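(* Let $\Gamma$ be a non-elementary word hyperbolic group, let $\mathbb{K}$ be $\mathbb{R}$ or $\mathbb{C}$, and let $V$ be a finite-dimensional vector space over $\mathbb{K}$. Let each of $G$ and $H$ be one of the groups $\mathrm{SL}(V)$, $\mathrm{SL}^*(V)=\{A\in\mathrm{GL}(V):|\det A|=1\}$, and $\mathrm{GL}(V)$. If the commutator subgroup $[\Gamma,\Gamma]$ has infinite index in $\Gamma$, then any connected component of the character variety $\mathrm{Hom}(\Gamma,G)/\!/H$ consisting entirely of $H$-equivalence classes of Anosov representations contains no $H$-equivalence classes of reducible representations.
   Context: $\mathrm{Hom}(\Gamma,G)$ carries the compact-open topology (equivalently, the topology as a subset of $G^\Sigma$ for a finite generating set $\Sigma$), and $H$ acts on it by post-composition with conjugation. Two representations are $H$-equivalent if the closures in $\mathrm{Hom}(\Gamma,G)$ of their $H$-orbits intersect; this is an equivalence relation, and the character variety $\mathrm{Hom}(\Gamma,G)/\!/H$ is the quotient with the quotient topology. For a linear endomorphism $A$ of $V$, $\lambda_1(A)\ge\dots\ge\lambda_{\dim V}(A)$ are the magnitudes of the complex roots of the characteristic polynomial, counted with multiplicity. For a finite generating set $\Sigma$ of $\Gamma$, $\|\gamma\|_\Sigma$ is the minimal word length of a conjugate of $\gamma$. With $\Delta_V=\{1,\dots,\dim_{\mathbb{K}}(V)-1\}$, a representation $\rho\colon\Gamma\to\mathrm{GL}(V)$ is $P_\theta$-Anosov ($\theta\subseteq\Delta_V$) if for each $k\in\theta$ there are constants $a_k>0$, $b_k\ge0$ with $\log(\lambda_k(\rho(\gamma))/\lambda_{k+1}(\rho(\gamma)))\ge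 a_k\|\gamma\|_\Sigma-b_k$ for all $\gamma\in\Gamma$. It is Anosov if it is $P_\theta$-Anosov for some non-empty $\theta\subseteq\Delta_V$. Equivalent representations have the same eigenvalue magnitudes, so being Anosov is a property of the equivalence class. A representation is reducible if it preserves a subspace $W$ with $\{0\}\subsetneq W\subsetneq V$. *)

(* Defs.v *)
From HB Require Import structures.
From mathcomp Require Import all_boot all_order all_fingroup all_algebra.
From mathcomp Require Import all_classical all_reals all_analysis.
From mathcomp Require Import complex.

Set Implicit Arguments.
Unset Strict Implicit.
Unset Printing Implicit Defensive.

Import Order.TTheory GRing.Theory Num.Theory.
Import numFieldNormedType.Exports.

Local Open Scope classical_set_scope.
Local Open Scope ring_scope.
Local Open Scope complex_scope.

Section Groups.
Local Open Scope group_scope.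
Variable Gamma : groupType.
Implicit Types (N A : set Gamma) (S : seq Gamma) (x y z w g : Gamma).

Definition is_subgroup N : Prop :=
  N 1 /\ forall x y, N x -> N y -> N (x * y^-1).

Definition generated_subgroup A : set Gamma := smallest is_subgroup A.

Definition commutator_subgroup : set Gamma :=
  generated_subgroup [set [~ p.1, p.2] | p in [set: Gamma * Gamma]].

Definition left_cosets N : set (set Gamma) :=
  [set [set x * y | y in N] | x in [set: Gamma]].

Definition finite_index N : Prop := finite_set (left_cosets N).

(* A hyperbolic group is elementary iff it is virtually cyclic. Finite groups  *)
(* are included, via the trivial subgroup.                                     *)
Definition virtually_cyclic : Prop :=
  exists g, finite_index (generated_subgroup [set g]).

Definition finite_generating_set S : Prop :=
  generated_subgroup [set` S] = [set: Gamma].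

Definition least (P : set nat) : nat :=
  xget 0%N [set n | P n /\ forall m, P m -> (n <= m)%N].

Definition is_word S : pred (seq Gamma) :=
  all (fun x => (x \in S) || (x^-1 \in S)).

Definition word_length S g : nat :=
  least [set n | exists w : seq Gamma,
           [/\ is_word S w, size w = n & \prod_(x <- w) x = g]].

Definition word_dist S x y : nat := word_length S (x^-1 * y).

Definition conj_length S g : nat :=
  least [set n | exists x, word_length S (g ^ x) = n].

(* Gromov's inequality (x|y)_w >= min((x|z)_w, (z|y)_w) - delta for all base   *)
(* points w, with the Gromov products written out in terms of distances.      *)
Definition gromov_hyperbolic (T : Type) (d : T -> T -> nat) : Prop :=
  exists delta : nat, forall x y z w : T,
    (d x y + d z w <=
     maxn (d x z + d y w) (d y z + d x w) + delta.*2)%N.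

Definition word_hyperbolic : Prop :=
  exists S, finite_generating_set S /\ gromov_hyperbolic (word_dist S).

End Groups.

Arguments commutator_subgroup Gamma : clear implicits.

Variant field_kind := RealNumbers | ComplexNumbers.

Definition scalars (R : realType) (F : field_kind) : numFieldType :=
  match F with RealNumbers => R | ComplexNumbers => R[i] end.

Definition to_complex (R : realType) (F : field_kind) : scalars R F -> R[i] :=
  match F with RealNumbers => fun x => x%:C | ComplexNumbers => fun z => z end.

Variant linear_group := SL | SLstar | GL.

Section LinearGroups.
Variables (K : numFieldType) (V : vectType K).

(* Coordinate row vectors are multiplied on the left, so this is the transpose *)
(* of the usual matrix of A; determinant, characteristic polynomial and        *)
(* topology are unaffected, and do not depend on the basis.                    *)
Definition endo_mx (A : 'End(V)) : 'M[K]_(\dim {:V}) :=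
  passmx.mxof (vbasis {:V}) (vbasis {:V}) A.

Definition in_group (G : linear_group) : set 'End(V) :=
  [set A | lker A = 0%VS /\
    match G with
    | SL => \det (endo_mx A) = 1
    | SLstar => `|\det (endo_mx A)| = 1
    | GL => True
    end].

End LinearGroups.

Section CharacterVariety.
Variables (K : numFieldType) (V : vectType K) (Gamma : groupType).
Variables (G H : linear_group).

Definition is_representation (rho : Gamma -> 'End(V)) : Prop :=
  [/\ forall g, in_group G (rho g),
      rho 1%g = \1%VF &
      forall g h, rho (g * h)%g = (rho g \o rho h)%VF].

Definition hom_set : set (Gamma -> 'End(V)) := [set rho | is_representation rho].

Definition hom_matrices (rho : hom_set) : {ptws Gamma -> 'M[K]_(\dim {:V})} :=
  fun g => endo_mx (\val rho g).

(* As Gamma is discrete, the compact-open topology is the topology of         *)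
(* pointwise convergence, i.e. the one induced by the product topology.       *)
Definition hom_space : Type := initial_topology hom_matrices.
HB.instance Definition _ := Topological.on hom_space.

Definition rep (rho : hom_space) : Gamma -> 'End(V) := \val rho.

Definition conj_orbit (rho : hom_space) : set hom_space :=
  [set sigma : hom_space | exists2 h : 'End(V), in_group H h &
     forall g, rep sigma g = (h \o rep rho g \o h^-1)%VF].

Definition h_equivalent (rho sigma : hom_space) : Prop :=
  closure (conj_orbit rho) `&` closure (conj_orbit sigma) !=set0.

Definition h_class (rho : hom_space) : set hom_space :=
  [set sigma | h_equivalent rho sigma].

(* [h_equivalent] is an equivalence relation, so this is the usual quotient;   *)
(* forming it as a set of classes does not require the proof.                  *)
Definition h_classes : Type := range h_class.

Definition class_of (rho : hom_space) : h_classes :=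
  exist _ (h_class rho) (mem_set (imageT h_class rho)).

Definition class_repr (c : h_classes) : hom_space := sval (cid2 (set_valP c)).

Lemma class_reprK : cancel class_repr class_of.
Proof.
move=> c; apply: val_inj => /=.
by rewrite /class_repr; case: cid2.
Qed.

HB.instance Definition _ := isQuotient.Build hom_space h_classes class_reprK.

Definition character_variety : Type := quotient_topology h_classes.
HB.instance Definition _ := Topological.on character_variety.

Definition char_class (rho : hom_space) : character_variety :=
  (\pi_(quotient_topology h_classes) rho)%qT.

End CharacterVariety.

Section Anosov.
Variables (R : realType) (F : field_kind) (V : vectType (scalars R F)).

Definition complex_char_poly (A : 'End(V)) : {poly R[i]} :=
  map_poly (@to_complex R F) (char_poly (endo_mx A)).

(* The roots of the characteristic polynomial, listed with multiplicity.       *)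
Definition complex_eigenvalues (A : 'End(V)) : seq R[i] :=
  sval (closed_field_poly_normal (complex_char_poly A)).

(* Indexed from k = 1, as lambda_1(A) >= ... >= lambda_{dim V}(A).             *)
Definition eigen_modulus (k : nat) (A : 'End(V)) : R :=
  nth 0 (sort >=%O [seq Normc.normc z | z <- complex_eigenvalues A]) k.-1.

Definition simple_roots : set nat := [set k | (0 < k < \dim {:V})%N].

Variables (Gamma : groupType) (Sigma : seq Gamma).

Definition P_anosov (theta : set nat) (rho : Gamma -> 'End(V)) : Prop :=
  forall k, theta k -> exists a b : R, [/\ 0 < a, 0 <= b &
    forall g : Gamma,
      a * (conj_length Sigma g)%:R - b
        <= ln (eigen_modulus k (rho g) / eigen_modulus k.+1 (rho g))].

Definition anosov (rho : Gamma -> 'End(V)) : Prop :=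
  exists theta : set nat,
    [/\ theta `<=` simple_roots, theta !=set0 & P_anosov theta rho].

Definition reducible (rho : Gamma -> 'End(V)) : Prop :=
  exists W : {vspace V},
    [/\ W != 0%VS, W != fullv & forall g, (rho g @: W <= W)%VS].

End Anosov.

(* Main.v *)
From HB Require Import structures.
Require Import Defs.
From mathcomp Require Import all_boot all_order all_fingroup all_algebra.
From mathcomp Require Import all_classical all_reals all_analysis.
From mathcomp Require Import complex zify ring lra.

Set Implicit Arguments.
Unset Strict Implicit.
Unset Printing Implicit Defensive.

Import Order.TTheory GRing.Theory Num.Theory.
Import numFieldNormedType.Exports.

Local Open Scope classical_set_scope.

Local Open Scope group_scope.

(** The idea.  Let [rho] be reducible, with class in the component.  Scaling the
    off-diagonal block to zero is a path of representations, so the component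
    contains the class of the block sum of the sub- and quotient representations;
    as [[Gamma, Gamma]] has infinite index there is a nonzero [phi : Gamma -> int],
    and twisting the two blocks by [exp (t b phi)] and [exp (- t a phi)], with [a]
    and [b] their dimensions, gives a further path.  Eigenvalue moduli are constant
    on closures of orbits, so every twist is Anosov itself.  This fails for large
    [t].  Suppose that there is a uniform gap at [k].  Choose [alpha] with
    [phi alpha != 0] and [beta] moving the axis of [alpha] away from itself, so that
    the conjugacy lengths of [w N m = alpha^(N-m) beta alpha^-m beta^-1], [m <= N],
    tend to infinity uniformly in [m] with [N].  Split the [k]-th elementary
    symmetric function of the eigenvalues of [w N m] into the part with [j]
    eigenvalues from the first block, [j] maximal, and the rest.  By the gap one part
    is much larger than the other for each [m]; for large [t] it is the first one at
    [m = 0] and the second one at [m = N].  But both parts satisfy, as sequences in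
    [m], one linear recurrence that does not depend on [N].  After passing to
    multiples of a fixed [M] no ratio of distinct characteristic roots is a root of
    unity; then the values of such a sequence on a Hilbert cube control it on a
    window of bounded length.  Since a two-colouring of a window contains a
    monochromatic cube, one part dominates on the whole window, and dominance
    cannot change from a window to the next. *)

(** * Hyperbolic groups *)

(** The weights [b] and [- a] of the two characters leave the determinant unchanged, so one
    deformation serves all three groups. The two ends of a run behave in opposite ways because
    [w N 0] is [alpha^N], [w N N] is conjugate to [alpha^-N], and
    [phi (w N m) = phi alpha * (N - 2 m)]: the twist favours the first block at one end and the
    second block at the other. The largest and the smallest number of eigenvalues that the first
    block can contribute to a product of [k] differ because both blocks are nonzero and
    [0 < k < a + b]. A gap makes one product of [k] eigenvalues dominant for each [m], so the number
    of its factors from the first block is well defined. The obstacle is that nothing continuous in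
    [m] prevents this number from jumping, since a recurrent sequence may be tiny at many single
    indices. Hilbert cubes are used because each of their directions [d] removes one characteristic
    root [x] through [T^d - x^d], and because, unlike intervals, they exist monochromatically in
    every colouring. The constants depend only on the recurrence, hence the size of gap that is
    needed can be fixed before [N]. *)

Section WordLength.
Variables (Gamma : groupType) (S : seq Gamma).
Hypothesis genS : finite_generating_set S.

Lemma leastP (P : set nat) : P !=set0 ->
  P (least P) /\ forall m, P m -> (least P <= m)%N.
Proof.
move=> [n Pn].
have exP : exists n, `[< P n >] by exists n; apply/asboolP.
have [k /asboolP Pk kmin] := ex_minnP exP.
rewrite /least; case: xgetP => [m -> [Pm mmin]|/(_ k) []]; first by split.
by split=> // m Pm; apply: kmin; apply/asboolP.
Qed.

Lemma word_exists g :
  exists w : seq Gamma, is_word S w /\ \prod_(x <- w) x = g.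
Proof.
have sub : is_subgroup [set g : Gamma | exists w : seq Gamma, is_word S w /\ \prod_(x <- w) x = g].
  split=> [|x y [u [Su <-]] [v [Sv <-]]]; first by exists [::]; rewrite big_nil.
  exists (u ++ rev [seq x^-1 | x <- v]); split.
    rewrite /is_word all_cat; apply/andP; split=> //.
    rewrite all_rev all_map; apply/allP => z zv /=.
    by rewrite invgK orbC; have /allP/(_ z zv) := Sv.
  rewrite big_cat /=; congr (_ * _); elim: v {Sv} => [|z v IHv] /=.
    by rewrite !big_nil invg1.
  by rewrite rev_cons -cats1 big_cat /= big_seq1 big_cons IHv invMg.
have /(_ g) : [set: Gamma] `<=` [set g : Gamma | exists w : seq Gamma, is_word S w /\ \prod_(x <- w) x = g].
  rewrite -[X in X `<=` _]genS; apply: smallest_sub => // x /= xS.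
  by exists [:: x]; rewrite big_seq1 /is_word /= xS.
by apply.
Qed.

Lemma word_length_word g : exists w : seq Gamma,
  [/\ is_word S w, size w = word_length S g & \prod_(x <- w) x = g].
Proof.
have [w [Sw wg]] := word_exists g.
have ne : [set n | exists w : seq Gamma,
           [/\ is_word S w, size w = n & \prod_(x <- w) x = g]] !=set0.
  by exists (size w), w.
by have [] := leastP ne.
Qed.

Lemma word_length_le (w : seq Gamma) :
  is_word S w -> (word_length S (\prod_(x <- w) x) <= size w)%N.
Proof.
move=> Sw.
have ne : [set n | exists v : seq Gamma,
   [/\ is_word S v, size v = n & \prod_(x <- v) x = \prod_(x <- w) x]] !=set0.
  by exists (size w), w.
by have [_] := leastP ne; apply; exists w.
Qed.

Lemma word_length1 : word_length S 1 = 0%N.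
Proof. by apply/eqP; rewrite -leqn0; have := @word_length_le [::] isT; rewrite big_nil. Qed.

Lemma word_lengthM g h : (word_length S (g * h) <= word_length S g + word_length S h)%N.
Proof.
have [u [Su <- <-]] := word_length_word g.
have [v [Sv <- <-]] := word_length_word h.
by rewrite -big_cat -size_cat /=; apply: word_length_le; rewrite /is_word all_cat; apply/andP.
Qed.

Lemma word_lengthV g : word_length S g^-1 = word_length S g.
Proof.
suff le x : (word_length S x^-1 <= word_length S x)%N.
  by apply/eqP; rewrite eqn_leq le -{1}[g]invgK le.
have [u [Su <- <-]] := word_length_word x.
rewrite -(size_map (fun x => x^-1)) -size_rev.
have -> : (\prod_(x <- u) x)^-1 = \prod_(x <- rev [seq x^-1 | x <- u]) x.
  elim: u {Su} => [|z v IHv] /=; first by rewrite !big_nil invg1.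
  by rewrite rev_cons -cats1 big_cat /= big_seq1 big_cons -IHv invMg.
apply: word_length_le.
rewrite /is_word all_rev all_map; apply/allP => z zv /=.
by rewrite invgK orbC; have /allP/(_ z zv) := Su.
Qed.

Lemma ball_finite n : finite_set [set g | (word_length S g <= n)%N].
Proof.
pose T := S ++ [seq x^-1 | x <- S].
pose f (t : {ffun 'I_n -> 'I_(size T).+1}) : Gamma :=
  \prod_(x <- [seq nth 1 T (t i) | i <- enum 'I_n]) x.
apply: (@sub_finite_set _ _ (f @` setT)); last exact/finite_image/finite_finset.
move=> g /= gn; have [w [Sw sw <-]] := word_length_word g.
(* The index [ord_max] points beyond the end of [T], where [nth] returns [1]; it pads shorter words
   to length [n]. *)
pose t := [ffun i : 'I_n => if (i < size w)%N then inord (index (nth 1 w i) T) else ord_max : 'I_(size T).+1].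
exists t => //; rewrite /f.
have wT x : x \in w -> x \in T.
  move=> xw; have /allP/(_ x xw)/orP[xS|xS] := Sw; rewrite mem_cat ?xS //.
  by apply/orP; right; rewrite -[x]invgK; apply: map_f.
have -> : [seq nth 1 T (t i) | i <- enum 'I_n] = w ++ nseq (n - size w) 1.
  apply: (@eq_from_nth _ 1); first by rewrite size_map size_enum_ord size_cat size_nseq sw subnKC.
  move=> i; rewrite size_map size_enum_ord => ilt.
  rewrite (nth_map (Ordinal ilt)) ?size_enum_ord // [RHS]nth_cat.
  have -> : nth (Ordinal ilt) (enum 'I_n) i = Ordinal ilt by apply: val_inj; rewrite /= nth_enum_ord.
  rewrite ffunE /=; case: ltnP => iw; last by rewrite nth_nseq if_same nth_default.
  rewrite inordK; last by rewrite ltnS index_size.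
  by rewrite nth_index // wT // mem_nth.
rewrite big_cat /= [X in _ * X]big1_seq ?mulg1 // => x /=.
by rewrite mem_nseq => /andP[_ /eqP].
Qed.

(** Used for the absolute value of [phi] and for comparing the word lengths of two generating
    sets. *)
Lemma subadditive_le_length (f : Gamma -> nat) :
  (forall g h : Gamma, (f (g * h)%g <= f g + f h)%N) -> f 1 = 0%N ->
  exists C, forall g, (f g <= C * word_length S g)%N.
Proof.
move=> fM f1.
exists (\sum_(x <- S) f x + \sum_(x <- S) f x^-1)%N => g.
have [w [Sw <- <-]] := word_length_word g.
elim: w Sw => [|x w IHw] /=; first by rewrite big_nil f1.
move=> /andP[Sx /IHw{}IHw]; rewrite big_cons mulnS; apply: leq_trans (fM _ _) _.
apply: leq_add => //.
case/orP: Sx => xS.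
  by rewrite (big_rem x) //=; lia.
by rewrite [X in (_ <= _ + X)%N](big_rem x^-1) //= invgK; lia.
Qed.

End WordLength.

Section Hyperbolic.
Variables (Gamma : groupType) (l : Gamma -> nat) (D : nat) (phi : Gamma -> int).
Hypothesis l1 : l 1 = 0%N.
Hypothesis lM : forall g h : Gamma, (l (g * h)%g <= l g + l h)%N.
Hypothesis lV : forall g, l g^-1 = l g.
Hypothesis hyp : forall x y z w : Gamma,
  (l (x^-1 * y)%g + l (z^-1 * w)%g <=
   maxn (l (x^-1 * z)%g + l (y^-1 * w)%g) (l (y^-1 * z)%g + l (x^-1 * w)%g) + D)%N.
Hypothesis phiM : forall g h : Gamma, phi (g * h)%g = (phi g + phi h)%R.

Let d x y := l (x^-1 * y).

Let dC x y : d x y = d y x.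
Proof. by rewrite /d -lV invMg invgK. Qed.

Let dD x y z : (d x z <= d x y + d y z)%N.
Proof.
rewrite /d; have ->: x^-1 * z = (x^-1 * y) * (y^-1 * z) by rewrite mulgA mulgK.
exact: lM.
Qed.

Let dM g x y : d (g * x) (g * y) = d x y.
Proof. by rewrite /d invMg mulgA mulgVK. Qed.

Let d1 x : d 1 x = l x.
Proof. by rewrite /d invg1 mul1g. Qed.

Let dhyp x y z w : (d x y + d z w <= maxn (d x z + d y w) (d y z + d x w) + D)%N.
Proof. exact: hyp. Qed.

Lemma phi1 : phi 1 = 0%R.
Proof. by apply: (addrI (phi 1)); rewrite -phiM mulg1 addr0. Qed.

Lemma phiV g : phi g^-1 = (- phi g)%R.
Proof. by apply: (addrI (phi g)); rewrite -phiM mulgV phi1 subrr. Qed.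

Lemma phiX g n : phi (g ^+ n) = (phi g * n%:Z)%R.
Proof.
elim: n => [|n IHn]; first by rewrite phi1 mulr0.
by rewrite expgS phiM IHn intS mulrDr mulr1.
Qed.

Let lKl a c : (l c <= l (a * c) + l a)%N.
Proof. by have := lM a^-1 (a * c); rewrite mulKg lV addnC. Qed.

Let lKr a c : (l c <= l (c * a) + l a)%N.
Proof. by have := lM (c * a) a^-1; rewrite mulgK lV. Qed.

(* The four-point condition for [1], [g ^+ 2], [g] and [g * x]. *)
Lemma length_conj g x : (l (g ^+ 2) <= l g + l (g ^ x) + D)%N.
Proof.
have := dhyp 1 (g * g) g (g * x).
have := dD (g * x) g x; 
have := dD 1 g (g * x).
have h1 : d (g * x) x = l (g ^ x) by rewrite dC.
have h2 : d (g * g) (g * x) = d g x by rewrite dM.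
have h3 : d g (g * x) = l x by rewrite -{1}[g]mulg1 dM d1.
have h4 : d (g * g) g = l g by rewrite dC -{1}[g]mulg1 dM d1.
have h5 : d g x = d x g by rewrite dC.
have := dD g (g * x) x.
have h6 : d 1 (g * g) = l (g ^+ 2) by rewrite d1 expg2.
have := dD 1 x (g * x).
have := d1 x; have := d1 g; have := d1 (g * x); have := dC x (g * x).
lia.
Qed.

(** * The axis of an element whose square is long enough *)

Section Axis.
Variable h : Gamma.
Hypothesis phih : phi h != 0.
Let b n := l (h ^+ n).
Hypothesis b2 : (b 1 + D.*2.+1 <= b 2)%N.

Let b0 : b 0 = 0%N. Proof. exact: l1. Qed.

Let db i j : (i <= j)%N -> d (h ^+ i) (h ^+ j) = b (j - i).
Proof. by move=> ij; rewrite /d -{1}(subnKC ij) expgnDr mulKg. Qed.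

Let pt x i := x * h ^+ i.

Let pt0 x : pt x 0 = x. Proof. exact: mulg1. Qed.

Let dbx x i j : (i <= j)%N -> d (pt x i) (pt x j) = b (j - i).
Proof. by move=> ij; rewrite dM db. Qed.

Let bD i j : (b (i + j) <= b i + b j)%N.
Proof. by rewrite /b expgnDr lM. Qed.

Let b_le i : (b i <= i * b 1)%N.
Proof. by elim: i => [|i IHi]; rewrite ?b0 // -addn1; have := bD i 1; lia. Qed.

Let bM x i : (l (pt x i) <= l x + b i)%N.
Proof. exact: lM. Qed.

(** The four-point condition for [1], [h ^+ 2], [h] and [h ^+ n.+2] propagates the first increment
    [b 2 - b 1]: the induction hypothesis excludes one alternative, and the other loses only [D]. *)
Lemma axis_incr n : (b n + D.+1 <= b n.+1)%N.
Proof.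
elim: n => [|n IHn]; first by have := bD 1 1; rewrite addn1 b0; lia.
have := dhyp (h ^+ 0) (h ^+ 2) (h ^+ 1) (h ^+ n.+2).
rewrite [d (h ^+ 2) (h ^+ 1)]dC !db //.
by rewrite subn0 !subSS !subn0; lia.
Qed.

Let b_mono i j : (i <= j)%N -> (b i + (j - i) <= b j)%N.
Proof.
move=> /subnKC <-; elim: (j - i)%N => [|k IHk]; first by rewrite addn0; lia.
by rewrite addnS; have := axis_incr (i + k); lia.
Qed.

Lemma axis_ge n : (n <= b n)%N.
Proof. by have := @b_mono 0 n; rewrite b0; lia. Qed.

(** The powers of [h] run along a geodesic up to a bounded error. Since [b] grows by more than [D]
    at each step, one alternative of the four-point condition for [1], two consecutive powers and a
    later power is impossible. *)
Lemma axis_additive i j : (b i + b j <= b (i + j) + b 1 + D)%N.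
Proof.
case: j => [|j]; first by rewrite addn0 b0; lia.
have := dhyp (h ^+ 0) (h ^+ i.+1) (h ^+ i) (h ^+ (i + j.+1)).
rewrite [d (h ^+ i.+1) (h ^+ i)]dC !db ?leq_addr //; try lia.
rewrite !subn0 subSnn.
have -> : (i + j.+1 - i = j.+1)%N by lia.
have -> : (i + j.+1 - i.+1 = j)%N by lia.
by have := axis_incr i; have := axis_incr j; lia.
Qed.

(** Take the least [n] such that [x] lies, up to an error, between [1] and [h ^+ n]. As this fails
    for the preceding exponent, the four-point condition places [x] between that power and [h ^+ N];
    both facts together put [x] close to [h ^+ n]. *)
Lemma near_axis (K N : nat) x :
  (l x + d (h ^+ N) x <= b N + K)%N ->
  exists2 n, (n <= N)%N & (d (h ^+ n) x <= 3 * b 1 + 3 * D + 2 * K)%N.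
Proof.
move=> xK.
pose P n := (l x + d (h ^+ n) x <= b n + K + D)%N.
have PQ n : (n <= N)%N -> ~~ P n -> (d (h ^+ n) x + d (h ^+ N) x <= b (N - n) + K + D)%N.
  move=> nN; rewrite /P => Pn.
  have := dhyp (h ^+ 0) (h ^+ N) (h ^+ n) x.
  rewrite [d (h ^+ N) (h ^+ n)]dC !db // !subn0 d1; lia.
have exP : exists n, P n by exists N; rewrite /P; lia.
have [n Pn nmin] := ex_minnP exP.
have nN : (n <= N)%N by apply: nmin; rewrite /P; lia.
exists n => //.
case: n Pn nmin nN => [|n] Pn nmin nN.
  by move: Pn; rewrite /P b0 d1; lia.
have nP : ~~ P n by apply/negP => /nmin; rewrite ltnn.
have := PQ n (ltnW nN) nP; have := dD (h ^+ n.+1) (h ^+ n) x.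
have := bD (N - n.+1) 1; have -> : (N - n.+1 + 1 = N - n)%N by lia.
rewrite [d (h ^+ n.+1) (h ^+ n)]dC !db // subSnn.
have := axis_additive n.+1 (N - n.+1); rewrite subnKC //.
have := dD 1 x (h ^+ N); rewrite !d1 [d x _]dC.
by move: Pn; rewrite /P /b; lia.
Qed.

(** The bound of [near_axis] for the error [b 1 + 3 * D] that arises in [fellow_travel]. It does not
    depend on [beta], and it is the same for [h] and [h^-1], so a single finite ball serves
    throughout. *)
Definition axis_radius := (5 * l h + 9 * D)%N.

(** As [b m] exceeds [l beta], the point [beta * h ^+ m] lies nearly between [1] and
    [beta * h ^+ M]. The last hypothesis says that it does not lie between [h ^+ N] and
    [beta * h ^+ M]; the four-point condition then leaves it between [1] and [h ^+ N]. *)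
Lemma fellow_travel beta (m M N : nat) : (m <= M)%N ->
  (l beta + b 1 + D.*2 < b m)%N ->
  (d (h ^+ N) (pt beta M) + b 1 + 3 * D <
    d (h ^+ N) (pt beta m) + d (pt beta M) (pt beta m))%N ->
  exists2 n, (n <= N)%N & (d (h ^+ n) (pt beta m) <= axis_radius)%N.
Proof.
move=> mM bm far; set x := pt beta m in far *.
have e1 : d beta x = b m by rewrite -{1}[beta]pt0 dbx // subn0.
have e2 : d (pt beta M) x = b (M - m) by rewrite dC dbx.
have e3 : d beta (pt beta M) = b M by rewrite -{1}[beta]pt0 dbx // subn0.
have e4 := axis_additive m (M - m); rewrite subnKC // in e4.
have e5 := dD beta 1 x; rewrite dC !d1 in e5.
have e6 := dD 1 beta x; rewrite !d1 in e6.
have step1 : (l x + d (pt beta M) x <= l (pt beta M) + b 1 + D.*2)%N.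
  have := dhyp beta (pt beta M) 1 x.
  by rewrite [d _ 1]dC [d (pt beta M) 1]dC !d1; lia.
have [|n nN nx] := @near_axis (b 1 + 3 * D) N x.
  have := dhyp 1 (pt beta M) (h ^+ N) x.
  by rewrite [d (pt beta M) (h ^+ N)]dC !d1 -/(b N); lia.
exists n => //; rewrite /axis_radius.
by move: nx; rewrite /b !expg1; lia.
Qed.

(** A bound on twice the Gromov product at [1] of [beta * h ^+ m] and [h ^+ n]: the forward end of
    the axis is not fixed by [beta]. The backward end is treated by taking [h^-1] for [h]. *)
Definition bounded_product beta := exists K, forall m n,
  (l (beta * h ^+ m) + l (h ^+ n) <= l ((beta * h ^+ m)^-1 * h ^+ n) + K)%N.

(* If [beta] keeps an end of the axis, then each far [beta * h ^+ m] is within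
   [axis_radius] of some [h ^+ n]; two of the differences agree, and [phi] then
   forces the exponents to shift by the same amount. *)
Lemma commute_power beta (s : seq Gamma) :
  (forall g, (l g <= axis_radius)%N -> g \in s) ->
  ~ bounded_product beta ->
  exists2 e, (0 < e <= size s)%N & commute beta (h ^+ e).
Proof.
move=> sball nbd.
have key m : (l beta + b 1 + D.*2 < m)%N ->
    exists n, h ^- n * (pt beta m) \in s.
  move=> mbig.
  (* The excess is chosen so large that it forces [m <= M] and keeps [beta * h ^+ m] from lying
     between [h ^+ N] and [beta * h ^+ M]. *)
  have [M [N MN]] : exists M N, (d (pt beta M) (h ^+ N) +
     (2 * l beta + 2 * b m + 2 * m * b 1 + b 1 + 3 * D + 1) <= l (pt beta M) + b N)%N.
    apply: contrapT => nex; apply: nbd.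
    exists (2 * l beta + 2 * b m + 2 * m * b 1 + b 1 + 3 * D + 1)%N => M N.
    rewrite -/(pt beta M) -/(d _ _) -/(b N).
    rewrite leqNgt; apply/negP => lt; apply: nex; exists M, N; exact: ltnW.
  have tM := bM beta M.
  have tri := dD 1 (pt beta M) (h ^+ N); rewrite !d1 -/(b N) in tri.
  have mM : (m <= M)%N.
    rewrite leqNgt; apply/negP => lt; have := b_le M.
    have : (M * b 1 <= m * b 1)%N by rewrite leq_mul2r (ltnW lt) orbT.
    by lia.
  have tm := bM beta m.
  have tr1 := dD 1 (pt beta m) (h ^+ N).
  have tr2 := dD 1 (pt beta m) (pt beta M).
  rewrite !d1 -/(b N) in tr1 tr2.
  have := axis_ge m => bm.
  have [||n nN] := @fellow_travel beta m M N mM; first by lia.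
    rewrite [d (h ^+ N) (pt beta m)]dC [d (pt beta M) (pt beta m)]dC.
    by rewrite [d (h ^+ N) _]dC; lia.
  by move=> /sball; exists n.
pose m0 := (l beta + b 1 + D.*2).+1.
have key' (i : 'I_(size s).+1) : exists n, h ^- n * (pt beta (m0 + i)) \in s.
  by apply: key; rewrite /m0; lia.
have [f fP] := choice key'.
pose idx (i : 'I_(size s).+1) := index (h ^- (f i) * (pt beta (m0 + i))) s.
have idxlt i : (idx i < size s)%N by rewrite index_mem.
pose F i := Ordinal (idxlt i).
have nF : ~ injective F.
  by move=> /leq_card; rewrite !card_ord; lia.
have [i [j [ij eFij]]] : exists i j : 'I_(size s).+1, (i < j)%N /\ F i = F j.
  apply: contrapT => nex; apply: nF => i j eF; apply: val_inj => /=.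
  by case: (ltngtP i j) => // lt; exfalso; apply: nex; [exists i, j|exists j, i].
have eg : h ^- (f i) * (pt beta (m0 + i)) = h ^- (f j) * (pt beta (m0 + j)).
  by rewrite -(nth_index 1 (fP i)) -(nth_index 1 (fP j)); congr nth; case: eFij.
have fij : (f j = f i + (j - i))%N.
  move: eg => /(congr1 phi); rewrite /pt !phiM !phiV !phiX => e.
  have : (phi h * ((f j)%:Z + i%:Z - (f i)%:Z - j%:Z))%R = 0%R.
    by move: e; rewrite !PoszD => e; apply/eqP; rewrite -(subrr (- (phi h * (f i)%:Z) + (phi beta + phi h * (m0%:Z + i%:Z)))%R) {2}e; apply/eqP; ring.
  by move/eqP; rewrite mulf_eq0 (negbTE phih) /=; lia.
exists (j - i)%N; first by have := ltn_ord j; lia.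
rewrite /commute; apply: (mulgI (h ^- (f j))).
apply: (mulIg (h ^+ (m0 + i))).
have ej : (m0 + j = (j - i) + (m0 + i))%N by lia.
move: eg; rewrite /pt ej; set c := (m0 + i)%N; rewrite [h ^+ (_ + c)]expgnDr !mulgA => <-.
by congr (_ * _ * _); rewrite fij [(f i + _)%N]addnC expgnDr invMg mulgVK.
Qed.

(** For multiples [m] of [E] the point [beta * h ^+ m = h ^+ m * beta] is within [l beta] of the
    axis. With [Z] a large multiple, [fellow_travel] improves this to a bound that does not depend
    on [beta], so that all such [beta] fall into finitely many cosets of the powers of [h]. *)
Lemma near_axis_of_central beta E : (0 < E)%N -> commute beta (h ^+ E) ->
  exists i n, (l (h ^- n * (h ^+ i * beta)) <= axis_radius)%N.
Proof.
move=> E0 cE; pose Z := (E * (l beta + b 1 + 4 * D + 1))%N.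
have cZ k : commute beta (h ^+ (Z * k)).
  by rewrite /Z -!mulnA expgnA; apply: commuteX.
have Zbig : (l beta + b 1 + 4 * D < b Z)%N.
  by apply: leq_trans (axis_ge Z); rewrite /Z; nia.
have far : (d (h ^+ (Z + Z)) (pt beta (Z + Z)) = l beta)%N.
  have := cZ 2%N; rewrite muln2 -addnn /commute => cZ2.
  by rewrite /pt cZ2 -{1}[h ^+ _]mulg1 dM d1.
have e1 : d (pt beta (Z + Z)) (pt beta Z) = b Z by rewrite dC dbx ?leq_addr // addnK.
have e2 : (b Z <= d (h ^+ (Z + Z)) (pt beta Z) + l beta)%N.
  have : d (h ^+ Z) (pt beta Z) = l beta.
    by have := cZ 1%N; rewrite muln1 /pt => ->; rewrite -{1}[h ^+ _]mulg1 dM d1.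
  have := dD (h ^+ (Z + Z)) (pt beta Z) (h ^+ Z).
  rewrite [d (h ^+ (Z + Z)) (h ^+ Z)]dC db ?leq_addr // addnK [d (pt beta Z) _]dC.
  by lia.
have [||n _ nr] := @fellow_travel beta Z (Z + Z) (Z + Z) (leq_addr _ _).
- by lia.
- by rewrite far e1; lia.
by exists Z, n; have := cZ 1%N; rewrite muln1 => <-.
Qed.

End Axis.

(** The ends of the second factor [beta * h ^- m * beta^-1] avoid those of [h ^+ N] where they could
    cancel: the hypothesis on [h^-1] makes the product [g] long, the one on [h] makes [g * g] about
    twice as long. By [length_conj] the difference of the lengths of [g ^+ 2] and [g] bounds the
    length of every conjugate from below. *)
Lemma conj_length_growth (h beta : Gamma) (K N m : nat) : phi h != 0 ->
  (l (h ^+ 1) + D.*2.+1 <= l (h ^+ 2))%N ->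
  (forall m n, (l (beta * h ^+ m) + l (h ^+ n) <= l ((beta * h ^+ m)^-1 * h ^+ n) + K)%N) ->
  (forall m n, (l (beta * h^-1 ^+ m) + l (h^-1 ^+ n) <= l ((beta * h^-1 ^+ m)^-1 * h^-1 ^+ n) + K)%N) ->
  (2 * l beta + K + 2 * D < N)%N -> (2 * l beta + K + 2 * D < m)%N ->
  forall x, (N + m <= l ((h ^+ N * (beta * h ^- m * beta^-1)) ^ x) + 2 * l beta + 2 * K + 3 * D)%N.
Proof.
move=> phih b2 bdp bdn; set g := h ^+ N * _ => Nbig mbig x.
have hN := axis_ge phih b2 N; have hm := axis_ge phih b2 m.
pose p := h ^+ N; pose q := beta * h ^+ m; pose r := h ^+ N * (beta * h ^- m).
have hN' : (N <= l p)%N by [].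
have gr : g = r * beta^-1 by rewrite /g /r !mulgA.
have lr : (l p + l (h ^+ m) <= l r + l beta + K)%N.
  have := bdn m N; rewrite !expVgn lV -/p invMg invgK; set y := l (beta * h ^- m) => bd.
  have : (l (h ^+ m) <= y + l beta)%N.
    by rewrite -[l (h ^+ m)]lV; apply: lKl.
  have er : l (h ^+ m * beta^-1 * h ^- N) = l r by rewrite /r -[RHS]lV !invMg invgK.
  by move: bd; rewrite er; lia.
have lgr : (l r <= l g + l beta)%N.
  by rewrite gr -[l beta]lV; apply: lKr.
have lq : (l (h ^+ m) <= l q + l beta)%N.
  exact: lKl.
have dpg : (d p g <= l (h ^+ m) + 2 * l beta)%N.
  have -> : d p g = l (beta * h ^- m * beta^-1) by rewrite /d /g mulKg.
  have := lM (beta * h ^- m) beta^-1; have := lM beta (h ^- m); rewrite !lV; lia.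
have dqg : (d q g^-1 <= l p + l beta)%N.
  rewrite dC /d invgK.
  have -> : g * q = h ^+ N * beta by rewrite /g /q -!mulgA mulKg mulVg mulg1.
  exact: lM.
have dpq : (l q + l p <= d q p + K)%N by exact: bdp.
(* Up to bounded errors [p] lies between [1] and [g], and [q] between [1] and [g^-1], so the bound
   on the Gromov product of [p] and [q] passes to [g] and [g^-1]. *)
have := dhyp p q g 1; have := dhyp g q g^-1 1; have := length_conj g x.
have -> : l (g ^+ 2) = d g^-1 g by rewrite /d invgK expg2.
rewrite [d g g^-1]dC [d q p]dC [d g 1]dC [d q 1]dC [d p 1]dC [d g^-1 1]dC !d1 in dpq *.
rewrite [d q g]dC in dpq *; rewrite [d g q]dC; rewrite lV.
by lia.
Qed.

End Hyperbolic.

Section HyperbolicGroup.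

Lemma exp_beats_linear (x c L : nat) : exists j, (L * (x + j * c) < 2 ^ j)%N.
Proof.
pose i := (L * x + 2 * (L * c))%N.
exists (i + i)%N; rewrite expnD.
have : (i < 2 ^ i)%N by rewrite ltn_expl.
move: (2 ^ i)%N => y; rewrite /i; nia.
Qed.

(** Otherwise each doubling of the exponent adds at most [c] to the length, so the length of
    [g ^+ (2 ^ j)] grows only linearly in [j], against the hypothesis. *)
Lemma exists_growing_power (Gamma : groupType) (l : Gamma -> nat) (c L : nat) (g : Gamma) :
  (forall n, (n <= L * l (g ^+ n))%N) ->
  exists2 k, (0 < k)%N & (l (g ^+ k) + c <= l (g ^+ k ^+ 2))%N.
Proof.
move=> gL; apply: contrapT => nex.
have le j : (l (g ^+ (2 ^ j)) <= l g + j * c)%N.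
  elim: j => [|j IHj]; first by rewrite expg1; lia.
  suff : (l (g ^+ (2 ^ j) ^+ 2) <= l (g ^+ (2 ^ j)) + c)%N.
    by rewrite expnSr expgnA mulSn addnCA => ?; apply: leq_trans (leq_add (leqnn c) IHj); rewrite addnC.
  rewrite leqNgt; apply/negP => lt; apply: nex; exists (2 ^ j)%N; rewrite ?expn_gt0 //.
  exact: ltnW.
have [j lt] := exp_beats_linear (l g) c L.
have := gL (2 ^ j)%N; have := leq_mul (leqnn L) (le j); lia.
Qed.

Variables (Gamma : groupType) (Sigma : seq Gamma) (phi : Gamma -> int).
Hypothesis hypG : word_hyperbolic Gamma.
Hypothesis nvc : ~ virtually_cyclic Gamma.
Hypothesis genSigma : finite_generating_set Sigma.
Hypothesis phiM : forall g h : Gamma, phi (g * h)%g = (phi g + phi h)%R.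

(** Applied to [x^-1], the hypothesis gives an [a] in [A] such that [x] and [a^-1] lie in the same
    left coset of the subgroup generated by [h]. *)
Lemma virtually_cyclic_of_near_axis (h : Gamma) (A : set Gamma) : finite_set A ->
  (forall beta : Gamma, exists i n, A (h ^- n * (h ^+ i * beta))) ->
  virtually_cyclic Gamma.
Proof using.
move=> finA near; exists h; pose N := generated_subgroup [set h].
have Nh : N h by apply: sub_gen_smallest.
have [N1 ND] : is_subgroup N.
  split=> [B [[B1 _] _] //|x y Nx Ny B BN].
  by have [[_ BD] _] := BN; apply: BD; [apply: Nx|apply: Ny].
have NV x : N x -> N x^-1 by move=> Nx; rewrite -[x^-1]mul1g; apply: ND.
have NM x y : N x -> N y -> N (x * y) by move=> Nx Ny; rewrite -[y]invgK; apply: ND => //; exact: NV.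
have NX n : N (h ^+ n) by elim: n => [//|n IHn]; rewrite expgS; apply: NM.
apply: (@sub_finite_set _ _ ((fun a => [set a^-1 * y | y in N]) @` A)); last exact: finite_image.
move=> _ [x _ <-] /=; have [i [n Aa]] := near x^-1.
exists (h ^- n * (h ^+ i * x^-1)) => //.
rewrite !invMg !invgK; apply/seteqP; split=> _ [y Ny <-].
  by exists (h ^- i * (h ^+ n * y)); rewrite ?mulgA //; do 2!apply: (NM) => //; exact: NV.
exists (h ^- n * (h ^+ i * y)); first by apply: (NM); [exact: NV|exact: NM].
by rewrite -!mulgA mulVKg mulKg.
Qed.

(** Since [phi] is at most proportional to the length, the lengths of the powers of [g] grow
    linearly and some power [h] has an axis. Hyperbolicity concerns the generators [S], conjugacy
    length the generators [Sigma]; the constant [C] relates the two. *)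
Lemma exists_growing_conj_length (g : Gamma) : phi g != 0 ->
  exists alpha beta : Gamma, phi alpha != 0 /\
    forall K, exists N0, forall N m, (N0 <= N)%N -> (m <= N)%N ->
      (K <= conj_length Sigma (alpha ^+ (N - m) * (beta * alpha ^- m * beta^-1)))%N.
Proof.
move=> phig; have [S [genS [delta hypS]]] := hypG.
pose l := word_length S; pose D := delta.*2.
have l1 := word_length1 S : l 1 = 0%N.
have lM := word_lengthM genS : forall g h : Gamma, (l (g * h)%g <= l g + l h)%N.
have lV := word_lengthV genS : forall g, l g^-1 = l g.
have [L phiL] : exists L, forall g, (absz (phi g) <= L * l g)%N.
  apply: (subadditive_le_length genS) => [x y|]; last by rewrite (phi1 phiM).
  by rewrite phiM; lia.
have [C lC] := subadditive_le_length genSigma lM l1.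
have [k k0 hk] : exists2 k, (0 < k)%N & (l (g ^+ k) + D.*2.+1 <= l (g ^+ k ^+ 2))%N.
  apply: (@exists_growing_power _ _ _ L) => n; apply: leq_trans (phiL _).
  by rewrite (phiX phiM); nia.
pose h := g ^+ k.
have phih : phi h != 0 by rewrite /h (phiX phiM); nia.
have b2 : (l (h ^+ 1) + D.*2.+1 <= l (h ^+ 2))%N by [].
have phihV : phi h^-1 != 0 by rewrite (phiV phiM); lia.
have b2V : (l (h^-1 ^+ 1) + D.*2.+1 <= l (h^-1 ^+ 2))%N by rewrite !expVgn !lV.
(* If every [beta] fixes an end, each one commutes with some [h ^+ e], [0 < e <= size s]. The
   factorial of [size s] is then an exponent common to all [beta], and [near_axis_of_central] makes
   the group virtually cyclic. *)
have [beta [bd bdV]] : exists beta, bounded_product l h beta /\ bounded_product l h^-1 beta.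
  apply: contrapT => nex.
  have [s sE] : exists s : seq Gamma, forall x, (l x <= axis_radius l D h)%N -> x \in s.
    have /finite_setP := ball_finite genS (axis_radius l D h); move=> /finite_seqP[s sE].
    by exists s => x lx; have : [set` s] x by rewrite -sE.
  have sEV : forall x, (l x <= axis_radius l D h^-1)%N -> x \in s.
    by rewrite /axis_radius lV.
  apply: nvc; apply: (virtually_cyclic_of_near_axis (ball_finite genS (axis_radius l D h))) => beta.
  have cE : commute beta (h ^+ (size s)`!).
    have [bd|nbd] := pselect (bounded_product l h beta).
      have nbd : ~ bounded_product l h^-1 beta by move=> bdV; apply: nex; exists beta.
      have [e es ce] := commute_power l1 lM lV hypS phiM phihV b2V sEV nbd.
      have : (e %| (size s)`!)%N by rewrite dvdn_fact.
      move=> /dvdnP[q ->]; rewrite mulnC expgnA; apply: commuteX.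
      by rewrite -[h ^+ e]invgK -expVgn; apply: commuteV.
    have [e es ce] := commute_power l1 lM lV hypS phiM phih b2 sE nbd.
    have : (e %| (size s)`!)%N by rewrite dvdn_fact.
    by move=> /dvdnP[q ->]; rewrite mulnC expgnA; apply: commuteX.
  have [i [n ln]] := near_axis_of_central l1 lM lV hypS phih b2 (fact_gt0 _) cE.
  by exists i, n; exact: ln.
have [K1 bd1] := bd; have [K2 bd2] := bdV; pose K0 := (K1 + K2)%N.
have {}bd1 (m n : nat) : (l (beta * h ^+ m)%g + l (h ^+ n)%g <= l ((beta * h ^+ m)^-1 * h ^+ n)%g + K0)%N.
  by apply: leq_trans (bd1 m n) _; rewrite leq_add2l leq_addr.
have {}bd2 (m n : nat) : (l (beta * h^-1 ^+ m)%g + l (h^-1 ^+ n)%g <= l ((beta * h^-1 ^+ m)^-1 * h^-1 ^+ n)%g + K0)%N.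
  by apply: leq_trans (bd2 m n) _; rewrite leq_add2l leq_addl.
exists h, beta; split=> // K.
exists (2 * (L * (C * K)) + 4 * l beta + 4 * K0 + 6 * D + C * K + 2)%N => N m Nbig mN.
set w := h ^+ _ * _.
have [x xw] : exists x, word_length Sigma (w ^ x)%g = conj_length Sigma w.
  by have [] := @leastP [set n | exists x, word_length Sigma (w ^ x)%g = n] (ex_intro _ _ (ex_intro _ 1 erefl)).
rewrite -xw {xw}; rewrite leqNgt; apply/negP => lt.
have lw : (l (w ^ x)%g <= C * K)%N.
  by apply: leq_trans (lC _) _; rewrite leq_mul2l (ltnW lt) orbT.
(* As [phi] is invariant under conjugation, a short conjugate of [w] forces [N - 2 m] to be small.
   Then [N - m] and [m] are both about half of [N], as [conj_length_growth] requires. *)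
have phiw : phi (w ^ x)%g = (phi h * ((N - m)%:Z - m%:Z))%R.
  rewrite conjgE /w !phiM !(phiV phiM) !(phiX phiM); ring.
have := phiL (w ^ x); rewrite phiw => pw.
have {}pw : (absz ((N - m)%:Z - m%:Z)%R <= L * (C * K))%N.
  apply: leq_trans (leq_trans pw _); last by rewrite leq_mul2l lw orbT.
  by rewrite abszM leq_pmull // absz_gt0.
have gr : (N - m + m <= l (w ^ x)%g + 2 * l beta + 2 * K0 + 3 * D)%N.
  by apply: (conj_length_growth l1 lM lV hypS phih b2 bd1 bd2); lia.
by lia.
Qed.

End HyperbolicGroup.

Local Open Scope ring_scope.

(** * Homomorphisms to the integers *)

Lemma common_denominator (I : finType) (u : I -> rat) :
  exists2 d : int, 0 < d & forall i, exists w : int, d%:~R * u i = w%:~R.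
Proof.
exists (\prod_i denq (u i)); first by apply: prodr_gt0 => i _; exact: denq_gt0.
move=> i; exists (numq (u i) * \prod_(j | j != i) denq (u j)).
rewrite (bigD1 i) //= !rmorphM /= mulrAC; congr (_ * _).
by rewrite -{2}[u i]divq_num_den mulrC mulfVK // intr_eq0 denq_eq0.
Qed.

(** Consider the relations among the generators over the rationals. If they have full rank, every
    generator is torsion and [A] is finite. If not, a nonzero column of the cokernel matrix, cleared
    of denominators, is an integral functional that vanishes on all relations and descends to
    [A]. *)
Lemma fg_zmod_hom (A : zmodType) (r : nat) (s : 'I_r -> A) :
  (forall a, exists v : 'rV[int]_r, a = \sum_i s i *~ v 0 i) ->
  ~ finite_set [set: A] ->
  exists2 f : A -> int, {morph f : a b / a + b} & exists a, f a != 0.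
Proof.
move=> gen infA.
pose ev (v : 'rV[int]_r) := \sum_i s i *~ v 0 i.
have evD : {morph ev : v w / v + w}.
  by move=> v w; rewrite /ev -big_split; apply: eq_bigr => i _; rewrite mxE mulrzDr.
have evZ c v : ev (c *: v) = ev v *~ c.
  rewrite /ev mulrz_suml; apply: eq_bigr => i _; rewrite mxE.
  by rewrite mulrC mulrzA.
have evN v : ev (- v) = - ev v by rewrite -scaleN1r evZ mulrN1z.
(* The largest such [n] is the rank of the relation lattice; maximality makes every further relation
   a rational combination of the rows of [B]. *)
pose P n := `[< exists p (B : 'M[int]_(p, r)),
   (forall i, ev (row i B) = 0) /\ \rank (map_mx intr B : 'M[rat]_(p, r)) = n >].
have exP : exists n, P n.
  exists 0%N; apply/asboolP; exists 0%N, 0; split=> [[]//|].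
  by rewrite map_mx0 mxrank0.
have Ple n : P n -> (n <= r)%N by move=> /asboolP[p [B [_ <-]]]; exact: rank_leq_col.
have [n /asboolP[p [B [evB rB]]] nmax] := ex_maxnP exP Ple.
pose B' : 'M[rat]_(p, r) := map_mx intr B.
have KB (v : 'rV[int]_r) : ev v = 0 -> (map_mx intr v <= B')%MS.
  move=> v0; have : P (\rank (col_mx B' (map_mx intr v))).
    apply/asboolP; exists (p + 1)%N, (col_mx B v); rewrite map_col_mx; split=> // i.
    case: (split_ordP i) => j ->; first by rewrite rowKu evB.
    by rewrite rowKd row_id v0.
  move=> /nmax; rewrite -rB => le.
  have sub : (B' <= col_mx B' (map_mx intr v))%MS by rewrite -addsmxE addsmxSl.
  have /eqmxP eqB : (B' == col_mx B' (map_mx intr v))%MS by rewrite -(geq_leqif (mxrank_leqif_eq sub)).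
  by rewrite eqB -addsmxE addsmxSr.
have := Ple n; rewrite leq_eqVlt => /(_ _)/orP[||].
- by apply/asboolP; exists p, B.
- move=> /eqP nr; exfalso; apply: infA.
  have full : row_full B' by rewrite /row_full rB nr.
  have tor i : exists2 d : int, 0 < d & s i *~ d = 0.
    have /submxP[c cB] := submx_full (delta_mx 0 i : 'rV[rat]_r) full.
    have [d d0 dP] := common_denominator (c 0).
    have [w wP] := choice dP.
    exists d => //.
    have -> : s i *~ d = ev (d *: delta_mx 0 i).
      rewrite evZ /ev (bigD1 i) //= big1 ?addr0 => [|j ji]; rewrite !mxE eqxx ?eqxx ?mulr1z //.
      by rewrite (negbTE ji).
    have -> : d *: delta_mx 0 i = \sum_j w j *: row j B.
      apply/rowP => j; apply: (@intr_inj rat).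
      rewrite summxE mxE rmorphM /= rmorph_sum /=.
      have := congr1 (fun M : 'rV[rat]_r => d%:~R * M 0 j) cB.
      rewrite !mxE => e.
      transitivity (d%:~R * ((0 == 0 :> 'I_1) && (j == i))%:R : rat).
        by rewrite rmorph_nat.
      rewrite e mulr_sumr; apply: eq_bigr => k _.
      by rewrite !mxE rmorphM /= mulrA wP.
    have : forall (I : finType) (F : I -> 'rV[int]_r), (forall j, ev (F j) = 0) -> ev (\sum_j F j) = 0.
      move=> I F F0; apply: (big_ind (fun v => ev v = 0)) => //; last by move=> x y x0 y0; rewrite evD x0 y0 addr0.
      by rewrite -(scale0r 0) evZ.
    by apply=> j; rewrite evZ evB mul0rz.
  have tor' i : exists d : int, 0 < d /\ s i *~ d = 0 by have [d] := tor i; exists d.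
  have [d dP] := choice tor'.
  pose M := (\max_i absz (d i)).+1.
  apply: (@sub_finite_set _ _ ((fun t : {ffun 'I_r -> 'I_M} => \sum_i s i *~ (t i)%:Z) @` setT));
    last exact/finite_image/finite_finset.
  move=> a _; have [v ->] := gen a.
  have lt i : (absz (v ord0 i %% d i)%Z < M)%N.
    rewrite /M ltnS; apply: (leq_trans _ (leq_bigmax i)).
    have [d0 _] := dP i; have := ltz_pmod (v 0 i) d0; have := modz_ge0 (v 0 i) (lt0r_neq0 d0).
    by lia.
  exists [ffun i => Ordinal (lt i)] => //; apply: eq_bigr => i _; rewrite ffunE /=.
  have [d0 sd] := dP i.
  have -> : absz (v ord0 i %% d i)%Z = (v ord0 i %% d i)%Z :> int.
    by rewrite gez0_abs ?modz_ge0 ?lt0r_neq0.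
  transitivity (s i *~ ((v ord0 i %/ d i)%Z * d i + (v ord0 i %% d i)%Z)).
    rewrite [RHS]mulrzDr [(_ %/ _)%Z * _]mulrC [X in _ = X + _]mulrzA sd mul0rz.
    by rewrite add0r.
  by rewrite -divz_eq.
move=> nr.
have cok0 : cokermx B' != 0.
  by rewrite -mxrank_eq0 mxrank_coker rB -lt0n subn_gt0.
have [j [k jk]] : exists j k, cokermx B' j k != 0.
  apply: contrapT => nex; move/eqP: cok0; apply; apply/matrixP => j k; rewrite [RHS]mxE.
  by apply: contrapT => ne; apply: nex; exists j, k; apply/eqP.
have [d d0 dP] := common_denominator (fun i => cokermx B' i k).
have [w wP] := choice dP.
pose psi (v : 'rV[int]_r) := \sum_i v 0 i * w i.
have psi0 v : ev v = 0 -> psi v = 0.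
  move=> /KB/submxP[c cB]; apply: (@intr_inj rat); rewrite rmorph_sum /=.
  transitivity (d%:~R * (map_mx intr v *m cokermx B') 0 k).
    rewrite mxE mulr_sumr; apply: eq_bigr => i _; rewrite mxE rmorphM /= -wP.
    by rewrite mulrCA.
  by rewrite cB -mulmxA mulmx_coker mulmx0 mxE mulr0.
have psiB v v' : psi (v - v') = psi v - psi v'.
  by rewrite /psi -sumrB; apply: eq_bigr => i _; rewrite !mxE mulrBl.
have psi_eq v v' : ev v = ev v' -> psi v = psi v'.
  by move=> e; apply/eqP; rewrite -subr_eq0 -psiB psi0 // evD evN e subrr.
have [g gP] := choice gen.
exists (fun a => psi (g a)).
  move=> a b; rewrite (psi_eq _ (g a + g b)); last by rewrite evD /ev -!gP.
  by rewrite /psi -big_split; apply: eq_bigr => i _; rewrite !mxE mulrDl.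
exists (s j); rewrite (psi_eq _ (delta_mx 0 j)); last first.
  rewrite /ev -gP (bigD1 j) //= big1 ?addr0 => [|i ij]; rewrite mxE eqxx ?eqxx ?mulr1z //.
  by rewrite (negbTE ij).
rewrite /psi (bigD1 j) //= big1 ?addr0 => [|i ij]; last by rewrite mxE (negbTE ij) andbF mul0r.
rewrite mxE !eqxx mul1r; apply: contraNneq jk => wj.
have := wP j; rewrite wj => /eqP; rewrite mulf_eq0 intr_eq0.
by rewrite (gt_eqF d0).
Qed.

Section Abelianization.
Local Open Scope group_scope.
Variable Gamma : groupType.

Let N := commutator_subgroup Gamma.

Let N_subgroup : is_subgroup N.
Proof.
split=> [B [[B1 _] _] //|x y Nx Ny B BN].
by have [[_ BD] _] := BN; apply: BD; [apply: Nx|apply: Ny].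
Qed.

Let N1 : N 1. Proof. by case: N_subgroup. Qed.

Let NV x : N x -> N x^-1.
Proof. by move=> Nx; rewrite -[x^-1]mul1g; case: N_subgroup => _; apply. Qed.

Let NM x y : N x -> N y -> N (x * y).
Proof. by move=> Nx Ny; rewrite -[y]invgK; case: N_subgroup => _; apply=> //; exact: NV. Qed.

Let NR x y : N [~ x, y].
Proof. by apply: sub_gen_smallest; exists (x, y). Qed.

Let NJ x y : N x -> N (x ^ y).
Proof. by move=> Nx; rewrite -[x ^ y](mulVKg x) -commgEl; apply: NM. Qed.

Let e x y := `[< N (x^-1 * y) >].

Let e_refl : reflexive e.
Proof. by move=> x; apply/asboolP; rewrite mulVg. Qed.

Let e_sym : symmetric e.
Proof.
by move=> x y; apply/asboolP/asboolP => /NV; rewrite invMg invgK.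
Qed.

Let e_trans : transitive e.
Proof.
move=> y x z /asboolP xy /asboolP yz; apply/asboolP.
by rewrite -[z](mulVKg y) mulgA; apply: NM.
Qed.

Definition commutator_equiv := EquivRel e e_refl e_sym e_trans.
Definition abelianization := {eq_quot commutator_equiv}%qT.
HB.instance Definition _ := Choice.on abelianization.
HB.instance Definition _ := Quotient.on abelianization.
HB.instance Definition _ := EqQuotient.on abelianization.

Definition ab_class (x : Gamma) : abelianization := (\pi_abelianization x)%qT.

Lemma ab_classP x y : reflect (N (x^-1 * y)) (ab_class x == ab_class y).
Proof. by rewrite /ab_class piE; exact: asboolP. Qed.

Definition ab_add (a b : abelianization) := ab_class (generic_quotient.repr a * generic_quotient.repr b).
Definition ab_opp (a : abelianization) := ab_class (generic_quotient.repr a)^-1.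

Let ab_repr a : ab_class (generic_quotient.repr a) = a.
Proof. exact: reprK. Qed.

Lemma ab_classM x y : ab_class (x * y) = ab_add (ab_class x) (ab_class y).
Proof.
have /eqP/ab_classP hx := ab_repr (ab_class x).
have /eqP/ab_classP hy := ab_repr (ab_class y).
move: hx hy; rewrite /ab_add; set x' := generic_quotient.repr _; set y' := generic_quotient.repr _ => hx hy.
apply/esym/eqP/ab_classP.
have -> : (x' * y')^-1 * (x * y) = (x'^-1 * x) ^ y' * (y'^-1 * y).
  by rewrite conjgE invMg !mulgA !mulgK.
by apply: NM => //; apply: NJ.
Qed.

Lemma ab_classV x : ab_class x^-1 = ab_opp (ab_class x).
Proof.
have /eqP/ab_classP hx := ab_repr (ab_class x).
move: hx; rewrite /ab_opp; set x' := generic_quotient.repr _ => hx.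
apply/eqP/ab_classP; rewrite invgK.
have -> : x * x'^-1 = (x'^-1 * x) ^ x'^-1 by rewrite conjgE invgK mulgA mulVKg.
exact: NJ.
Qed.

Let ab_addA : associative ab_add.
Proof.
by move=> a b c; rewrite -[a]ab_repr -[b]ab_repr -[c]ab_repr -!ab_classM mulgA.
Qed.

Let ab_addC : commutative ab_add.
Proof.
move=> a b; rewrite -[a]ab_repr -[b]ab_repr -!ab_classM; apply/eqP/ab_classP.
set x := generic_quotient.repr a; set y := generic_quotient.repr b.
have -> : (x * y)^-1 * (y * x) = [~ y, x] by rewrite invMg -mulgA.
exact: NR.
Qed.

Let ab_add0 : left_id (ab_class 1) ab_add.
Proof. by move=> a; rewrite -[a]ab_repr -ab_classM mul1g. Qed.

Let ab_addN : left_inverse (ab_class 1) ab_opp ab_add.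
Proof. by move=> a; rewrite -[a]ab_repr -ab_classV -ab_classM mulVg. Qed.

HB.instance Definition _ :=
  GRing.isZmodule.Build abelianization ab_addA ab_addC ab_add0 ab_addN.

(** The abelianization is generated by the classes of [Sigma], and its elements correspond to the
    left cosets of the commutator subgroup, so infinite index makes it infinite. *)
Lemma exists_hom_int (Sigma : seq Gamma) :
  finite_generating_set Sigma -> ~ finite_index (commutator_subgroup Gamma) ->
  exists2 phi : Gamma -> int, (forall g h : Gamma, phi (g * h)%g = (phi g + phi h)%R)
    & exists g, phi g != 0.
Proof.
move=> gen infN.
have cM g h : ab_class (g * h)%g = (ab_class g + ab_class h)%R by exact: ab_classM.
have cV g : ab_class g^-1%g = (- ab_class g)%R by exact: ab_classV.
have c1 : ab_class 1%g = 0%R by [].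
pose s (i : 'I_(size Sigma)) := ab_class (nth 1 Sigma i).
have [|infA|f fD [a fa]] := @fg_zmod_hom abelianization _ s.
- move=> a; rewrite -[a]ab_repr; have [w [Sw <-]] := word_exists gen (generic_quotient.repr a).
  elim: w Sw => [_|x w IHw /= /andP[Sx /IHw[v vP]]].
    exists 0%R; rewrite big_nil c1 big1 // => i _; by rewrite mxE.
  have key y : y \in Sigma -> exists i, ab_class y = s i.
    move=> yS; have lt : (index y Sigma < size Sigma)%N by rewrite index_mem.
    by exists (Ordinal lt); rewrite /s /= nth_index.
  rewrite big_cons cM vP.
  have comb i (c : int) : (s i *~ c + \sum_j s j *~ v ord0 j = \sum_j s j *~ (c *: delta_mx ord0 i + v) ord0 j)%R.
    rewrite -[LHS]addr0 [in RHS](bigD1 i) //= [in LHS](bigD1 i) //= addr0.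
    rewrite !mxE !eqxx mulr1 mulrzDr -addrA; congr (_ + (_ + _))%R.
    by apply: eq_bigr => j ji; rewrite !mxE (negbTE ji) andbF mulr0 add0r.
  case/orP: Sx => /key[i si].
    by exists (1 *: delta_mx ord0 i + v)%R; rewrite -comb mulr1z -si.
  by exists ((-1) *: delta_mx ord0 i + v)%R; rewrite -comb mulrN1z -si cV opprK.
- apply: infN; apply: (@sub_finite_set _ _ ((fun a : abelianization => [set x | ab_class x = a]) @` setT)); last exact: finite_image.
  move=> _ [x _ <-]; exists (ab_class x) => //; apply/seteqP; split=> y /=.
    by move=> /esym/eqP/ab_classP xy; exists (x^-1 * y) => //; rewrite mulVKg.
  by move=> [z Nz <-]; apply/esym/eqP/ab_classP; rewrite mulKg.
exists (fun g => f (ab_class g)) => [g h|]; first by rewrite cM fD.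
by exists (generic_quotient.repr a); rewrite ab_repr.
Qed.

End Abelianization.

Local Open Scope complex_scope.

(** * Linear recurrences *)

Section ComplexModulus.
Variable R : realType.
Implicit Types (x y : R[i]).

Lemma normc_ge0 x : 0 <= Normc.normc x.
Proof. by case: x => a b; rewrite sqrtr_ge0. Qed.

Lemma normcX x n : Normc.normc (x ^+ n) = Normc.normc x ^+ n.
Proof.
by elim: n => [|n IHn]; rewrite ?expr0 ?Normc.normc1 // !exprS Normc.normcM IHn.
Qed.

Lemma le_normc_sub x y : Normc.normc (x - y) <= Normc.normc x + Normc.normc y.
Proof. by rewrite -(normcN y) le_normcD. Qed.

Lemma le_normc_sum (I : Type) (r : seq I) (P : pred I) (F : I -> R[i]) :
  Normc.normc (\sum_(i <- r | P i) F i) <= \sum_(i <- r | P i) Normc.normc (F i).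
Proof.
elim/big_rec2: _ => [|i y x _ le]; first by rewrite Normc.normc0.
by apply: le_trans (le_normcD _ _) _; rewrite lerD2l.
Qed.

Lemma normc_eq0 x : (Normc.normc x == 0) = (x == 0).
Proof. by apply/eqP/eqP => [/Normc.eq0_normc //|->]; exact: Normc.normc0. Qed.

Lemma normc_gt0 x : (0 < Normc.normc x) = (x != 0).
Proof. by rewrite lt_def normc_ge0 andbT normc_eq0. Qed.

Lemma normc_prod (I : Type) (r : seq I) (P : pred I) (F : I -> R[i]) :
  Normc.normc (\prod_(i <- r | P i) F i) = \prod_(i <- r | P i) Normc.normc (F i).
Proof. by apply: (big_morph _ (@Normc.normcM R) (@Normc.normc1 R)). Qed.

End ComplexModulus.

Section Recurrence.
Variable R : realType.
Local Notation C := R[i].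
Local Notation nm := (@Normc.normc R).
Implicit Types (l : seq C) (s u v : nat -> C) (p q : {poly C}).

(* [recur l s]: the product of the operators [T - x], [x] in [l], kills [s], where
   [T] is the shift. *)
Fixpoint recur l s : Prop :=
  if l is x :: l' then recur l' (fun m => s m.+1 - x * s m) else forall m, s m = 0.

Lemma recur_ext l s u : s =1 u -> recur l s -> recur l u.
Proof. by move=> /funext ->. Qed.

Lemma recur_comb l c c' s u : recur l s -> recur l u ->
  recur l (fun m => c * s m + c' * u m).
Proof.
elim: l s u => [|x l IHl] s u /=; first by move=> s0 u0 m; rewrite s0 u0 !mulr0 addr0.
move=> sl ul; apply: recur_ext (IHl _ _ sl ul) => m /=; ring.
Qed.

Lemma recur0 l : recur l (fun=> 0).
Proof.
elim: l => [//|x l IHl] /=; apply: recur_ext IHl => m /=; by rewrite mulr0 subr0.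
Qed.

Lemma recurZ l c s : recur l s -> recur l (fun m => c * s m).
Proof.
move=> sl; apply: recur_ext (recur_comb c 0 sl sl) => m /=; by rewrite mul0r addr0.
Qed.

Lemma recurD l s u : recur l s -> recur l u -> recur l (fun m => s m + u m).
Proof.
move=> sl ul; apply: recur_ext (recur_comb 1 1 sl ul) => m /=; by rewrite !mul1r.
Qed.

Lemma recurB l s u : recur l s -> recur l u -> recur l (fun m => s m - u m).
Proof.
move=> sl ul; apply: recur_ext (recur_comb 1 (-1) sl ul) => m /=; by rewrite mulN1r mul1r.
Qed.

Lemma recur_shift l s k : recur l s -> recur l (fun m => s (m + k)%N).
Proof.
by elim: l s => [|x l IHl] s /=; [move=> s0 m|move=> /IHl].
Qed.

Lemma recur_cons l x s : recur l s -> recur (x :: l) s.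
Proof.
move=> sl /=; apply: recurB (recurZ x sl).
by apply: recur_ext (recur_shift 1 sl) => m; rewrite addn1.
Qed.

Lemma recur_catr l l' s : recur l s -> recur (l' ++ l) s.
Proof. by elim: l' => [//|x l' IHl'] /IHl'; apply: recur_cons. Qed.

Lemma recur_catl l l' s : recur l s -> recur (l ++ l') s.
Proof.
elim: l s => [|x l IHl] s /=; last exact: IHl.
by move=> s0; apply: recur_ext (recur0 l') => m.
Qed.

(** With [s'] and [u'] the shifted sequences, [s' u' - x y s u = (s' - x s) u' + x s (u' - y u)]:
    each summand is a product of sequences with one root fewer in total. *)
Lemma recur_mul l l' : 0 \notin l -> 0 \notin l' -> exists2 L, 0 \notin L &
  forall s u, recur l s -> recur l' u -> recur L (fun m => s m * u m).
Proof.
have [n] := ubnP (size l + size l'); elim: n l l' => // n IHn [|x l] [|y l'] /= sz l0 l'0.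
- by exists [::] => // s u s0 u0 m; rewrite s0 mul0r.
- by exists [::] => // s u s0 u0 m; rewrite s0 mul0r.
- by exists [::] => // s u s0 u0 m; rewrite u0 mulr0.
have l0' : 0 \notin l by apply: contra l0; rewrite inE orbC => ->.
have l'0' : 0 \notin l' by apply: contra l'0; rewrite inE orbC => ->.
have [|L1 L10 H1] := IHn l (y :: l') _ l0' l'0; first by move: sz; rewrite /=; lia.
have [|L2 L20 H2] := IHn (x :: l) l' _ l0 l'0'; first by move: sz; rewrite /=; lia.
exists (x * y :: (L1 ++ L2)).
  rewrite inE mem_cat !negb_or L10 L20 !andbT eq_sym mulf_neq0 //.
    by apply: contra l0 => /eqP ->; rewrite inE eqxx.
  by apply: contra l'0 => /eqP ->; rewrite inE eqxx.
move=> s u sl ul /=.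
have := recurD (recur_catl L2 (H1 _ (fun m => u m.+1) sl _))
               (recur_catr L1 (recurZ x (H2 s _ sl ul))).
move=> H; apply: recur_ext (H _) => [m|]; first by ring.
by apply: recur_ext (recur_shift 1 (l := y :: l') ul) => m; rewrite addn1.
Qed.

(** The operator [T^d - x^d] is a multiple of [T - x], so it removes the root [x] for every [d]. *)
Lemma recur_pow l x s d : recur (x :: l) s -> recur l (fun m => s (m + d)%N - x ^+ d * s m).
Proof.
move=> sl; elim: d => [|d IHd].
  by apply: recur_ext (recur0 l) => m; rewrite addn0 mul1r subrr.
apply: recur_ext (recurD (recur_shift (l := l) d sl) (recurZ x IHd)) => m /=.
by rewrite addnS exprS; ring.
Qed.

Lemma recur_sub l s M : recur l s ->
  recur [seq x ^+ M | x <- l] (fun m => s (M * m)%N).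
Proof.
elim: l s => [|x l IHl] s /=; first by move=> s0 m.
move=> sl; apply: recur_ext (IHl _ (recur_pow M (x := x) sl)) => m.
by rewrite mulnS addnC.
Qed.

(** The value at [0] of [p(T) s], with [T] the shift. It lets identities between polynomials, such
    as Bezout relations, act on recurrent sequences. *)
Definition seq_eval s (p : {poly C}) := \sum_(i < size p) p`_i * s i.

Lemma seq_evalE s p n : (size p <= n)%N -> seq_eval s p = \sum_(i < n) p`_i * s i.
Proof.
move=> le; rewrite /seq_eval (big_ord_widen n (fun i => p`_i * s i) le) big_mkcond /=.
by apply: eq_bigr => i _; case: ltnP => // ?; rewrite nth_default ?mul0r.
Qed.

Lemma seq_evalD s p q : seq_eval s (p + q) = seq_eval s p + seq_eval s q.
Proof.
pose n := maxn (size p) (size q).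
rewrite !(@seq_evalE s _ n) ?leq_maxl ?leq_maxr ?size_polyD //.
by rewrite -big_split; apply: eq_bigr => i _; rewrite coefD mulrDl.
Qed.

Lemma seq_evalZ s c p : seq_eval s (c *: p) = c * seq_eval s p.
Proof.
rewrite !(@seq_evalE s _ (size p)) ?size_scale_leq // mulr_sumr.
by apply: eq_bigr => i _; rewrite coefZ mulrA.
Qed.

Lemma seq_evalXn s i : seq_eval s 'X^i = s i.
Proof.
rewrite (@seq_evalE s _ i.+1) ?size_polyXn // (bigD1 ord_max) //= big1 => [|j ji].
  by rewrite coefXn eqxx mul1r addr0.
by rewrite coefXn (negbTE (ji : (j : nat) != i)) mul0r.
Qed.

Lemma seq_evalXM s p : seq_eval s ('X * p) = seq_eval (fun m => s m.+1) p.
Proof.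
rewrite (@seq_evalE s _ (size p).+1); last first.
  by apply: leq_trans (size_polyMleq _ _) _; rewrite size_polyX.
by rewrite big_ord_recl coefXM mul0r add0r; apply: eq_bigr => i _; rewrite coefXM.
Qed.

Lemma seq_evalXsub s x p :
  seq_eval s (('X - x%:P) * p) = seq_eval (fun m => s m.+1 - x * s m) p.
Proof.
rewrite mulrBl mul_polyC seq_evalD -scaleN1r !seq_evalZ seq_evalXM.
rewrite /seq_eval !mulr_sumr -big_split; apply: eq_bigr => i _ /=; ring.
Qed.

Lemma seq_evalXnM s p d : seq_eval s ('X^d * p) = seq_eval (fun m => s (m + d)%N) p.
Proof.
elim: d s => [|d IHd] s; first by rewrite expr0 mul1r; congr seq_eval; apply/funext => m; rewrite addn0.
by rewrite exprS -mulrA seq_evalXM IHd; congr seq_eval; apply/funext => m; rewrite addnS.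
Qed.

Lemma seq_eval_recur l s p : recur l s -> seq_eval s (\prod_(x <- l) ('X - x%:P) * p) = 0.
Proof.
elim: l s => [|x l IHl] s /=; last by rewrite big_cons -mulrA seq_evalXsub => /IHl.
by move=> s0; rewrite /seq_eval big1 // => i _; rewrite s0 mulr0.
Qed.

(** The Hilbert cube: [a] plus all subset sums of [ds]. *)
Fixpoint cube (a : nat) (ds : seq nat) : seq nat :=
  if ds is d :: ds' then cube a ds' ++ cube (a + d) ds' else [:: a].

Lemma cube_shift t a ds : cube (t + a) ds = [seq (t + x)%N | x <- cube a ds].
Proof. by elim: ds a => [//|d ds IHds] a /=; rewrite map_cat -addnA !IHds. Qed.

Lemma mem_cube a ds : a \in cube a ds.
Proof. by elim: ds => [|d ds IHds] /=; rewrite ?inE // mem_cat IHds. Qed.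

Definition nondegenerate l := forall x y d, x \in l -> y \in l -> (0 < d)%N ->
  x ^+ d = y ^+ d -> x = y.

(** For each pair of roots that have some equal positive powers, choose one exponent at which they
    agree. The product [M] of the chosen exponents identifies all these pairs at once. *)
Lemma nondegenerate_power l : 0 \notin l ->
  exists2 M, (0 < M)%N & nondegenerate [seq x ^+ M | x <- l].
Proof.
move=> l0.
have ex (p : C * C) : exists d, (0 < d)%N /\ ((exists2 e, (0 < e)%N & p.1 ^+ e = p.2 ^+ e) -> p.1 ^+ d = p.2 ^+ d).
  have [[e e0 pe]|ne] := pselect (exists2 e, (0 < e)%N & p.1 ^+ e = p.2 ^+ e).
    by exists e.
  by exists 1%N; split=> // /ne.
have [f fP] := choice ex.
exists (\prod_(p <- [seq (x, y) | x <- l, y <- l]) f p)%N.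
  by rewrite prodn_gt0 // => p; case: (fP p).
move=> _ _ d /mapP[x xl ->] /mapP[y yl ->] d0; set M := (\prod_(_ <- _) _)%N => e.
have fM : (f (x, y) %| M)%N.
  rewrite /M (big_rem (x, y)) ?dvdn_mulr //.
  by apply/allpairsP; exists (x, y).
have M0 : (0 < M)%N by rewrite prodn_gt0 // => p; case: (fP p).
have [_ /(_ _)/= fxy] := fP (x, y).
case/dvdnP: fM => q ->; rewrite mulnC !exprM fxy //.
by exists (M * d)%N; rewrite ?muln_gt0 ?M0 // !exprM.
Qed.

(** The first polynomial is [h = (X^d - x^d) / (X - x)]. A common root [y] satisfies [y^d = x^d],
    hence [y = x] by nondegeneracy; but [h] takes the nonzero value [d x^(d-1)] at [x]. This
    argument allows [x] to occur again in [l]. *)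
Lemma coprimep_geom x d l : x != 0 -> (0 < d)%N -> nondegenerate (x :: l) ->
  coprimep (\sum_(i < d) 'X^(d.-1 - i) * x%:P ^+ i) (\prod_(y <- l) ('X - y%:P)).
Proof.
move=> x0 d0 nd; set h := \sum_(_ < _) _.
have hE : 'X^d - (x ^+ d)%:P = ('X - x%:P) * h by rewrite rmorphXn subrXX.
suff: forall y, y \in l -> ~~ root h y.
  elim: l {nd} => [|y l IHl] hl; first by rewrite big_nil coprimep1.
  rewrite big_cons coprimepMr coprimep_XsubC hl ?mem_head //=.
  by apply: IHl => z zl; apply: hl; rewrite inE zl orbT.
move=> y yl; apply/negP => /rootP hy.
have yx : y = x.
  apply: (nd y x d); rewrite ?inE ?yl ?eqxx ?orbT //.
  have := congr1 (fun p => p.[y]) hE.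
  by rewrite hornerM hy mulr0 !hornerE => /eqP; rewrite subr_eq0 => /eqP.
move: hy; rewrite yx /h horner_sum => /eqP; apply/negP.
have -> : \sum_(i < d) ('X^(d.-1 - i) * x%:P ^+ i).[x] = d%:R * x ^+ d.-1.
  rewrite -[d in d%:R]card_ord -sum1_card natr_sum mulr_suml; apply: eq_bigr => i _.
  rewrite -rmorphXn hornerM hornerXn hornerC -exprD subnK ?mul1r //.
  by have := ltn_ord i; lia.
by rewrite mulf_neq0 ?expf_neq0 // pnatr_eq0 -lt0n.
Qed.

(* With [X^d - x^d = (X - x) h], nondegeneracy makes [h] prime to the other
   factors, so [(T^d - x^d) s], which loses the root [x] and one dimension of the
   cube, determines [(T - x) s]. *)
Lemma cube_control l : 0 \notin l -> nondegenerate l ->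
  forall a ds p, size ds = size l -> all (fun d => 0 < d)%N ds ->
  exists2 K, 0 <= K & forall s e, recur l s ->
    (forall x, x \in cube a ds -> nm (s x) <= e) -> nm (seq_eval s p) <= K * e.
Proof.
elim: l => [|x l IHl] l0 nd a [|d ds] p //= => [_ _|[sz] /andP[d0 ds0]].
  exists 0 => // s e s0 _; rewrite mul0r /seq_eval big1 ?Normc.normc0 // => i _.
  by rewrite s0 mulr0.
have [x0 l0'] : x != 0 /\ 0 \notin l.
  by move: l0; rewrite inE negb_or eq_sym => /andP[].
have nd' : nondegenerate l.
  by move=> y z e yl zl; apply: nd; rewrite inE ?yl ?zl orbT.
have cop := coprimep_geom x0 d0 nd; set h := \sum_(_ < _) _ in cop.
have hE : 'X^d - (x ^+ d)%:P = ('X - x%:P) * h by rewrite rmorphXn subrXX.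
have [[u1 u2] /eqpP[[c1 c2] /= /andP[c10 c20] ue]] := Bezout_coprimepP _ _ cop.
pose v1 := (c1 / c2) *: u1; pose v2 := (c1 / c2) *: u2.
have ve : v1 * h + v2 * \prod_(y <- l) ('X - y%:P) = 1.
  rewrite /v1 /v2 -!scalerAl -scalerDr mulrC -scalerA ue scalerA mulVf ?scale1r //.
(* This [c] makes [p - c X^a] divisible by [X - x]. The Bezout relation splits the quotient part
   into a multiple of [X^d - x^d], to which induction applies, and a multiple of the full product,
   which kills [s]; the term [c X^a] only sees [s a], and [a] is in the cube. *)
pose c := p.[x] / x ^+ a.
have /factor_theorem[q qE] : root (p - c *: 'X^a) x.
  by rewrite /root !hornerE /c mulfVK ?expf_neq0 // subrr.
have pE : p = c *: 'X^a + (('X^d - (x ^+ d)%:P) * (v1 * q) +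
    \prod_(y <- x :: l) ('X - y%:P) * (v2 * q)).
  rewrite big_cons hE -[p](subrK (c *: 'X^a)) qE addrC; congr (_ + _).
  have -> : q * ('X - x%:P) = ('X - x%:P) * ((v1 * h + v2 * \prod_(y <- l) ('X - y%:P)) * q) by rewrite ve mul1r mulrC.
  have gen (A w1 w2 H P Q : {poly C}) :
      A * ((w1 * H + w2 * P) * Q) = A * H * (w1 * Q) + A * P * (w2 * Q) by ring.
  exact: gen.
have [K K0 KP] := IHl l0' nd' a ds (v1 * q) sz ds0.
exists (nm c + K * (1 + nm x ^+ d)).
  by rewrite addr_ge0 ?normc_ge0 // mulr_ge0 // addr_ge0 // exprn_ge0 // normc_ge0.
move=> s e sl se.
rewrite pE !seq_evalD seq_evalZ seq_evalXn (seq_eval_recur (l := x :: l) _ sl) addr0.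
rewrite mulrBl mul_polyC seq_evalD -scaleN1r !seq_evalZ seq_evalXnM.
have -> : seq_eval (fun m => s (m + d)%N) (v1 * q) + -1 * (x ^+ d * seq_eval s (v1 * q)) =
    seq_eval (fun m => s (m + d)%N - x ^+ d * s m) (v1 * q).
  rewrite /seq_eval !mulr_sumr -big_split; apply: eq_bigr => i _ /=; ring.
apply: le_trans (le_normcD _ _) _; rewrite mulrDl; apply: lerD.
  rewrite Normc.normcM ler_wpM2l ?normc_ge0 // se // mem_cat mem_cube //.
rewrite -mulrA; apply: KP; first exact: recur_pow.
move=> m mc; apply: le_trans (le_normc_sub _ _) _; rewrite mulrDl mul1r; apply: lerD.
  by rewrite se // mem_cat addnC [(a + d)%N]addnC cube_shift map_f ?orbT.
by rewrite Normc.normcM normcX ler_wpM2l ?exprn_ge0 ?normc_ge0 // se // mem_cat mc.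
Qed.

Lemma uniform_bound (T : finType) (P : T -> R -> Prop) :
  (forall x K K', K <= K' -> P x K -> P x K') ->
  (forall x, exists2 K, 0 <= K & P x K) -> exists2 K, 0 <= K & forall x, P x K.
Proof.
move=> mono ex.
have ex' x : exists K, 0 <= K /\ P x K by have [K] := ex x; exists K.
have [f fP] := choice ex'.
exists (\sum_x f x); first by rewrite sumr_ge0 // => x _; case: (fP x).
move=> x; have [_ Px] := fP x; apply: mono Px.
by rewrite (bigD1 x) //= lerDl sumr_ge0 // => y _; case: (fP y).
Qed.

(** Only finitely many base points, directions and positions are bounded by [L], so the constants of
    [cube_control] for all of them have a common bound. *)
Lemma cube_control_uniform l L : 0 \notin l -> nondegenerate l ->
  exists2 K, 0 <= K & forall a ds i s e, (a <= L)%N -> size ds = size l ->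
    all (fun d => 0 < d <= L)%N ds -> (i <= L)%N -> recur l s ->
    (forall x, x \in cube a ds -> nm (s x) <= e) -> nm (s i) <= K * e.
Proof.
move=> l0 nd.
pose T := ('I_L.+1 * (size l).-tuple 'I_L.+1 * 'I_L.+1)%type.
pose dsof (t : T) := [seq val d | d <- t.1.2].
have [||K K0 KP] := @uniform_bound T (fun t K => 0 <= K /\
    (all (fun d => 0 < d)%N (dsof t) -> forall s e,
      recur l s -> (forall x, x \in cube t.1.1 (dsof t) -> nm (s x) <= e) -> nm (s t.2) <= K * e)).
- move=> t K K' KK' [K0 H]; split=> [|pos s e sl se]; first exact: le_trans KK'.
  apply: le_trans (H pos s e sl se) _; rewrite ler_wpM2r //.
  by apply: le_trans (se _ (mem_cube _ _)); exact: normc_ge0.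
- move=> t; have [pos|npos] := boolP (all (fun d => 0 < d)%N (dsof t)); last by exists 0.
  have [|K K0 KP] := @cube_control l l0 nd t.1.1 (dsof t) 'X^(t.2) _ pos.
    by rewrite size_map size_tuple.
  by exists K => //; split=> // _ s e sl /(KP s e sl); rewrite seq_evalXn.
exists K => // a ds i s e aL sz dsL iL sl se.
have tsz : size [seq (inord d : 'I_L.+1) | d <- ds] == size l by rewrite size_map sz.
have dsE : [seq val d | d <- [seq (inord d : 'I_L.+1) | d <- ds]] = ds.
  rewrite -map_comp -[RHS]map_id; apply/eq_in_map => d dds /=.
  by rewrite inordK // ltnS; have /allP/(_ d dds)/andP[] := dsL.
have [_] := KP ((inord a, Tuple tsz), inord i).
rewrite /dsof /= dsE !inordK ?ltnS //; apply=> //.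
by apply/allP => d dds; have /allP/(_ d dds)/andP[] := dsL.
Qed.

(** Cut the integers into blocks of the length that works for [k]. Among sufficiently many blocks
    two carry the same colouring, and their distance is the new direction. *)
Lemma hilbert_cube k : exists2 L, (0 < L)%N & forall c : nat -> bool,
  exists a ds b, [/\ size ds = k, all (fun d => 0 < d <= L)%N ds,
    (forall x, x \in cube a ds -> (x < L)%N) & forall x, x \in cube a ds -> c x = b].
Proof.
elim: k => [|k [L L0 IHk]].
  exists 1%N => // c; exists 0%N, [::], (c 0%N); split=> //= x; rewrite inE => /eqP -> //.
pose n := #|{ffun 'I_L -> bool}|.+1.
exists (n * L)%N; first by rewrite muln_gt0 L0.
move=> c; pose pat (j : 'I_n) := [ffun i : 'I_L => c (j * L + i)%N].
have [j [j' [jj' eqp]]] : exists j j' : 'I_n, (j < j')%N /\ pat j = pat j'.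
  apply: contrapT => nex.
  have /leq_card : injective pat.
    move=> j j' e; apply: val_inj => /=.
    by case: (ltngtP j j') => // lt; exfalso; apply: nex; [exists j, j'|exists j', j].
  by rewrite card_ord /n ltnn.
have [a [ds [b [sz dsL lt cb]]]] := IHk (fun x => c (j * L + x)%N).
have jn := ltn_ord j; have j'n := ltn_ord j'.
have le1 : (j' * L + L <= n * L)%N by rewrite -mulSnr leq_mul2r j'n orbT.
have le2 : (j * L + L <= j' * L)%N by rewrite -mulSnr leq_mul2r jj' orbT.
exists (j * L + a)%N, ((j' * L - j * L)%N :: ds), b; split.
- by rewrite /= sz.
- apply/andP; split; first by lia.
  by apply: sub_all dsL => d; lia.
- move=> x; rewrite /= mem_cat; have -> : (j * L + a + (j' * L - j * L) = j' * L + a)%N by lia.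
  by rewrite !cube_shift => /orP[]/mapP[y /lt yL ->]; lia.
move=> x; rewrite /= mem_cat; have -> : (j * L + a + (j' * L - j * L) = j' * L + a)%N by lia.
rewrite !cube_shift => /orP[]/mapP[y yc ->]; first exact: cb.
rewrite -(cb y yc); have yL := lt y yc.
by have := congr1 (fun f : {ffun 'I_L -> bool} => f (Ordinal yL)) eqp; rewrite !ffunE.
Qed.

Definition window L s w := \sum_(i < L) nm (s (w + i)%N).

Lemma window_ge L s w i : (i < L)%N -> nm (s (w + i)%N) <= window L s w.
Proof.
move=> iL; rewrite /window (bigD1 (Ordinal iL)) //= lerDl.
by rewrite sumr_ge0 // => j _; exact: normc_ge0.
Qed.

Lemma window_ge0 L s w : 0 <= window L s w.
Proof. by rewrite sumr_ge0 // => j _; exact: normc_ge0. Qed.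

Lemma window_le L s w e : (forall i, (i < L)%N -> nm (s (w + i)%N) <= e) ->
  window L s w <= L%:R * e.
Proof.
move=> le; apply: le_trans (ler_sum _ (fun (i : 'I_L) _ => le i (ltn_ord i))) _.
by rewrite sumr_const card_ord mulr_natl.
Qed.

(** A monochromatic cube in a window turns the pointwise alternative into domination, with ratio
    [c * e], on the whole window. If [s] dominates one window and [u] the next, then passing from
    [u] there back to [s] there costs [c] for moving [u] back, [c * e] for the domination and [c]
    for moving [s] forward. This is why [c ^+ 3 * e < 1] excludes a change. *)
Lemma dominance_persists l : 0 \notin l -> nondegenerate l ->
  exists L K, [/\ (0 < L)%N, 0 < K & forall e s u n, recur l s -> recur l u ->
    0 <= e -> K * e < 1 ->
    (forall m, (m < n + L)%N -> nm (s m) <= e * nm (u m) \/ nm (u m) <= e * nm (s m)) ->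
    window L u 0 < window L s 0 -> window L u n <= window L s n].
Proof.
move=> l0 nd; have [L L0 hL] := hilbert_cube (size l).
have [K K0 KP] := cube_control_uniform L l0 nd.
pose c := L%:R * K + 1.
have c1 : 1 <= c by rewrite lerDr mulr_ge0.
(* The constant colouring provides some cube inside one window. It serves to bound each window by
   the preceding one, and, moved by one, by the following one. *)
have [a0 [ds0 [b0 [sz0 ds0L cube0 _]]]] := hL xpredT.
have a0L := cube0 _ (mem_cube _ _).
have up s w : recur l s -> window L s w.+1 <= c * window L s w.
  move=> sl; apply: le_trans (_ : L%:R * (K * window L s w) <= _).
    apply: window_le => i iL.
    have := KP a0 ds0 i.+1 (fun m => s (m + w)%N) (window L s w) (ltnW a0L) sz0 ds0L iL (recur_shift w sl).
    rewrite addSn -addnS addnC; apply=> x xc; rewrite addnC; exact/window_ge/cube0.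
  by rewrite mulrA ler_wpM2r ?window_ge0 // /c lerDl.
have down s w : recur l s -> window L s w <= c * window L s w.+1.
  move=> sl; apply: le_trans (_ : L%:R * (K * window L s w.+1) <= _).
    apply: window_le => i iL.
    have := KP a0.+1 ds0 i (fun m => s (m + w)%N) (window L s w.+1) a0L sz0 ds0L (ltnW iL) (recur_shift w sl).
    rewrite addnC; apply=> x; rewrite -addn1 addnC cube_shift => /mapP[y yc ->].
    by rewrite addnC addnA addn1; exact/window_ge/cube0.
  by rewrite mulrA ler_wpM2r ?window_ge0 // /c lerDl.
have dom e s u w : recur l s -> recur l u -> 0 <= e ->
    (forall m, (m < w + L)%N -> nm (s m) <= e * nm (u m) \/ nm (u m) <= e * nm (s m)) ->
    window L s w <= c * e * window L u w \/ window L u w <= c * e * window L s w.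
  move=> sl ul e0 alt.
  have [a [ds [b [sz dsL lt cb]]]] := hL (fun x => nm (s (w + x)%N) <= e * nm (u (w + x)%N)).
  have aL := lt _ (mem_cube _ _).
  have fin v v' : recur l v ->
      (forall x, x \in cube a ds -> nm (v (w + x)%N) <= e * nm (v' (w + x)%N)) ->
      window L v w <= c * e * window L v' w.
    move=> vl vv'; apply: le_trans (_ : L%:R * (K * (e * window L v' w)) <= _).
      apply: window_le => i iL.
      have := KP a ds i (fun m => v (m + w)%N) (e * window L v' w) (ltnW aL) sz dsL (ltnW iL) (recur_shift w vl).
      rewrite addnC; apply=> x xc; rewrite addnC; apply: le_trans (vv' x xc) _.
      by rewrite ler_wpM2l //; exact/window_ge/lt.
    by rewrite !mulrA ler_wpM2r ?window_ge0 // ler_wpM2r // /c lerDl.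
  case: b cb => cb; [by left; apply: fin|right; apply: fin => // x xc].
  by have := cb x xc; have [|->|//] := alt (w + x)%N; rewrite ?ltn_add2l ?lt.
exists L, (c ^+ 3); split=> // [|e s u n sl ul e0 ce alt u0s0].
  by rewrite exprn_gt0 // (lt_le_trans _ c1).
have ce1 : c * e <= 1.
  apply: le_trans (ltW ce); rewrite ler_wpM2r // -[X in X <= _]expr1 ler_weXn2l //.
suff main w : (w <= n)%N -> window L u w <= c * e * window L s w /\ 0 < window L s w.
  have [le _] := main n (leqnn n); apply: le_trans le _.
  by rewrite -[X in _ <= X]mul1r ler_wpM2r ?window_ge0.
elim: w => [_|w IHw wn].
  split; last by apply: le_lt_trans u0s0; exact: window_ge0.
  case: (dom e s u 0%N sl ul e0) => [m mL|le|//].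
    by apply: alt; apply: leq_trans mL _; rewrite leq_add2r.
  have : window L s 0 <= window L u 0.
    by apply: le_trans le _; rewrite -[X in _ <= X]mul1r ler_wpM2r ?window_ge0.
  by rewrite leNgt u0s0.
have [le pos] := IHw (ltnW wn).
have pos1 : 0 < window L s w.+1.
  rewrite -(pmulr_rgt0 _ (lt_le_trans ltr01 c1)); apply: lt_le_trans pos (down s w sl).
split=> //; case: (dom e s u w.+1 sl ul e0) => [m mL|le1|//].
  by apply: alt; apply: leq_trans mL _; rewrite leq_add2r.
have : window L s w.+1 <= window L u w.+1.
  by apply: le_trans le1 _; rewrite -[X in _ <= X]mul1r ler_wpM2r ?window_ge0.
suff : window L u w.+1 < window L s w.+1 by move=> /lt_le_trans h /h; rewrite ltxx.
apply: le_lt_trans (up u w ul) _.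
apply: (@le_lt_trans _ _ (c ^+ 3 * e * window L s w.+1)); last by rewrite gtr_pMl.
have c0 : 0 <= c by rewrite (le_trans _ c1).
apply: le_trans (ler_wpM2l c0 le) _.
have -> : c ^+ 3 * e * window L s w.+1 = c * (c * e * (c * window L s w.+1)) by ring.
by rewrite ler_wpM2l // ler_wpM2l ?mulr_ge0 // down.
Qed.

End Recurrence.

(** * Families of sequences with a common recurrence *)

Section RecurrentFamilies.
Variables (R : realType) (I : Type).
Local Notation C := R[i].
Implicit Types (f g : I -> nat -> C).

(** The root list is chosen before the index [i], which will be [N]; all constants derived from the
    recurrence are then uniform in [N]. *)
Definition recur_family f := exists2 l : seq C, 0 \notin l & forall i, recur l (f i).

Lemma recur_family_ext f g : (forall i m, f i m = g i m) -> recur_family f -> recur_family g.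
Proof. by move=> fg [l l0 fl]; exists l => // i; apply: recur_ext (fl i) => m. Qed.

Lemma recur_family_const (c : I -> C) : recur_family (fun i _ => c i).
Proof. by exists [:: 1]; rewrite ?inE 1?eq_sym ?oner_eq0 // => i m /=; rewrite mul1r subrr. Qed.

Lemma recur_familyD f g : recur_family f -> recur_family g ->
  recur_family (fun i m => f i m + g i m).
Proof.
move=> [l l0 fl] [l' l'0 gl']; exists (l ++ l'); first by rewrite mem_cat negb_or l0.
by move=> i; apply: recurD; [apply: recur_catl|apply: recur_catr].
Qed.

Lemma recur_familyM f g : recur_family f -> recur_family g ->
  recur_family (fun i m => f i m * g i m).
Proof.
move=> [l l0 fl] [l' l'0 gl']; have [L L0 LP] := recur_mul l0 l'0.
by exists L => // i; apply: LP.
Qed.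

Lemma recur_familyN f : recur_family f -> recur_family (fun i m => - f i m).
Proof.
move=> ff; apply: recur_family_ext (recur_familyM (recur_family_const (fun=> -1)) ff) => i m.
by rewrite mulN1r.
Qed.

Lemma recur_family_sum (J : Type) (r : seq J) (P : pred J) (F : J -> I -> nat -> C) :
  (forall j, recur_family (F j)) -> recur_family (fun i m => \sum_(j <- r | P j) F j i m).
Proof.
move=> FF; elim: r => [|j r IHr].
  by apply: recur_family_ext (recur_family_const (fun=> 0)) => i m; rewrite big_nil.
case Pj: (P j).
  by apply: recur_family_ext (recur_familyD (FF j) IHr) => i m; rewrite big_cons Pj.
by apply: recur_family_ext IHr => i m; rewrite big_cons Pj.
Qed.

Definition recur_family_mx p q (M : I -> nat -> 'M[C]_(p, q)) :=
  forall a b, recur_family (fun i m => M i m a b).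

Lemma recur_family_mx_const p q (M : I -> 'M[C]_(p, q)) : recur_family_mx (fun i _ => M i).
Proof. move=> a b; exact: (recur_family_const (fun i => M i a b)). Qed.

Lemma recur_family_mulmx p q r (M : I -> nat -> 'M[C]_(p, q)) (N : I -> nat -> 'M[C]_(q, r)) :
  recur_family_mx M -> recur_family_mx N -> recur_family_mx (fun i m => M i m *m N i m).
Proof.
move=> MM NN a b.
apply: recur_family_ext (recur_family_sum (index_enum 'I_q) xpredT
  (fun j => recur_familyM (MM a j) (NN j b))) => i m.
by rewrite mxE.
Qed.

(** By the Cayley-Hamilton theorem the entries of the powers of [B] satisfy the recurrence of its
    characteristic polynomial, whose roots are nonzero because [B] is invertible. *)
Lemma recur_family_pow n (B : 'M[C]_n.+1) : B \in unitmx ->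
  recur_family_mx (fun (_ : I) m => B ^+ m).
Proof.
move=> uB; have [l lE] := closed_field_poly_normal (char_poly B).
rewrite (monicP (char_poly_monic B)) scale1r in lE.
have l0 : 0 \notin l.
  apply/negP => l0; have : root (char_poly B) 0 by rewrite lE root_prod_XsubC.
  rewrite /root horner_coef0 char_poly_det mulf_eq0 signr_eq0 /= => /eqP d0.
  by move: uB; rewrite unitmxE d0 unitr0.
have kill : \prod_(x <- l) (B - x%:M) = 0.
  have := Cayley_Hamilton B; rewrite lE rmorph_prod /= => <-.
  by apply: eq_bigr => x _; rewrite rmorphB /= horner_mx_X horner_mx_C.
move=> a b; exists l => // _.
suff gen (Y : 'M[C]_n.+1) : Y * \prod_(x <- l) (B - x%:M) = 0 ->
    recur l (fun m => (Y * B ^+ m) a b).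
  have := gen 1; rewrite mul1r kill => /(_ erefl); apply: recur_ext => m.
  by rewrite mul1r.
elim: l Y {lE l0 kill} => [|x l IHl] Y.
  by rewrite big_nil mulr1 => -> m; rewrite mul0r mxE.
rewrite big_cons mulrA => /IHl /=; apply: recur_ext => m.
rewrite exprS mulrA mulrBr mulrBl [LHS]mxE; congr (_ + _).
by rewrite mxE; congr (- _); rewrite -mulrA -scalemx1 -!scalerAl -scalerAr mul1r mxE.
Qed.

Definition recur_family_poly (p : I -> nat -> {poly C}) :=
  forall k, recur_family (fun i m => (p i m)`_k).

Lemma recur_family_polyM p q : recur_family_poly p -> recur_family_poly q ->
  recur_family_poly (fun i m => p i m * q i m).
Proof.
move=> pp qq k.
apply: recur_family_ext (recur_family_sum (index_enum 'I_k.+1) xpredT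
  (fun j => recur_familyM (pp j) (qq (k - j)%N))) => i m.
by rewrite coefM.
Qed.

Lemma recur_family_poly_const (p : I -> {poly C}) : recur_family_poly (fun i _ => p i).
Proof. move=> k; exact: (recur_family_const (fun i => (p i)`_k)). Qed.

Lemma recur_family_char_poly n (M : I -> nat -> 'M[C]_n) :
  recur_family_mx M -> recur_family_poly (fun i m => char_poly (M i m)).
Proof.
move=> MM.
have entry a b : recur_family_poly (fun i m => char_poly_mx (M i m) a b).
  move=> k; have [->|k0] := eqVneq k 0%N; last first.
    apply: recur_family_ext (recur_family_const (fun=> ('X *+ (a == b) : {poly C})`_k)) => i m.
    by rewrite !mxE coefB coefC (negbTE k0) subr0.
  apply: recur_family_ext (recur_familyD (recur_family_const (fun=> ('X *+ (a == b) : {poly C})`_0))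
    (recur_familyN (MM a b))) => i m.
  by rewrite !mxE coefB coefC.
have prods (r : seq 'I_n) (s : 'S_n) :
    recur_family_poly (fun i m => \prod_(a <- r) char_poly_mx (M i m) a (s a)).
  elim: r => [|a r IHr] k.
    by apply: recur_family_ext (recur_family_poly_const (fun=> 1) k) => i m; rewrite big_nil.
  by apply: recur_family_ext (recur_family_polyM (entry a (s a)) IHr k) => i m; rewrite big_cons.
move=> k.
apply: recur_family_ext (recur_family_sum (index_enum {perm 'I_n}) xpredT
  (fun s : 'S_n => recur_family_polyM (recur_family_poly_const (fun=> (-1) ^+ s))
     (prods (index_enum 'I_n) s) k)) => i m.
by rewrite /char_poly /determinant coef_sum.
Qed.

End RecurrentFamilies.

(** * Eigenvalue gaps *)

Section ElementarySymmetric.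
Variable R : realType.
Local Notation C := R[i].
Local Notation nm := (@Normc.normc R).
Implicit Types (l la lb : seq C) (x : C).

Fixpoint elemsym l (j : nat) : C :=
  if l is x :: l' then elemsym l' j + (if j is j'.+1 then x * elemsym l' j' else 0)
  else (j == 0)%:R.

Lemma elemsym0 l : elemsym l 0 = 1.
Proof. by elim: l => [//|x l IHl] /=; rewrite IHl addr0. Qed.

Lemma elemsym_eq0 l j : (size l < j)%N -> elemsym l j = 0.
Proof.
elim: l j => [|x l IHl] [|j] //= lt; rewrite !IHl ?mulr0 ?addr0 //.
by lia.
Qed.

Lemma elemsym_cat l l' k : elemsym (l ++ l') k = \sum_(j < k.+1) elemsym l j * elemsym l' (k - j).
Proof.
elim: l k => [|x l IHl] k /=.
  by rewrite big_ord_recl subn0 mul1r big1 ?addr0 // => i _; rewrite mul0r.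
rewrite IHl; case: k => [|k]; first by rewrite !big_ord_recl !big_ord0 /= !addr0.
rewrite IHl mulr_sumr.
under [in RHS]eq_bigr => j _ do rewrite mulrDl.
rewrite big_split; congr (_ + _).
rewrite [RHS]big_ord_recl /= mul0r add0r; apply: eq_bigr => j _ /=.
by rewrite subSS mulrA.
Qed.

Lemma coef_prod_XsubC_elemsym l i : (i <= size l)%N ->
  (\prod_(x <- l) ('X - x%:P))`_i = (-1) ^+ (size l - i) * elemsym l (size l - i).
Proof.
elim: l i => [|x l IHl] i; first by case: i => //= _; rewrite big_nil coef1 mulr1.
have lastz : (\prod_(x <- l) ('X - x%:P))`_(size l).+1 = 0.
  by rewrite nth_default // size_prod_XsubC.
rewrite big_cons mulrBl coefB coefXM coefCM /=.
case: i => [_|i]; first by rewrite IHl // !subn0 exprS (elemsym_eq0 (ltnSn _)); ring.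
rewrite ltnS subSS => il; rewrite IHl //=; move: il; rewrite leq_eqVlt => /orP[/eqP->|il].
  by rewrite lastz subnn elemsym0 mulr0 subr0 addr0.
rewrite IHl //; have -> : (size l - i = (size l - i.+1).+1)%N by lia.
by rewrite exprS; ring.
Qed.

(** If [d] members of [l] have modulus at least [T], then [T ^+ d * maxprod T l] is the product of
    their moduli, see [maxprod_big]. For any [j], [T ^+ j * maxprod T l] bounds every product of [j]
    members. *)
Definition maxprod (T : R) l := \prod_(x <- l) Num.max 1 (nm x / T).

Lemma maxprod_ge1 T l : 1 <= maxprod T l.
Proof.
rewrite /maxprod; elim/big_rec: _ => // x y _ y1.
by rewrite -[X in X <= _]mulr1 ler_pM // le_max lexx.
Qed.

Lemma maxprod_cat T l l' : maxprod T (l ++ l') = maxprod T l * maxprod T l'.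
Proof. by rewrite /maxprod big_cat. Qed.

Lemma elemsym_le T l j : 0 < T ->
  nm (elemsym l j) <= 2 ^+ size l * T ^+ j * maxprod T l.
Proof.
move=> T0; elim: l j => [|x l IHl] j.
  rewrite /maxprod big_nil expr0 mul1r mulr1.
  case: j => [|j]; first by rewrite elemsym0 Normc.normc1 expr0.
  by rewrite elemsym_eq0 // Normc.normc0 exprn_ge0 // ltW.
rewrite [elemsym _ _]/= [size _]/=.
rewrite /maxprod big_cons -/(maxprod T l); set M := maxprod T l in IHl *.
set mx := Num.max _ _.
have M1 : 1 <= M := maxprod_ge1 T l.
have mx1 : 1 <= mx by rewrite /mx le_max lexx.
have xmx : nm x <= mx * T by rewrite -ler_pdivrMr // /mx le_max lexx orbT.
have Tj : 0 < T ^+ j by rewrite exprn_gt0.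
have S0 : 0 < 2 ^+ size l :> R by rewrite exprn_gt0.
apply: le_trans (le_normcD _ _) _.
have -> : 2 ^+ (size l).+1 * T ^+ j * (mx * M) =
   2 ^+ size l * T ^+ j * M * mx + 2 ^+ size l * T ^+ j * M * mx by rewrite exprS; ring.
have pos i : 0 <= 2 ^+ size l * T ^+ i * M.
  by rewrite !mulr_ge0 ?exprn_ge0 // ?(ltW T0) // (le_trans _ M1).
apply: lerD.
  by apply: le_trans (IHl j) _; rewrite ler_peMr.
case: j {Tj} => [|j]; first by rewrite Normc.normc0 mulr_ge0 // (le_trans _ mx1).
rewrite Normc.normcM; apply: le_trans (ler_pM _ _ xmx (IHl j)) _; rewrite ?normc_ge0 //.
by rewrite exprS le_eqVlt; apply/orP; left; apply/eqP; ring.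
Qed.

Lemma prod_take_le T l j : 0 < T -> (j <= size l)%N ->
  \prod_(x <- take j l) nm x <= T ^+ j * maxprod T l.
Proof.
move=> T0; elim: l j => [|x l IHl] [|j] //= jl.
- by rewrite /maxprod !big_nil mulr1.
- by rewrite big_nil mul1r maxprod_ge1.
rewrite big_cons /maxprod big_cons -/(maxprod T l) exprS mulrACA.
apply: ler_pM; rewrite ?normc_ge0 ?prodr_ge0 //; try by move=> *; exact: normc_ge0.
  by rewrite mulrC -ler_pdivrMr // le_max lexx orbT.
exact: IHl.
Qed.

Section Gap.
Variables (T G : R).
Hypotheses (T0 : 0 < T) (G1 : 1 <= G).

Let big x := T <= nm x.

Definition gapped l := forall x, x \in l -> T <= nm x \/ G * nm x <= T.

Lemma gapped_cons x l : gapped (x :: l) -> (T <= nm x \/ G * nm x <= T) /\ gapped l.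
Proof. by move=> H; split=> [|y yl]; apply: H; rewrite inE ?eqxx ?yl ?orbT. Qed.

Lemma maxprod_big l : \prod_(x <- l | big x) nm x = T ^+ count big l * maxprod T l.
Proof.
elim: l => [|x l IHl]; first by rewrite /maxprod !big_nil mulr1.
rewrite big_cons /maxprod big_cons -/(maxprod T l) /= IHl /big; case: leP => h.
  rewrite exprS max_r; first by field; rewrite gt_eqF.
  by rewrite ler_pdivlMr // mul1r.
by rewrite add0n max_l ?mul1r // ler_pdivrMr // mul1r ltW.
Qed.

Lemma maxprod_gap l : gapped l -> maxprod (T / G) l = G ^+ count big l * maxprod T l.
Proof.
have G0 : 0 < G by rewrite (lt_le_trans _ G1).
elim: l => [|x l IHl] gl; first by rewrite /maxprod !big_nil mulr1.
have [gx {}/IHl IHl] := gapped_cons gl.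
rewrite /maxprod !big_cons -!/(maxprod _ l) /= IHl /big.
have -> : nm x / (T / G) = G * (nm x / T) by field; rewrite ?gt_eqF.
case: leP => h.
  have h1 : 1 <= nm x / T by rewrite ler_pdivlMr // mul1r.
  rewrite exprS (max_r h1) max_r; last by rewrite -[X in X <= _]mulr1 ler_pM.
  ring.
have h1 : G * (nm x / T) <= 1.
  rewrite mulrA ler_pdivrMr // mul1r.
  by case: gx => // /le_lt_trans /(_ h); rewrite ltxx.
rewrite (max_l h1) max_l ?mul1r //.
by rewrite ler_pdivrMr // mul1r ltW.
Qed.

(** Lowering the threshold from [T] to [T / G] multiplies [maxprod] by [G] for each large root, but
    [T ^+ j] is divided by [G ^+ j]. As [j] exceeds the number of large roots, at least one factor
    [G] is gained in [elemsym_le]. *)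
Lemma elemsym_gap l j : gapped l -> (count big l < j)%N ->
  nm (elemsym l j) <= 2 ^+ size l * T ^+ j * maxprod T l / G.
Proof.
move=> gl cj; have G0 : 0 < G by rewrite (lt_le_trans _ G1).
apply: le_trans (@elemsym_le (T / G) l j _) _; first by rewrite divr_gt0.
rewrite maxprod_gap // expr_div_n.
have -> : 2 ^+ size l * (T ^+ j / G ^+ j) * (G ^+ count big l * maxprod T l) =
   2 ^+ size l * T ^+ j * maxprod T l * (G ^+ count big l / G ^+ j) by ring.
rewrite ler_wpM2l //.
  by rewrite !mulr_ge0 ?exprn_ge0 // ?(ltW T0) // (le_trans _ (maxprod_ge1 _ _)).
rewrite ler_pdivrMr ?exprn_gt0 // mulrC ler_pdivlMr // -exprSr.
exact: ler_weXn2l.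
Qed.

(** Every other product with the same number of factors replaces a large root by a small one and so
    loses a factor [G]; there are at most [2 ^+ size l] products. *)
Lemma elemsym_main l : gapped l ->
  nm (elemsym l (count big l) - \prod_(x <- l | big x) x)
    <= 2 ^+ size l * (T ^+ count big l * maxprod T l) / G.
Proof.
have G0 : 0 < G by rewrite (lt_le_trans _ G1).
elim: l => [|x l IHl] gl.
  rewrite /maxprod /= !big_nil subrr Normc.normc0 expr0 !mul1r.
  by rewrite invr_ge0 ltW.
have [gx gl'] := gapped_cons gl; have {}IHl := IHl gl'.
rewrite big_cons /= /maxprod big_cons -/(maxprod T l).
set d := count big l in IHl *; set M := maxprod T l in IHl *.
set Pi := \prod_(_ <- _ | _) _ in IHl *.
have M1 : 1 <= M := maxprod_ge1 T l.
have Td : 0 <= T ^+ d by rewrite exprn_ge0 // ltW.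
have M0 : 0 <= M by rewrite (le_trans _ M1).
have Gi : 0 <= G^-1 by rewrite invr_ge0 ltW.
have S0 : 0 <= 2 ^+ size l :> R by rewrite exprn_ge0.
rewrite /big; case: (leP T (nm x)) => h.
  rewrite add1n max_r; last by rewrite ler_pdivlMr // mul1r.
  have -> : elemsym l d.+1 + x * elemsym l d - x * Pi = elemsym l d.+1 + x * (elemsym l d - Pi) by ring.
  apply: le_trans (le_normcD _ _) _.
  have -> : 2 ^+ (size l).+1 * (T ^+ d.+1 * (nm x / T * M)) / G =
     nm x * (2 ^+ size l * (T ^+ d * M) / G) + nm x * (2 ^+ size l * (T ^+ d * M) / G).
    by rewrite !exprS; field; rewrite ?gt_eqF.
  apply: lerD; last by rewrite Normc.normcM ler_wpM2l ?normc_ge0.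
  apply: le_trans (elemsym_gap gl' (ltnSn _)) _; rewrite -/d -/M exprS.
  have -> : 2 ^+ size l * (T * T ^+ d) * M / G = T * (2 ^+ size l * (T ^+ d * M) / G) by ring.
  by apply: ler_wpM2r => //; rewrite !mulr_ge0.
rewrite add0n max_l; last by rewrite ler_pdivrMr // mul1r ltW.
rewrite mul1r.
have -> : 2 ^+ (size l).+1 * (T ^+ d * M) / G =
   2 ^+ size l * (T ^+ d * M) / G + 2 ^+ size l * (T ^+ d * M) / G by rewrite exprS; ring.
rewrite addrAC; apply: le_trans (le_normcD _ _) _; apply: lerD => //.
case: d {IHl} Td => [|d] Td; first by rewrite Normc.normc0 !mulr_ge0.
have {}gx : nm x <= T / G.
  rewrite ler_pdivlMr // mulrC.
  by case: gx => // /le_lt_trans /(_ h); rewrite ltxx.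
rewrite Normc.normcM; apply: le_trans (ler_pM _ _ gx (elemsym_le l d T0)) _; rewrite ?normc_ge0 //.
by rewrite -/M exprS le_eqVlt; apply/orP; left; apply/eqP; field; rewrite gt_eqF.
Qed.

End Gap.

(** The full symmetric function is close to the product of the large roots, of modulus [P]. If
    exactly [j] of them lie in [la], so is [s1]. Otherwise one factor of [s1] asks for more large
    roots than its list has, hence [s1] is small and [s2] is close to that product. *)
Lemma gap_dichotomy T G la lb j :
  let k := count (fun x => T <= nm x) (la ++ lb) in
  let n := (size la + size lb)%N in
  let P := T ^+ k * maxprod T (la ++ lb) in
  let s1 := elemsym la j * elemsym lb (k - j) in
  let s2 := elemsym (la ++ lb) k - s1 in
  let e := 2 ^+ n.+2 / G in
  0 < T -> 2 ^+ n.+3 <= G -> gapped T G (la ++ lb) -> (j <= k)%N ->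
  (nm s2 <= e * nm s1 \/ nm s1 <= e * nm s2) /\ (P / 2 <= nm s1 \/ P / 2 <= nm s2).
Proof.
move=> k n P s1 s2 e T0 GG gl jk.
have n1 : 1 <= 2 ^+ n :> R by apply: exprn_ege1; rewrite ler1n.
have G1 : 1 <= G by apply: le_trans GG; rewrite !exprS; lra.
have G0 : 0 < G by rewrite (lt_le_trans _ G1).
have gla : gapped T G la by move=> x xl; apply: gl; rewrite mem_cat xl.
have glb : gapped T G lb by move=> x xl; apply: gl; rewrite mem_cat xl orbT.
pose big x := T <= nm x.
set dA := count big la; set dB := count big lb.
have kE : k = (dA + dB)%N by rewrite /k count_cat.
pose PA := T ^+ dA * maxprod T la; pose PB := T ^+ dB * maxprod T lb.
have PE : P = PA * PB by rewrite /P maxprod_cat kE exprD /PA /PB; ring.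
(* The basic relative error, at most [1 / 8] by the lower bound on [G]. That [e] is [4 * q] comes
   from the first case, where [s2] may reach [3 * q * P] while [s1] is only known to be at least
   [3 / 4 * P]. *)
pose q := 2 ^+ n / G.
have q8 : q <= 1 / 8.
  by rewrite /q ler_pdivrMr //; move: GG; rewrite !exprS; lra.
have q0 : 0 <= q by rewrite /q divr_ge0 ?exprn_ge0 // ltW.
have eE : e = 4 * q by rewrite /e /q !exprS; ring.
have PA0 : 0 < PA by rewrite mulr_gt0 ?exprn_gt0 // (lt_le_trans _ (maxprod_ge1 _ _)).
have PB0 : 0 < PB by rewrite mulr_gt0 ?exprn_gt0 // (lt_le_trans _ (maxprod_ge1 _ _)).
have P0 : 0 < P by rewrite PE mulr_gt0.
pose Pi := \prod_(x <- la ++ lb | big x) x.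
have nPi : nm Pi = P by rewrite /Pi normc_prod maxprod_big.
have tot : nm (elemsym (la ++ lb) k - Pi) <= q * P.
  apply: le_trans (elemsym_main T0 G1 gl) _; rewrite size_cat -/n -/P /q.
  by rewrite mulrAC.
have totge : P - q * P <= nm (elemsym (la ++ lb) k).
  rewrite -nPi lerBlDr; apply: le_trans (lerD (lexx _) (_ : nm (Pi - elemsym (la ++ lb) k) <= _)).
    by rewrite -[X in nm X <= _](subrKC (elemsym (la ++ lb) k)) le_normcD.
  by rewrite -normcN opprB nPi.
have [djE|djN] := eqVneq dA j.
  pose PiA := \prod_(x <- la | big x) x; pose PiB := \prod_(x <- lb | big x) x.
  have kj : (k - j = dB)%N by rewrite kE djE addKn.
  have eA := elemsym_main T0 G1 gla; have eB := elemsym_main T0 G1 glb.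
  rewrite -/dA -/dB -/PA -/PB -/PiA -/PiB in eA eB.
  have s1Pi : nm (s1 - Pi) <= 2 * q * P.
    have -> : s1 - Pi = (elemsym la dA - PiA) * elemsym lb dB + PiA * (elemsym lb dB - PiB).
      by rewrite /s1 kj -djE /Pi big_cat -/PiA -/PiB /=; ring.
    apply: le_trans (le_normcD _ _) _; rewrite !Normc.normcM.
    have h1 := ler_pM (normc_ge0 _) (normc_ge0 _) eA (elemsym_le lb dB T0).
    have nPiA : nm PiA = PA by rewrite /PiA normc_prod maxprod_big.
    have h2 := ler_wpM2l (normc_ge0 PiA) eB; rewrite nPiA in h2.
    rewrite nPiA; apply: le_trans (lerD h1 h2) _.
    have -> : 2 * q * P = q * P + q * P by ring.
    apply: lerD.
      rewrite le_eqVlt; apply/orP; left; apply/eqP.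
      by rewrite /q PE /n exprD /PB; ring.
    have -> : PA * (2 ^+ size lb * PB / G) = 2 ^+ size lb / G * P by rewrite PE; ring.
    rewrite ler_wpM2r ?(ltW P0) // /q ler_wpM2r ?invr_ge0 ?(ltW G0) //.
    by rewrite ler_weXn2l ?ler1n // /n leq_addl.
  have s1ge : P - 2 * q * P <= nm s1.
    rewrite -nPi lerBlDr; apply: le_trans (lerD (lexx _) (_ : nm (Pi - s1) <= _)).
      by rewrite -[X in nm X <= _](subrKC s1) le_normcD.
    by rewrite -normcN opprB nPi.
  have s2le : nm s2 <= 3 * q * P.
    have -> : s2 = (elemsym (la ++ lb) k - Pi) - (s1 - Pi) by rewrite /s2; ring.
    by apply: le_trans (le_normc_sub _ _) _; move: tot s1Pi; lra.
  have : q * P <= 1 / 8 * P by rewrite ler_wpM2r // ltW.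
  move=> qP; split; last by left; lra.
  left; rewrite eE; have : 4 * q * (3 / 4 * P) <= 4 * q * nm s1 by rewrite ler_wpM2l //; lra.
  by lra.
have s1le : nm s1 <= q * P.
  rewrite Normc.normcM.
  case: (ltngtP dA j) => [lt|gt|/eqP]; last by rewrite (negbTE djN).
    have h1 := ler_pM (normc_ge0 _) (normc_ge0 _) (elemsym_gap T0 G1 gla lt) (elemsym_le lb (k - j) T0).
    apply: le_trans h1 _; rewrite le_eqVlt; apply/orP; left; apply/eqP.
    by rewrite /q /P -{2}(subnKC jk) maxprod_cat /n !exprD; ring.
  have lt : (dB < k - j)%N by rewrite ltn_subRL kE ltn_add2r.
  have h1 := ler_pM (normc_ge0 _) (normc_ge0 _) (elemsym_le la j T0) (elemsym_gap T0 G1 glb lt).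
  apply: le_trans h1 _; rewrite le_eqVlt; apply/orP; left; apply/eqP.
  by rewrite /q /P -{2}(subnKC jk) maxprod_cat /n !exprD; ring.
have : q * P <= 1 / 8 * P by rewrite ler_wpM2r // ltW.
have s2ge : P - 2 * q * P <= nm s2.
  have := le_normcD s2 s1; rewrite /s2 subrK => h; move: h totge s1le; rewrite -/s2; lra.
move=> qP; split; last by right; lra.
right; rewrite eE; have : 4 * q * (3 / 4 * P) <= 4 * q * nm s2 by rewrite ler_wpM2l //; lra.
have := mulr_ge0 q0 (ltW P0); lra.
Qed.

End ElementarySymmetric.

(** * Eigenvalue moduli of complex matrices *)

Section Spectrum.
Variable R : realType.
Local Notation C := R[i].
Local Notation nm := (@Normc.normc R).

Definition mx_roots n (M : 'M[C]_n) : seq C := sval (closed_field_poly_normal (char_poly M)).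

Lemma mx_rootsP n (M : 'M[C]_n) : char_poly M = \prod_(x <- mx_roots M) ('X - x%:P).
Proof.
rewrite /mx_roots; case: closed_field_poly_normal => s /= {1}->.
by rewrite (monicP (char_poly_monic M)) scale1r.
Qed.

Lemma size_mx_roots n (M : 'M[C]_n) : size (mx_roots M) = n.
Proof.
by have := size_char_poly M; rewrite mx_rootsP size_prod_XsubC => -[].
Qed.

(** The entrywise norm, used because it is submultiplicative: together with the norm of the inverse
    it encloses all eigenvalue moduli. *)
Definition mx_sum p q (M : 'M[C]_(p, q)) := \sum_i \sum_j nm (M i j).

Lemma mx_sum_ge0 p q (M : 'M[C]_(p, q)) : 0 <= mx_sum M.
Proof. by apply: sumr_ge0 => i _; apply: sumr_ge0 => j _; exact: normc_ge0. Qed.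

Lemma mx_sum_mul p q r (M : 'M[C]_(p, q)) (N : 'M[C]_(q, r)) :
  mx_sum (M *m N) <= mx_sum M * mx_sum N.
Proof.
rewrite /mx_sum mulr_suml; apply: ler_sum => i _; rewrite mulr_suml.
have le j : \sum_l nm (N j l) <= \sum_k \sum_l nm (N k l).
  rewrite [leRHS](bigD1 j) //= lerDl; apply: sumr_ge0 => ? _; apply: sumr_ge0 => ? _; exact: normc_ge0.
apply: le_trans (_ : \sum_k \sum_j nm (M i j) * nm (N j k) <= _).
  apply: ler_sum => k _; rewrite mxE; apply: le_trans (le_normc_sum _ _ _) _.
  by apply: ler_sum => j _; rewrite Normc.normcM.
rewrite exchange_big; apply: ler_sum => j _; rewrite -mulr_sumr.
by rewrite ler_wpM2l ?normc_ge0 // le.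
Qed.

Lemma mx_roots_eigen n (M : 'M[C]_n) x : x \in mx_roots M ->
  exists2 v : 'rV[C]_n, v *m M = x *: v & v != 0.
Proof.
by rewrite -root_prod_XsubC -mx_rootsP -eigenvalue_root_char => /eigenvalueP.
Qed.

Lemma mx_sumZ p q c (M : 'M[C]_(p, q)) : mx_sum (c *: M) = nm c * mx_sum M.
Proof.
rewrite /mx_sum mulr_sumr; apply: eq_bigr => i _; rewrite mulr_sumr.
by apply: eq_bigr => j _; rewrite mxE Normc.normcM.
Qed.

Lemma mx_sum_gt0 n (v : 'rV[C]_n) : v != 0 -> 0 < mx_sum v.
Proof.
move=> v0; rewrite lt_def mx_sum_ge0 andbT; apply: contra v0 => /eqP s0.
apply/eqP/rowP => j; rewrite mxE; apply/Normc.eq0_normc/eqP.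
rewrite eq_le normc_ge0 andbT -s0 /mx_sum big_ord1 (bigD1 j) //= lerDl.
by apply: sumr_ge0 => ? _; exact: normc_ge0.
Qed.

Lemma mx_roots_le n (M : 'M[C]_n) x : x \in mx_roots M -> nm x <= mx_sum M.
Proof.
move=> /mx_roots_eigen[v vM /mx_sum_gt0 v0].
rewrite -(ler_pM2r v0) -mx_sumZ -vM mulrC; exact: mx_sum_mul.
Qed.

Lemma mx_roots_ge n (M M' : 'M[C]_n) x : M *m M' = 1%:M -> x \in mx_roots M ->
  1 <= nm x * mx_sum M'.
Proof.
move=> MM' /mx_roots_eigen[v vM /mx_sum_gt0 v0].
rewrite -(ler_pM2r v0) mul1r -[X in mx_sum X <= _]mulmx1 -MM' mulmxA vM -scalemxAl mx_sumZ.
by rewrite -mulrA ler_wpM2l ?normc_ge0 // mulrC mx_sum_mul.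
Qed.

(** The threshold is [lambda_k] itself: [nth] counts from zero, so the positions [k.-1] and [k] hold
    [lambda_k] and [lambda_(k+1)]. *)
Lemma sorted_gap (s : seq R) k G : (0 < k < size s)%N -> (forall x, x \in s -> 0 < x) -> 1 < G ->
  let l := sort >=%O s in
  G * nth 0 l k <= nth 0 l k.-1 ->
  [/\ 0 < nth 0 l k.-1, count (fun x => nth 0 l k.-1 <= x) s = k &
    forall x, x \in s -> nth 0 l k.-1 <= x \/ G * x <= nth 0 l k.-1].
Proof.
move=> /andP[k0 ks] pos G1 l gap.
have szl : size l = size s by rewrite size_sort.
have meml x : (x \in l) = (x \in s) by rewrite mem_sort.
have srt : sorted >=%O l by apply: sort_sorted => x y; exact: le_total.
have nthl i j : (i <= j)%N -> (j < size l)%N -> nth 0 l j <= nth 0 l i.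
  move=> ij jl.
  have tr : transitive (>=%O : rel R) by move=> y x z /= h1 h2; exact: le_trans h2 h1.
  have rf : reflexive (>=%O : rel R) by move=> x /=.
  by apply: (sorted_leq_nth tr rf 0 srt) => //; rewrite inE (leq_ltn_trans ij).
have T0 : 0 < nth 0 l k.-1 by apply: pos; rewrite -meml mem_nth // szl; lia.
have S0 : 0 < nth 0 l k by apply: pos; rewrite -meml mem_nth // szl.
have ST : nth 0 l k < nth 0 l k.-1 by apply: lt_le_trans gap; rewrite ltr_pMl.
have bigP i : (i < size l)%N -> (nth 0 l k.-1 <= nth 0 l i) = (i < k)%N.
  move=> il; case: ltnP => ik; first by apply: nthl; lia.
  by apply/negbTE; rewrite -ltNge; apply: le_lt_trans ST; exact: nthl.
split=> //.
  pose p (x : R) := nth 0 l k.-1 <= x.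
  have e1 : count p (take k l) = size (take k l).
    apply/eqP; rewrite -all_count; apply/allP => x xl; have [i ik <-] := nthP 0 xl.
    move: ik; rewrite size_take szl ks => ik; rewrite nth_take // /p bigP // szl; lia.
  have e2 : count p (drop k l) = 0%N.
    apply/eqP; rewrite -leqn0 leqNgt -has_count; apply/negP => /hasP[x xl]; have [i ik <-] := nthP 0 xl.
    move: ik; rewrite size_drop => ik; by rewrite nth_drop /p bigP; [rewrite ltnNge leq_addr|rewrite -ltn_subRL].
  rewrite -(count_sort >=%O) -/l -/p -[in LHS](cat_take_drop k l) count_cat e1 e2.
  by rewrite size_take szl ks addn0.
move=> x; rewrite -meml => xl; have [i il <-] := nthP 0 xl.
case: (ltnP i k) => ik; first by left; rewrite bigP.
right; apply: le_trans gap; rewrite ler_pM2l ?(lt_trans _ G1) //; exact: nthl.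
Qed.

Lemma elemsym_le_roots (l : seq C) hi j : 0 < hi -> (forall x, x \in l -> nm x <= hi) ->
  nm (elemsym l j) <= 2 ^+ size l * hi ^+ j.
Proof.
move=> hi0 lhi; have := elemsym_le l j hi0; rewrite /maxprod big1_seq ?mulr1 // => x /= xl.
by rewrite max_l // ler_pdivrMr // mul1r lhi.
Qed.

Lemma prod_take_ge (l : seq C) lo j : 0 <= lo -> (j <= size l)%N -> (forall x, x \in l -> lo <= nm x) ->
  lo ^+ j <= \prod_(x <- take j l) nm x.
Proof.
move=> lo0; elim: l j => [|x l IHl] [|j] //= jl llo; rewrite ?big_nil ?expr0 //.
rewrite big_cons exprS ler_pM ?exprn_ge0 //; first by rewrite llo ?mem_head.
by apply: IHl => // y yl; apply: llo; rewrite inE yl orbT.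
Qed.

(** The right-hand side bounds every product of [k] roots, in particular one with [j] roots from
    [la] and [k - j] from [lb]. No relation between [T] and the roots is assumed. *)
Lemma maxprod_ge_roots (la lb : seq C) (T loA loB : R) j k : 0 < T -> 0 <= loA -> 0 <= loB ->
  (j <= size la)%N -> (j <= k)%N -> (k - j <= size lb)%N ->
  (forall x, x \in la -> loA <= nm x) -> (forall x, x \in lb -> loB <= nm x) ->
  loA ^+ j * loB ^+ (k - j) <= T ^+ k * maxprod T (la ++ lb).
Proof.
move=> T0 A0 B0 ja jk kb hA hB.
rewrite maxprod_cat -{2}(subnKC jk) exprD mulrACA.
apply: ler_pM; rewrite ?exprn_ge0 //.
  exact: le_trans (prod_take_ge A0 ja hA) (prod_take_le T0 ja).
exact: le_trans (prod_take_ge B0 kb hB) (prod_take_le T0 kb).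
Qed.

Lemma recur_family_elemsym (I : Type) n (M : I -> nat -> 'M[C]_n) j :
  recur_family_mx M -> recur_family (fun i m => elemsym (mx_roots (M i m)) j).
Proof.
move=> MM; have [jn|nj] := leqP j n; last first.
  apply: recur_family_ext (recur_family_const (fun=> 0)) => i m.
  by rewrite elemsym_eq0 // size_mx_roots.
apply: recur_family_ext (recur_familyM (recur_family_const (fun=> (-1) ^+ j))
  (recur_family_char_poly MM (n - j)%N)) => i m.
rewrite mx_rootsP coef_prod_XsubC_elemsym ?size_mx_roots ?leq_subr // subKn //.
by rewrite mulrA -exprD addnn -mul2n exprM sqrrN !expr1n mul1r.
Qed.

End Spectrum.

(** * Dominance along a run of test words *)

Section NoGap.
Variables (R : realType) (Gamma : groupType) (len : Gamma -> nat) (alpha beta : Gamma).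
Local Notation C := R[i].
Local Notation nm := (@Normc.normc R).

Definition test_word (N m : nat) : Gamma :=
  (alpha ^+ (N - m) * (beta * alpha ^- m * beta^-1))%g.

Hypothesis len_growth : forall K, exists N0, forall N m, (N0 <= N)%N -> (m <= N)%N ->
  (K <= len (test_word N m))%N.

Definition matrix_hom n (X : Gamma -> 'M[C]_n.+1) :=
  X 1%g = 1 /\ forall g h : Gamma, X (g * h)%g = X g * X h.

Section OneHom.
Variables (n : nat) (X : Gamma -> 'M[C]_n.+1).
Hypothesis homX : matrix_hom X.

Lemma matrix_hom_unit g : X g \in unitmx.
Proof.
have [X1 XM] := homX; have := mulmx1_unit (_ : X g *m X g^-1%g = 1%:M).
by rewrite -[X g *m _]XM mulgV X1 => /(_ erefl)[].
Qed.

Lemma matrix_homX g m : X (g ^+ m)%g = X g ^+ m.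
Proof.
have [X1 XM] := homX.
by elim: m => [|m IHm]; rewrite ?X1 ?expr0 // expgS XM IHm exprS.
Qed.

(** Writing [alpha ^+ (N - m)] as [alpha ^+ N] times a power of [alpha^-1] makes [N] enter only
    through a constant factor, and defines the sequence for all [m]; so it satisfies one recurrence
    for all [N]. *)
Definition test_matrix (N m : nat) : 'M[C]_n.+1 :=
  X alpha ^+ N * X alpha^-1%g ^+ m * (X beta * X alpha^-1%g ^+ m * X beta^-1%g).

Lemma test_matrixE N m : (m <= N)%N -> test_matrix N m = X (test_word N m).
Proof.
move=> mN; have [X1 XM] := homX.
by rewrite /test_matrix /test_word expgnFr // !XM -!expVgn !matrix_homX.
Qed.

Lemma recur_family_test_matrix : recur_family_mx test_matrix.
Proof.
have pow := @recur_family_pow R nat n _ (matrix_hom_unit alpha^-1%g).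
have cst := @recur_family_mx_const R nat.
apply: recur_family_mulmx.
  by apply: recur_family_mulmx => //; exact: cst.
apply: recur_family_mulmx; last exact: cst.
by apply: recur_family_mulmx => //; exact: cst.
Qed.

End OneHom.

Variables (a b : nat) (X : Gamma -> 'M[C]_a.+1) (Y : Gamma -> 'M[C]_b.+1).
Hypotheses (homX : matrix_hom X) (homY : matrix_hom Y).

Definition joint_spectrum g := mx_roots (X g) ++ mx_roots (Y g).

Definition log_gap k g : R :=
  let l := sort >=%O [seq nm z | z <- joint_spectrum g] in
  ln (nth 0 l k.-1 / nth 0 l k).

Lemma size_joint_spectrum g : size (joint_spectrum g) = (a.+1 + b.+1)%N.
Proof. by rewrite size_cat !size_mx_roots. Qed.

Lemma joint_spectrum_neq0 g x : x \in joint_spectrum g -> x != 0.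
Proof.
rewrite mem_cat => xs; apply/eqP => x0.
have nz n (Z : Gamma -> 'M[C]_n.+1) : matrix_hom Z -> 0 \notin mx_roots (Z g).
  move=> homZ; apply/negP => /mx_roots_eigen[v].
  rewrite scale0r => vZ /eqP; apply.
  by rewrite -[v](mulmxK (matrix_hom_unit homZ g)) vZ mul0mx.
by move: xs; rewrite x0 (negbTE (nz _ _ homX)) (negbTE (nz _ _ homY)).
Qed.

Lemma gapped_joint_spectrum k g G : (0 < k < a.+1 + b.+1)%N -> 1 < G -> ln G <= log_gap k g ->
  exists T, [/\ 0 < T, count (fun x => T <= nm x) (joint_spectrum g) = k &
    gapped T G (joint_spectrum g)].
Proof.
move=> kn G1 lnG; pose s := [seq nm z | z <- joint_spectrum g].
have pos x : x \in s -> 0 < x.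
  by move=> /mapP[z /joint_spectrum_neq0 z0 ->]; rewrite normc_gt0.
have G0 : 0 < G by rewrite (lt_trans _ G1).
have ks : (0 < k < size s)%N by rewrite size_map size_joint_spectrum.
have mem i : (i < size s)%N -> 0 < nth 0 (sort >=%O s) i.
  by move=> i_lt; apply: pos; rewrite -(mem_sort >=%O) mem_nth // size_sort.
have [k0 ks'] := andP ks.
have p1 := mem k ks'; have p2 : 0 < nth 0 (sort >=%O s) k.-1 by apply: mem; lia.
have gap : G * nth 0 (sort >=%O s) k <= nth 0 (sort >=%O s) k.-1.
  by rewrite -ler_pdivlMr // -ler_ln ?posrE ?divr_gt0.
have [T0 cT alt] := sorted_gap ks pos G1 gap.
exists (nth 0 (sort >=%O s) k.-1); split=> //; last by move=> x xs; apply: alt; exact: map_f.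
by rewrite -[RHS]cT /s count_map.
Qed.

Variables (k j : nat).
Hypotheses (kn : (0 < k < a.+1 + b.+1)%N) (jk : (j <= k)%N).

Definition split_term (g : Gamma) := elemsym (mx_roots (X g)) j * elemsym (mx_roots (Y g)) (k - j).
Definition rest_term (g : Gamma) := elemsym (joint_spectrum g) k - split_term g.

Hypothesis start_bound : forall L e, 0 < e -> exists N1, forall N m T, (N1 <= N)%N -> (m <= L)%N -> (m <= N)%N ->
  0 < T -> nm (rest_term (test_word N m)) <= e * (T ^+ k * maxprod T (joint_spectrum (test_word N 0))).
Hypothesis end_bound : forall L e, 0 < e -> exists N1, forall N m T, (N1 <= N)%N -> (m <= L)%N -> (m <= N)%N ->
  0 < T -> nm (split_term (test_word N (N - m))) <= e * (T ^+ k * maxprod T (joint_spectrum (test_word N N))).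

Definition test_split N m :=
  elemsym (mx_roots (test_matrix X N m)) j * elemsym (mx_roots (test_matrix Y N m)) (k - j).
Definition test_rest N m :=
  elemsym (mx_roots (test_matrix X N m) ++ mx_roots (test_matrix Y N m)) k - test_split N m.

Lemma test_splitE N m : (m <= N)%N -> test_split N m = split_term (test_word N m).
Proof.
by move=> mN; rewrite /test_split (test_matrixE homX mN) (test_matrixE homY mN).
Qed.

Lemma test_restE N m : (m <= N)%N -> test_rest N m = rest_term (test_word N m).
Proof.
move=> mN; rewrite /test_rest (test_splitE mN).
by rewrite (test_matrixE homX mN) (test_matrixE homY mN).
Qed.

Theorem no_uniform_gap (a0 b0 : R) : 0 < a0 ->
  ~ (forall g, a0 * (len g)%:R - b0 <= log_gap k g).
Proof.
move=> a00 gapP.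
pose n := (a.+1 + b.+1)%N.
pose s1 := test_split; pose s2 := test_rest.
have s1E N m : (m <= N)%N -> s1 N m = split_term (test_word N m) by exact: test_splitE.
have s2E N m : (m <= N)%N -> s2 N m = rest_term (test_word N m) by exact: test_restE.
have fX := recur_family_test_matrix homX; have fY := recur_family_test_matrix homY.
have fs1 : recur_family s1.
  exact: recur_familyM (recur_family_elemsym j fX) (recur_family_elemsym (k - j) fY).
have fs2 : recur_family s2.
  apply: recur_family_ext (recur_familyD (recur_family_sum (index_enum 'I_k.+1) xpredT
    (fun i => recur_familyM (recur_family_elemsym i fX) (recur_family_elemsym (k - i) fY)))
    (recur_familyN fs1)) => N m.
  by rewrite /s2 /test_rest elemsym_cat.
have [l1 l10 r1] := fs1; have [l2 l20 r2] := fs2.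
have l0 : 0 \notin l1 ++ l2 by rewrite mem_cat negb_or l10.
have [M M0 nd] := nondegenerate_power l0.
set l := [seq x ^+ M | x <- l1 ++ l2] in nd.
have l0' : 0 \notin l.
  apply/negP => /mapP[x xl /esym/eqP]; rewrite expf_eq0 M0 /= => /eqP x0.
  by move: l0; rewrite -x0 xl.
have rs1 N : recur l (fun m => s1 N (M * m)%N) by apply: recur_sub; apply: recur_catl.
have rs2 N : recur l (fun m => s2 N (M * m)%N) by apply: recur_sub; apply: recur_catr.
have [L [K [L0 K0 dom]]] := dominance_persists l0' nd.
(* The power of two is what [gap_dichotomy] requires; the factor [K + 1] gives
   [K * e = K / (2 * (K + 1)) < 1] for [dominance_persists]. *)
pose G := 2 ^+ n.+3 * (K + 1).
have K1 : 1 < K + 1 by rewrite ltrDr.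
have p8 m : 8 <= 2 ^+ m.+3 :> R.
  have : 1 <= 2 ^+ m :> R by rewrite exprn_ege1 // ler1n.
  by rewrite !exprS; lra.
have GG : 2 ^+ n.+3 <= G by rewrite /G ler_peMr ?exprn_ge0 // ltW.
have G1 : 1 < G by apply: lt_le_trans GG; apply: lt_le_trans (p8 n); lra.
have G0 : 0 < G by rewrite (lt_trans _ G1).
pose e := 2 ^+ n.+2 / G.
have e0 : 0 <= e by rewrite /e divr_ge0 ?exprn_ge0 // ltW.
have Ke : K * e < 1.
  rewrite /e mulrA ltr_pdivrMr // mul1r /G [2 ^+ n.+3]exprS.
  have : 0 < 2 ^+ n.+2 :> R by rewrite exprn_gt0.
  by move: (2 ^+ n.+2) => y y0; nra.
(* From this length on the assumed gap is at least [ln G]. *)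
pose Kl := Num.bound (`|(ln G + b0) / a0|).
have [N0 N0P] := len_growth Kl.
have gapw N m : (N0 <= N)%N -> (m <= N)%N -> ln G <= log_gap k (test_word N m).
  move=> N0N mN; apply: le_trans (gapP _); rewrite lerBrDr mulrC -ler_pdivrMr //.
  apply: le_trans (ler_norm _) _; apply: le_trans (ltW (archi_boundP (normr_ge0 _))) _.
  by rewrite ler_nat N0P.
have dich N m : (N0 <= N)%N -> (m <= N)%N -> exists2 T, 0 < T &
    (nm (s2 N m) <= e * nm (s1 N m) \/ nm (s1 N m) <= e * nm (s2 N m)) /\
    (T ^+ k * maxprod T (joint_spectrum (test_word N m)) / 2 <= nm (s1 N m) \/
     T ^+ k * maxprod T (joint_spectrum (test_word N m)) / 2 <= nm (s2 N m)).
  move=> N0N mN; have [T [T0 cT gT]] := gapped_joint_spectrum kn G1 (gapw N m N0N mN).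
  exists T => //; have := @gap_dichotomy R T G (mx_roots (X (test_word N m))) (mx_roots (Y (test_word N m))) j.
  rewrite /= -/(joint_spectrum _) cT !size_mx_roots -/n => /(_ T0 GG gT jk).
  by rewrite (s1E N m mN) (s2E N m mN).
(* The [L] terms of a window then add up to at most [P / 4], less than the term of modulus at least
   [P / 2] that the dichotomy provides at the end of the run. *)
pose eps := (4 * L%:R)^-1 : R.
have L0' : 0 < L%:R :> R by rewrite ltr0n.
have eps0 : 0 < eps by rewrite invr_gt0 mulr_gt0.
have [N1 start] := start_bound (M * L) eps0.
have [N2 endb] := end_bound (M * L) eps0.
(* With [N] a multiple of [M], the sampled indices [M * m] contain both ends [0] and [N] of the
   run. *)
pose N' := (N0 + N1 + N2 + L)%N; pose N := (M * N')%N.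
have NN' : (N' <= N)%N by rewrite /N leq_pmull.
have win_lt (s : nat -> C) w P : 0 < P ->
   (forall i, (i < L)%N -> nm (s (w + i)%N) <= eps * P) -> window L s w < P / 2.
  move=> P0 /window_le le; apply: le_lt_trans le _.
  have -> : L%:R * (eps * P) = P / 4 by rewrite /eps; field; rewrite gt_eqF.
  by lra.
have Ppos T g : 0 < T -> 0 < T ^+ k * maxprod T (joint_spectrum g).
  by move=> T0; rewrite mulr_gt0 ?exprn_gt0 // (lt_le_trans _ (maxprod_ge1 _ _)).
(* The window that starts at [n'] has [N'] as its last index, which is sampled at [N]. *)
pose n' := (N' - L).+1.
have N1N : (N1 <= N)%N by apply: leq_trans NN'; rewrite /N'; clear; lia.
have N2N : (N2 <= N)%N by apply: leq_trans NN'; rewrite /N'; clear; lia.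
have n'L : (n' + L = N'.+1)%N by rewrite /n' addSn subnK // /N' leq_addl.
have := dom e (fun m => s1 N (M * m)%N) (fun m => s2 N (M * m)%N) n' (rs1 N) (rs2 N) e0 Ke.
have mulN m : (m <= N')%N -> (M * m <= N)%N by move=> mN; rewrite leq_mul2l mN orbT.
have N0N : (N0 <= N)%N by apply: leq_trans NN'; rewrite /N' -!addnA leq_addr.
move=> /(_ _)/(_ _)/wrap[].
- move=> m; rewrite n'L ltnS => mN'.
  by have [T T0 [[]]] := dich N (M * m)%N N0N (mulN _ mN'); [right|left].
- have [T T0 [_ big]] := dich N 0%N N0N (leq0n _).
  set P := T ^+ k * _ in big.
  have P0 : 0 < P := Ppos _ _ T0.
  have w2 : window L (fun m => s2 N (M * m)%N) 0 < P / 2.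
    apply: win_lt => // i iL; rewrite add0n.
    have iN : (M * i <= N)%N by apply: mulN; rewrite /N' (leq_trans (ltnW iL)) // leq_addl.
    rewrite s2E //; apply: start => //.
    by rewrite leq_mul2l (ltnW iL) orbT.
  apply: (lt_le_trans w2).
  have g0 := @window_ge R L (fun m => s1 N (M * m)%N) 0 0 L0.
  have g0' := @window_ge R L (fun m => s2 N (M * m)%N) 0 0 L0.
  rewrite /= addn0 muln0 in g0 g0'.
  case: big => [h|h]; first exact: le_trans g0.
  by have := lt_le_trans (le_lt_trans g0' w2) h; rewrite ltxx.
have [T T0 [_ big]] := dich N N N0N (leqnn _).
set P := T ^+ k * _ in big.
have P0 : 0 < P := Ppos _ _ T0.
have w1 : window L (fun m => s1 N (M * m)%N) n' < P / 2.
  apply: win_lt => // i iL.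
  have iN' : (n' + i <= N')%N by rewrite -ltnS -n'L ltn_add2l.
  have -> : (M * (n' + i) = N - M * (N' - (n' + i)))%N by rewrite /N -mulnBr subKn.
  rewrite s1E ?leq_subr //; apply: endb => //.
  - by rewrite leq_mul2l; apply/orP; right; move: n'L; clear; lia.
  - by apply: mulN; rewrite leq_subr.
apply/negP; rewrite -ltNge; apply: (lt_le_trans w1).
have lastE : (n' + L.-1 = N')%N by move: n'L L0; clear; lia.
have g1 := @window_ge R L (fun m => s1 N (M * m)%N) n' L.-1.
have g2 := @window_ge R L (fun m => s2 N (M * m)%N) n' L.-1.
rewrite /= lastE -/N prednK // in g1 g2.
case: big => [h|h]; last exact: le_trans (g2 _).
by have := lt_le_trans (le_lt_trans (g1 (leqnn _)) w1) h; rewrite ltxx.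
Qed.

End NoGap.

(** * Block sums twisted by characters *)

Section Twist.
Variables (R : realType) (Gamma : groupType) (len : Gamma -> nat) (alpha beta : Gamma).
Variable phi : Gamma -> int.
Local Notation C := R[i].
Local Notation nm := (@Normc.normc R).
Hypothesis phiM : forall g h : Gamma, phi (g * h)%g = phi g + phi h.
Local Notation w := (test_word alpha beta).

Lemma normc_real (x : R) : 0 <= x -> nm x%:C = x.
Proof. by move=> x0; rewrite /= expr0n /= addr0 sqrtr_sqr ger0_norm. Qed.

Definition twist n (c : R) (X : Gamma -> 'M[C]_n) g :=
  (expR (c * (phi g)%:~R))%:C *: X g.

Lemma matrix_hom_twist n c (X : Gamma -> 'M[C]_n.+1) :
  matrix_hom X -> matrix_hom (twist c X).
Proof.
move=> [X1 XM]; split; first by rewrite /twist (phi1 phiM) mulr0 expR0 X1 scale1r.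
move=> g h; rewrite /twist phiM rmorphD mulrDr expRD XM rmorphM /=.
by rewrite -scalerAl -scalerAr scalerA.
Qed.

(** Both [w N m] and its inverse cost at most [N + 4] factors of norm at most [c], an empty power
    counting as one factor because the identity may have norm above [1]. As [N + 4 <= 5 * N] for
    positive [N], the rate [c ^+ 5] is enough. *)
Lemma matrix_hom_bound n (X : Gamma -> 'M[C]_n.+1) : matrix_hom X ->
  exists2 q : R, 0 <= q & forall N m, (0 < N)%N -> (m <= N)%N ->
    mx_sum (X (w N m)) <= expR (q * N%:R) /\ mx_sum (X (w N m)^-1%g) <= expR (q * N%:R).
Proof.
move=> [X1 XM].
pose c := 1 + mx_sum (X 1%g) + mx_sum (X alpha) + mx_sum (X alpha^-1%g)
  + mx_sum (X beta) + mx_sum (X beta^-1%g).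
have p1 := mx_sum_ge0 (X 1%g); have p2 := mx_sum_ge0 (X alpha).
have p3 := mx_sum_ge0 (X alpha^-1%g); have p4 := mx_sum_ge0 (X beta).
have p5 := mx_sum_ge0 (X beta^-1%g).
have c1 : 1 <= c by rewrite /c; lra.
have c0 : 0 <= c by rewrite (le_trans _ c1).
pose P g e := mx_sum (X g) <= c ^+ e.
have PM g h e e' : P g e -> P h e' -> P (g * h)%g (e + e')%N.
  move=> Pg Ph; rewrite /P XM exprD; apply: le_trans (mx_sum_mul _ _) _.
  by apply: ler_pM => //; exact: mx_sum_ge0.
have [Q1 Qa Qa' Qb Qb'] : [/\ P 1%g 1%N, P alpha 1%N, P alpha^-1%g 1%N, P beta 1%N & P beta^-1%g 1%N].
  by rewrite /P !expr1 /c; split; lra.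
have PX g e : P g 1%N -> P (g ^+ e)%g e.+1.
  by move=> Pg; elim: e => [//|e IHe]; rewrite expgS -add1n; apply: (PM).
have fin g e N : (0 < N)%N -> (e <= N + 4)%N -> P g e -> mx_sum (X g) <= expR (c ^+ 5 * N%:R).
  move=> N0 eN; rewrite /P => Pg; apply: (le_trans Pg).
  apply: (@le_trans _ _ ((c ^+ 5) ^+ N)).
    by rewrite -exprM ler_weXn2l //; move: N0 eN; clear; lia.
  rewrite expRM_natr lerXn2r ?nnegrE ?exprn_ge0 ?expR_ge0 //.
  by apply: le_trans (expR_ge1Dx _); rewrite lerDr.
exists (c ^+ 5); first by rewrite exprn_ge0.
move=> N m N0 mN; split.
  apply: (fin _ ((N - m).+1 + (1 + m.+1 + 1))%N) => //; first by move: N0 mN; clear; lia.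
  by rewrite /test_word -expVgn; apply: (PM); [exact: PX|apply: (PM) => //; apply: (PM) => //; exact: PX].
apply: (fin _ ((1 + (m.+1 + 1)) + (N - m).+1)%N) => //; first by move: N0 mN; clear; lia.
rewrite /test_word !invMg !invgK -expVgn; apply: (PM); last exact: PX.
by apply: (PM) => //; apply: (PM) => //; exact: PX.
Qed.

Lemma twist_roots n c (X : Gamma -> 'M[C]_n.+1) g q x : matrix_hom X ->
  mx_sum (X g) <= expR q -> mx_sum (X g^-1%g) <= expR q ->
  x \in mx_roots (twist c X g) ->
  expR (c * (phi g)%:~R - q) <= nm x <= expR (c * (phi g)%:~R + q).
Proof.
move=> homX le1 le2 xr; have [X1 XM] := homX.
have z0 : 0 <= expR (c * (phi g)%:~R) by exact: expR_ge0.
apply/andP; split; last first.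
  apply: le_trans (mx_roots_le xr) _.
  by rewrite /twist mx_sumZ normc_real // expRD ler_wpM2l.
have inv : twist c X g *m twist c X g^-1%g = 1%:M.
  have [T1 TM] := matrix_hom_twist c homX.
  by have := TM g g^-1%g; rewrite mulgV T1.
have := mx_roots_ge inv xr; rewrite /twist mx_sumZ normc_real ?expR_ge0 // (phiV phiM).
rewrite rmorphN mulrN expRN expRD expRN.
move: (expR_gt0 (c * (phi g)%:~R)) (expR_gt0 q) le2.
move: (expR _) (expR q) (mx_sum _) (nm x) (normc_ge0 x) => z e s y y0 zp ep se h.
rewrite ler_pdivrMr //; apply: le_trans (_ : y * s <= _); last by rewrite ler_wpM2l.
have := ler_wpM2l (ltW zp) h; rewrite mulr1 (_ : z * (y * (z^-1 * s)) = y * s) //.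
by field; rewrite gt_eqF.
Qed.

Variables (a b : nat) (A : Gamma -> 'M[C]_a.+1) (D : Gamma -> 'M[C]_b.+1).
Hypotheses (homA : matrix_hom A) (homD : matrix_hom D).

Definition twist_sub t := twist (t * b.+1%:R) A.
Definition twist_quot t := twist (- (t * a.+1%:R)) D.

Hypothesis phi_alpha : phi alpha != 0.
Hypothesis len_growth : forall K, exists N0, forall N m, (N0 <= N)%N -> (m <= N)%N ->
  (K <= len (w N m))%N.

Lemma phi_test_word N m : (m <= N)%N ->
  (phi (w N m))%:~R = (phi alpha)%:~R * (N%:R - 2 * m%:R) :> R.
Proof.
move=> mN; rewrite /test_word !phiM !(phiV phiM) !(phiX phiM).
have -> : phi alpha * (N - m)%:Z + (phi beta + - (phi alpha * m%:Z) + - phi beta) =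
  phi alpha * (N%:Z - 2%:Z * m%:Z) by rewrite -subzn //; ring.
by rewrite rmorphM rmorphB rmorphM /=.
Qed.

(** The parameter [t] has to be found before [k], since the position of the gap of a twisted
    representation may depend on [t]. *)
Theorem twisted_no_gap : exists t : R, forall k, (0 < k < a.+1 + b.+1)%N ->
  forall a0 b0 : R, 0 < a0 ->
  ~ (forall g, a0 * (len g)%:R - b0 <= log_gap (twist_sub t) (twist_quot t) k g).
Proof.
have [qA qA0 bA] := matrix_hom_bound homA.
have [qD qD0 bD] := matrix_hom_bound homD.
pose q := qA + qD; have q0 : 0 <= q by rewrite addr_ge0.
(* [f] is [t * phi alpha]; this value beats the growth [exp (q N)] of the untwisted blocks. *)
pose f := 2 * q + 1; have f0 : 0 < f by rewrite /f; lra.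
pose t := f / (phi alpha)%:~R.
have pa0 : (phi alpha)%:~R != 0 :> R by rewrite intr_eq0.
exists t => k kn a0 b0 a00.
have hA : matrix_hom (twist_sub t) := matrix_hom_twist _ homA.
have hD : matrix_hom (twist_quot t) := matrix_hom_twist _ homD.
pose n := (a.+1 + b.+1)%N.
pose nR : R := n%:R; pose kR : R := k%:R; pose aR : R := a.+1%:R; pose bR : R := b.+1%:R.
have nE : nR = aR + bR by rewrite /nR /n natrD.
have tw c N m : (m <= N)%N -> t * c * (phi (w N m))%:~R = f * (N%:R - 2 * m%:R) * c.
  by move=> mN; rewrite phi_test_word // /t; field.
have qAN N : expR (qA * N%:R) <= expR (q * N%:R) by rewrite ler_expR ler_wpM2r // /q lerDl.
have qDN N : expR (qD * N%:R) <= expR (q * N%:R) by rewrite ler_expR ler_wpM2r // /q lerDr.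
have rA N m x : (0 < N)%N -> (m <= N)%N -> x \in mx_roots (twist_sub t (w N m)) ->
    expR (f * (N%:R - 2 * m%:R) * bR - q * N%:R) <= nm x
      <= expR (f * (N%:R - 2 * m%:R) * bR + q * N%:R).
  move=> N0 mN xr; have [b1 b2] := bA N m N0 mN.
  by rewrite -tw //; apply: (twist_roots homA _ _ xr); [apply: le_trans b1 _|apply: le_trans b2 _].
have rD N m x : (0 < N)%N -> (m <= N)%N -> x \in mx_roots (twist_quot t (w N m)) ->
    expR (- (f * (N%:R - 2 * m%:R) * aR) - q * N%:R) <= nm x
      <= expR (- (f * (N%:R - 2 * m%:R) * aR) + q * N%:R).
  move=> N0 mN xr; have [b1 b2] := bD N m N0 mN.
  by rewrite -tw // -mulNr; apply: (twist_roots homD _ _ xr); [apply: le_trans b1 _|apply: le_trans b2 _].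
(* The exponent that the twist gives to a product of [i] eigenvalues of the first block and [k - i]
   of the second. It increases with [i] while [2 * m < N] and decreases when [N < 2 * m]. *)
pose Z N m i : R := f * (N%:R - 2 * m%:R) * (nR * i%:R - aR * kR).
have ZE N m i s : (i <= k)%N ->
    (f * (N%:R - 2 * m%:R) * bR + s) * i%:R + (- (f * (N%:R - 2 * m%:R) * aR) + s) * (k - i)%:R =
    Z N m i + s * kR.
  by move=> ik; rewrite natrB // /Z nE /kR; ring.
pose term g i := elemsym (mx_roots (twist_sub t g)) i * elemsym (mx_roots (twist_quot t g)) (k - i).
have upper N m i : (0 < N)%N -> (m <= N)%N -> (i <= k)%N ->
    nm (term (w N m) i) <= 2 ^+ n * expR (Z N m i + q * N%:R * kR).
  move=> N0 mN ik; rewrite -ZE // expRD !expRM_natr Normc.normcM /n exprD.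
  rewrite mulrACA; apply: ler_pM; rewrite ?normc_ge0 //.
    rewrite -[X in 2 ^+ X](size_mx_roots (twist_sub t (w N m))).
    apply: elemsym_le_roots; rewrite ?expR_gt0 // => x xr.
    by have /andP[] := rA N m x N0 mN xr.
  rewrite -[X in 2 ^+ X](size_mx_roots (twist_quot t (w N m))).
  apply: elemsym_le_roots; rewrite ?expR_gt0 // => x xr.
  by have /andP[] := rD N m x N0 mN xr.
have lower N m i T : (0 < N)%N -> (m <= N)%N -> (i <= k)%N -> (i <= a.+1)%N -> (k - i <= b.+1)%N -> 0 < T ->
    expR (Z N m i - q * N%:R * kR) <= T ^+ k * maxprod T (joint_spectrum (twist_sub t) (twist_quot t) (w N m)).
  move=> N0 mN ik ia ib T0; rewrite -mulNr -ZE // expRD !expRM_natr.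
  apply: maxprod_ge_roots; rewrite ?expR_ge0 ?size_mx_roots //.
    by move=> x xr; have /andP[] := rA N m x N0 mN xr.
  by move=> x xr; have /andP[] := rD N m x N0 mN xr.
(* The largest and the smallest number of eigenvalues that the first block can contribute; [i2 < j]
   holds because [0 < k < a.+1 + b.+1]. *)
pose j := minn k a.+1; pose i2 := (k - minn k b.+1)%N.
have [k0 klt] := andP kn.
have jk : (j <= k)%N by rewrite /j geq_minl.
have ja : (j <= a.+1)%N by rewrite /j geq_minr.
have kjb : (k - j <= b.+1)%N by rewrite /j; clear -klt; lia.
have i2j : (i2.+1 <= j)%N by rewrite /i2 /j; clear -klt k0; lia.
have i2k : (i2 <= k)%N by rewrite /i2; clear; lia.
have i2a : (i2 <= a.+1)%N by rewrite /i2; clear -klt; lia.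
have ki2b : (k - i2 <= b.+1)%N by rewrite /i2; clear; lia.
have nR1 : 1 <= nR by rewrite /nR /n ler1n.
have kRn : kR <= nR by rewrite /kR /nR ler_nat ltnW.
have aRn : aR <= nR by rewrite /aR /nR ler_nat /n leq_addr.
have jRk : j%:R <= kR :> R by rewrite /kR ler_nat.
have i2jR : i2%:R + 1 <= j%:R :> R by rewrite natr1 ler_nat.
have kR0 : 0 <= kR by rewrite ler0n.
have aR0 : 0 <= aR by rewrite ler0n.
have i20 : 0 <= i2%:R :> R by rewrite ler0n.
have nR0 : 0 <= nR by rewrite (le_trans _ nR1).
have jR0 : 0 <= j%:R :> R by rewrite ler0n.
have akn : aR * kR <= nR * nR by rewrite ler_pM.
have mfL (m L : nat) x : (m <= L)%N -> x <= nR + nR * nR ->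
    m%:R * f * x <= L%:R * f * (nR + nR * nR).
  move=> mL xn; apply: le_trans (_ : m%:R * f * (nR + nR * nR) <= _).
    by rewrite ler_wpM2l // mulr_ge0 ?ler0n // ltW.
  by rewrite ler_wpM2r ?addr_ge0 ?mulr_ge0 // ler_wpM2r ?(ltW f0) // ler_nat.
(* At an end of the run a change of [i] by one moves the exponent by [f * nR * N], while the upper
   and the lower bound each lose [q * N * k]. At least [N] remains, from which [c L] is subtracted
   for indices up to [L] steps away from the end. *)
have fn : 1 <= f * nR - 2 * (q * kR).
  rewrite /f; have : q * kR <= q * nR by rewrite ler_wpM2l.
  by lra.
pose c L := 2 * L%:R * f * (nR + nR * nR).
have key (B e : R) L : 0 < e -> 0 <= B -> exists N1, forall N, (N1 <= N)%N ->
    (2 * L < N)%N /\ forall d, N%:R - c L <= d -> B <= e * expR d.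
  move=> e0 B0; exists (2 * L + 1 + Num.bound (`|c L + B / e|%R))%N => N NN; split.
    by move: NN; clear; lia.
  move=> d dN; rewrite mulrC -ler_pdivrMr //; apply: le_trans (expR_ge1Dx d).
  have : c L + B / e <= N%:R.
    apply: le_trans (ler_norm _) _; apply: le_trans (ltW (archi_boundP (normr_ge0 _))) _.
    by rewrite ler_nat; apply: leq_trans NN; rewrite leq_addl.
  by lra.
apply: (@no_uniform_gap R Gamma len alpha beta len_growth a b _ _ hA hD k j kn jk) => // L e e0.
  have [N1 N1P] := key (k.+1%:R * 2 ^+ n) e L e0 (mulr_ge0 (ler0n _ _) (exprn_ge0 _ (ler0n _ _))).
  exists N1 => N m T NN mL mN T0.
  have [LN big] := N1P N NN; have N0 : (0 < N)%N by move: LN; clear; lia.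
  apply: le_trans (_ : e * expR (Z N 0 j - q * N%:R * kR) <= _); last by rewrite ler_wpM2l ?lower // ltW.
  have mLR : m%:R <= L%:R :> R by rewrite ler_nat.
  have m0 : 0 <= m%:R :> R by rewrite ler0n.
  have LNR : 2 * L%:R <= N%:R :> R by rewrite -natrM ler_nat ltnW.
  have s0 : 0 <= f * (N%:R - 2 * m%:R) by rewrite mulr_ge0 ?(ltW f0) //; lra.
  pose E := f * (N%:R - 2 * m%:R) * (nR * (j%:R - 1) - aR * kR) + q * N%:R * kR.
  have termE i : (i <= k)%N -> i != j -> nm (term (w N m) i) <= 2 ^+ n * expR E.
    move=> ik ij; have [ltij|ltji|eij] := ltngtP i j; last by rewrite eij eqxx in ij.
      apply: le_trans (upper N m i N0 mN ik) _; rewrite ler_wpM2l ?exprn_ge0 // ler_expR lerD2r.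
      rewrite /Z ler_wpM2l // lerD2r ler_wpM2l ?(le_trans _ nR1) //.
      by rewrite lerBrDr natr1 ler_nat.
    (* Here [j < i <= k], so [j] is the size [a.+1] of the first block, and that block has fewer
       than [i] roots. *)
    have ai : (a.+1 < i)%N by move: ltji ik; rewrite /j; clear; lia.
    rewrite /term elemsym_eq0 ?size_mx_roots // mul0r Normc.normc0.
    by rewrite mulr_ge0 ?exprn_ge0 ?expR_ge0.
  have restE : rest_term (twist_sub t) (twist_quot t) k j (w N m) =
      \sum_(i < k.+1 | i != inord j) term (w N m) i.
    rewrite /rest_term /joint_spectrum elemsym_cat (bigD1 (inord j)) //= inordK ?ltnS //.
    by rewrite /split_term addrC addrK.
  rewrite restE; apply: le_trans (le_normc_sum _ _ _) _.
  apply: le_trans (_ : \sum_(i < k.+1) 2 ^+ n * expR E <= _).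
    rewrite [leRHS](bigID (fun i : 'I_k.+1 => i != inord j)) /=.
    apply: le_trans (_ : \sum_(i < k.+1 | i != inord j) 2 ^+ n * expR E <= _).
      apply: ler_sum => i ij; apply: termE; first by rewrite -ltnS.
      by apply: contra ij => /eqP e'; apply/eqP/val_inj; rewrite /= e' inordK.
    by rewrite lerDl sumr_ge0 // => i _; rewrite mulr_ge0 ?exprn_ge0 ?expR_ge0.
  rewrite sumr_const card_ord -[X in X <= _]mulr_natl mulrA.
  suff hd : N%:R - c L <= Z N 0 j - q * N%:R * kR - E.
    by have := ler_wpM2r (expR_ge0 E) (big _ hd); rewrite -[e * _ * _]mulrA -expRD subrK.
  rewrite /Z /E /c.
  have h1 : m%:R * f * (nR + aR * kR - nR * j%:R) <= L%:R * f * (nR + nR * nR).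
    by apply: mfL => //; have := mulr_ge0 nR0 jR0; lra.
  have h2 : N%:R * 1 <= N%:R * (f * nR - 2 * (q * kR)) by rewrite ler_wpM2l.
  by lra.
have [N1 N1P] := key (2 ^+ n) e L e0 (exprn_ge0 _ (ler0n _ _)).
exists N1 => N m T NN mL mN T0.
have [LN big] := N1P N NN; have N0 : (0 < N)%N by move: LN; clear; lia.
apply: le_trans (_ : e * expR (Z N N i2 - q * N%:R * kR) <= _); last by rewrite ler_wpM2l ?lower // ltW.
have mLR : m%:R <= L%:R :> R by rewrite ler_nat.
have m0 : 0 <= m%:R :> R by rewrite ler0n.
apply: le_trans (upper N (N - m)%N j N0 (leq_subr _ _) jk) _.
set E := Z N (N - m)%N j + q * N%:R * kR.
suff hd : N%:R - c L <= Z N N i2 - q * N%:R * kR - E.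
  by have := ler_wpM2r (expR_ge0 E) (big _ hd); rewrite -[e * _ * _]mulrA -expRD subrK.
rewrite /E; rewrite /Z /c (natrB _ mN).
have h1 : m%:R * f * (nR * j%:R - aR * kR) <= L%:R * f * (nR + nR * nR).
  apply: mfL => //; have := mulr_ge0 aR0 kR0.
  have : nR * j%:R <= nR * nR by rewrite ler_wpM2l // (le_trans jRk).
  by lra.
have h2 : N%:R * 1 <= N%:R * (f * nR - 2 * (q * kR)) by rewrite ler_wpM2l.
have h3 : N%:R * f * nR * (i2%:R + 1) <= N%:R * f * nR * j%:R.
  by rewrite ler_wpM2l // !mulr_ge0 ?(ltW f0) ?(le_trans _ nR1).
by lra.
Qed.

End Twist.

(** * Deformations of reducible representations *)

Section BlockReduction.
Variable K : fieldType.

(** The base change is rectangular because the dimension of the space and the sum of the block sizes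
    are equal, but not the same expression. *)
Lemma rect_det n m (Q : 'M[K]_(n, m)) (Q' : 'M[K]_(m, n)) (X : 'M[K]_m) :
  Q *m Q' = 1%:M -> Q' *m Q = 1%:M -> \det (Q *m X *m Q') = \det X.
Proof.
move=> QQ' Q'Q; have nm : n = m.
  by apply/eqP; rewrite eqn_leq (mulmx1_min QQ') (mulmx1_min Q'Q).
case: _ / nm in X Q Q' QQ' Q'Q *.
by rewrite !det_mulmx mulrAC -det_mulmx QQ' det1 mul1r.
Qed.

Lemma rect_char_poly n m (Q : 'M[K]_(n, m)) (Q' : 'M[K]_(m, n)) (X : 'M[K]_m) :
  Q *m Q' = 1%:M -> Q' *m Q = 1%:M -> char_poly (Q *m X *m Q') = char_poly X.
Proof.
move=> QQ' Q'Q; have nm : n = m.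
  by apply/eqP; rewrite eqn_leq (mulmx1_min QQ') (mulmx1_min Q'Q).
case: _ / nm in X Q Q' QQ' Q'Q *.
rewrite /char_poly /char_poly_mx.
have -> : 'X%:M - map_mx polyC (Q *m X *m Q') =
  map_mx polyC Q *m ('X%:M - map_mx polyC X) *m map_mx polyC Q'.
  rewrite mulmxBr mulmxBl !map_mxM /= mul_mx_scalar -scalemxAl; congr (_ - _).
  by rewrite -map_mxM QQ' map_mx1 scalemx1.
by rewrite !det_mulmx mulrAC -det_mulmx -map_mxM QQ' map_mx1 det1 mul1r.
Qed.

Lemma char_poly_lblock r s (A : 'M[K]_r) (B : 'M[K]_(s, r)) (D : 'M[K]_s) :
  char_poly (block_mx A 0 B D) = char_poly A * char_poly D.
Proof.
rewrite /char_poly /char_poly_mx map_block_mx /= map_mx0 scalar_mx_block opp_block_mx add_block_mx.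
by rewrite oppr0 addr0 det_lblock.
Qed.

Lemma char_poly_scale_tr r c (A : 'M[K]_r) : char_poly (c *: A^T) = char_poly (c *: A).
Proof.
rewrite /char_poly -[RHS]det_tr; congr (\det _); apply/matrixP => i j.
by rewrite !mxE eq_sym.
Qed.

Lemma row_space_basis m n (w : 'M[K]_(m, n)) k : \rank w = k ->
  exists2 U : 'M[K]_(k, n), (U :=: w)%MS & row_free U.
Proof.
by move=> <-; exists (row_base w); [exact: eq_row_base|exact: row_base_free].
Qed.

(** The rows of [Q'] are a basis of the row space of [w] followed by one of a complement. Matrices
    act on row vectors, so invariance empties the upper right block; both block sizes are successors
    because [w] has neither rank zero nor full rank. *)
Lemma block_reduction (T : Type) n (M : T -> 'M[K]_n) (w : 'M[K]_n) :
  w != 0 -> (\rank w < n)%N -> (forall g, (w *m M g <= w)%MS) ->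
  exists r s (Q : 'M[K]_(n, r.+1 + s.+1)) (Q' : 'M[K]_(r.+1 + s.+1, n)),
    [/\ Q *m Q' = 1%:M, Q' *m Q = 1%:M & forall g, ursubmx (Q' *m M g *m Q) = 0].
Proof.
move=> w0 wn stable.
have r0 : (0 < \rank w)%N by rewrite lt0n mxrank_eq0.
have [U Uw freeU] := @row_space_basis _ _ w (\rank w).-1.+1 (esym (prednK r0)).
have s0 : (0 < \rank w^C)%N by rewrite mxrank_compl subn_gt0.
have [U2 U2w freeU2] := @row_space_basis _ _ w^C%MS (\rank w^C).-1.+1 (esym (prednK s0)).
set r := (\rank w).-1 in U Uw freeU *; set s := (\rank w^C).-1 in U2 U2w freeU2 *.
have rs : (r.+1 + s.+1 = n)%N by rewrite /r /s !prednK // mxrank_compl subnKC // ltnW.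
pose Q' := col_mx U U2.
have fullQ' : row_full Q'.
  by rewrite -sub1mx -addsmxE (adds_eqmx Uw U2w) sub1mx addsmx_compl_full.
have freeQ' : row_free Q' by rewrite /row_free (eqP fullQ') rs.
exists r, s, (pinvmx Q'), Q'.
have Q'Q : Q' *m pinvmx Q' = 1%:M by rewrite mulmxVp.
split=> //; first by rewrite mulVpmx.
move=> g; have UQ : U *m pinvmx Q' = row_mx 1%:M 0.
  rewrite -[U in LHS](col_mxKu U U2) -/Q' mul_usub_mx Q'Q.
  by rewrite (scalar_mx_block r.+1 s.+1) block_mxEv col_mxKu.
have /submxP[A UA] : (U *m M g <= U)%MS by rewrite (eqmxMr _ Uw) (submx_trans (stable g)) // Uw.
rewrite -mulmxA /Q' mul_col_mx /ursubmx col_mxKu mulmxA UA -mulmxA UQ.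
by rewrite mul_mx_row mulmx0 row_mxKr.
Qed.

End BlockReduction.

(** * Continuity of matrix entries and characteristic polynomials *)

Section ContinuousFunctions.
Variables (K : numFieldType) (X : topologicalType).

Lemma continuous_to_mx m n (f : X -> 'M[K]_(m, n)) :
  (forall i j, continuous (fun x => f x i j)) -> continuous f.
Proof.
move=> fc x A [P Px PA]; have : \forall y \near x, forall i j, P i j (f y i j).
  by apply: filter_forall => i; apply: filter_forall => j; apply: fc; exact: Px.
by apply: filterS => y Py; apply: PA => i j; exact: Py.
Qed.

Lemma continuous_to_ptws (I : choiceType) (Y : topologicalType) (f : X -> {ptws I -> Y}) :
  (forall i, continuous (fun x => f x i)) -> continuous f.
Proof.
move=> fc x; apply/cvg_sup => i.
have := @continuous_comp_initial _ X Y (fun h : I -> Y => h i) f.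
by move=> /(_ (fc i)) /(_ x).
Qed.

Lemma continuous_sum_fun (J : Type) (r : seq J) (P : pred J) (f : J -> X -> K) :
  (forall j, continuous (f j)) -> continuous (fun x => \sum_(j <- r | P j) f j x).
Proof.
move=> fc; elim: r => [|j r IHr].
  rewrite (_ : (fun _ => _) = fun=> 0); last by apply/funext => x; rewrite big_nil.
  by move=> x; exact: cvg_cst.
case Pj: (P j).
  rewrite (_ : (fun _ => _) = fun x => f j x + \sum_(j <- r | P j) f j x).
    by move=> x; apply: cvgD; [exact: fc|exact: IHr].
  by apply/funext => x; rewrite big_cons Pj.
rewrite (_ : (fun _ => _) = fun x => \sum_(j <- r | P j) f j x); first exact: IHr.
by apply/funext => x; rewrite big_cons Pj.
Qed.

Definition continuous_poly (p : X -> {poly K}) := forall k, continuous (fun x => (p x)`_k).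

Lemma continuous_polyM p q : continuous_poly p -> continuous_poly q ->
  continuous_poly (fun x => p x * q x).
Proof.
move=> pc qc k.
rewrite (_ : (fun _ => _) = fun x => \sum_(j < k.+1) (p x)`_j * (q x)`_(k - j)).
  by apply: continuous_sum_fun => j x; apply: cvgM; [exact: pc|exact: qc].
by apply/funext => x; rewrite coefM.
Qed.

Lemma continuous_char_poly n (M : X -> 'M[K]_n) :
  (forall i j, continuous (fun x => M x i j)) -> continuous_poly (fun x => char_poly (M x)).
Proof.
move=> Mc.
have cst (c : {poly K}) : continuous_poly (fun=> c) by move=> k x; exact: cvg_cst.
have entry i j : continuous_poly (fun x => char_poly_mx (M x) i j).
  move=> k; have [->|k0] := eqVneq k 0%N.
    rewrite (_ : (fun _ => _) = fun x => ('X *+ (i == j) : {poly K})`_0 - M x i j).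
      by move=> x; apply: cvgB; [exact: cvg_cst|exact: Mc].
    by apply/funext => x; rewrite !mxE coefB coefC.
  rewrite (_ : (fun _ => _) = fun x => ('X *+ (i == j) : {poly K})`_k).
    by move=> x; exact: cvg_cst.
  by apply/funext => x; rewrite !mxE coefB coefC (negbTE k0) subr0.
have prods (r : seq 'I_n) (s : 'S_n) :
    continuous_poly (fun x => \prod_(i <- r) char_poly_mx (M x) i (s i)).
  elim: r => [|i r IHr].
    by rewrite (_ : (fun _ => _) = fun=> 1) //; apply/funext => x; rewrite big_nil.
  rewrite (_ : (fun _ => _) = fun x => char_poly_mx (M x) i (s i) *
    \prod_(i <- r) char_poly_mx (M x) i (s i)); first exact: continuous_polyM.
  by apply/funext => x; rewrite big_cons.
move=> k; rewrite (_ : (fun _ => _) = fun x => \sum_(s : 'S_n)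
    ((-1) ^+ s * \prod_i char_poly_mx (M x) i (s i))`_k).
  by apply: continuous_sum_fun => s; apply: (continuous_polyM (cst _) (prods _ s)).
by apply/funext => x; rewrite /char_poly /determinant coef_sum.
Qed.

Lemma closure_constant (f : X -> K) (c : K) (S : set X) : continuous f ->
  (forall x, S x -> f x = c) -> forall x, closure S x -> f x = c.
Proof.
move=> fc Sc.
have cl : closed (f @^-1` [set c]).
  apply: preimage_closed => [x _|]; first exact: fc.
  by apply: accessible_closed_set1; apply: hausdorff_accessible; exact: norm_hausdorff.
have : closure S `<=` f @^-1` [set c] by rewrite closureE; apply: smallest_sub.
by move=> sub x /sub.
Qed.

End ContinuousFunctions.

Section Endomorphisms.
Variables (K : numFieldType) (V : vectType K).
Local Notation n := (\dim {:V}).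

Let bV := vbasisP {:V}.

Definition endo_of_mx (M : 'M[K]_n) : 'End(V) :=
  passmx.hommx (vbasis {:V}) (vbasis {:V}) M.

Lemma endo_of_mxK M : endo_mx (endo_of_mx M) = M.
Proof. exact: passmx.hommxK. Qed.

Lemma endo_mxK A : endo_of_mx (endo_mx A) = A.
Proof. exact: passmx.mxofK. Qed.

Lemma endo_mx_inj : injective (@endo_mx K V).
Proof. exact: can_inj endo_mxK. Qed.

Lemma endo_mx_comp (f g : 'End(V)) : endo_mx (f \o g)%VF = endo_mx g *m endo_mx f.
Proof. exact: passmx.mxof_comp. Qed.

Lemma endo_mx1 : endo_mx (\1%VF : 'End(V)) = 1%:M.
Proof. by apply: passmx.mxof1; exact: basis_free bV. Qed.

Lemma lker0_det (A : 'End(V)) : (lker A == 0%VS) = (\det (endo_mx A) != 0).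
Proof.
rewrite (passmx.lker_ker bV) passmx.vsof_eq0 // kermx_eq0 row_free_unit unitmxE.
by rewrite unitfE.
Qed.

Lemma in_group_det G (A B : 'End(V)) :
  \det (endo_mx A) = \det (endo_mx B) -> Defs.in_group G A -> Defs.in_group G B.
Proof.
move=> dAB [/eqP lA GA]; split; last by rewrite -dAB.
by apply/eqP; move: lA; rewrite !lker0_det dAB.
Qed.

End Endomorphisms.

(** * Spaces of representations and their quotients *)

Section CharacterVariety.
Variables (K : numFieldType) (V : vectType K) (Gamma : groupType) (G H : linear_group).
Local Notation n := (\dim {:V}).
Implicit Types rho sigma : hom_space V Gamma G.

Lemma repP rho : is_representation G (rep rho).
Proof. exact: set_mem (valP rho). Qed.

Lemma exists_rep (M : Gamma -> 'M[K]_n) : M 1%g = 1%:M ->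
  (forall g h : Gamma, M (g * h)%g = M h *m M g) ->
  (forall g, Defs.in_group G (endo_of_mx (M g))) ->
  exists rho, forall g, endo_mx (rep rho g) = M g.
Proof.
move=> M1 MM MG.
have repM : is_representation G (fun g => endo_of_mx (M g)).
  split=> // [|g h]; apply: endo_mx_inj; first by rewrite endo_of_mxK M1 endo_mx1.
  by rewrite endo_mx_comp !endo_of_mxK MM.
exists (exist _ (fun g => endo_of_mx (M g)) (mem_set repM) : @hom_set K V Gamma G) => g.
by rewrite /rep /= endo_of_mxK.
Qed.

Lemma continuous_to_hom_space (X : topologicalType) (f : X -> hom_space V Gamma G) :
  (forall g i j, continuous (fun x => endo_mx (rep (f x) g) i j)) -> continuous f.
Proof.
move=> fc; apply: continuous_comp_initial; apply: continuous_to_ptws => g.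
by apply: continuous_to_mx => i j; exact: fc.
Qed.

Lemma continuous_rep_coef g i j : continuous (fun rho => endo_mx (rep rho g) i j).
Proof.
move=> rho.
have c1 : continuous (@hom_matrices K V Gamma G : hom_space V Gamma G -> _).
  exact: initial_continuous.
have c2 := @proj_continuous Gamma (fun=> 'M[K]_n) g (hom_matrices rho).
have c3 := @coord_continuous K n n i j (hom_matrices rho g).
exact: (continuous_comp (continuous_comp (c1 rho) c2) c3).
Qed.

Lemma conj_orbit_char_poly rho sigma g : conj_orbit H rho sigma ->
  char_poly (endo_mx (rep sigma g)) = char_poly (endo_mx (rep rho g)).
Proof.
move=> [h [/eqP h0 _] /(_ g) ->]; rewrite !endo_mx_comp.
have hV : endo_mx h^-1%VF *m endo_mx h = 1%:M.
  by rewrite -endo_mx_comp lker0_compfV // endo_mx1.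
by rewrite mulmxA; apply: rect_char_poly => //; exact: mulmx1C.
Qed.

(** Each coefficient is a continuous function of the representation, constant on the orbit, and
    points of the field are closed. *)
Lemma closure_orbit_char_poly rho sigma g : closure (conj_orbit H rho) sigma ->
  char_poly (endo_mx (rep sigma g)) = char_poly (endo_mx (rep rho g)).
Proof.
move=> cl; apply/polyP => k.
have cc := continuous_char_poly (@continuous_rep_coef g) (k := k).
apply: (closure_constant cc (c := (char_poly (endo_mx (rep rho g)))`_k) (S := conj_orbit H rho)) => //.
by move=> tau /(conj_orbit_char_poly g) ->.
Qed.

Lemma h_equivalent_char_poly rho sigma g : h_equivalent H rho sigma ->
  char_poly (endo_mx (rep rho g)) = char_poly (endo_mx (rep sigma g)).
Proof.
by move=> [tau [/(closure_orbit_char_poly g) <- /(closure_orbit_char_poly g) <-]].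
Qed.

Lemma h_equivalent_refl rho : h_equivalent H rho rho.
Proof.
have k1 : lker (\1%VF : 'End(V)) == 0%VS by rewrite lker0_det endo_mx1 det1 oner_eq0.
have i1 : (\1^-1)%VF = \1%VF :> 'End(V) by rewrite -[LHS]comp_lfun1l lker0_compfV.
have orb : conj_orbit H rho rho.
  exists \1%VF => [|g]; last by rewrite i1 comp_lfun1l comp_lfun1r.
  split; first exact/eqP.
  by case: H; rewrite ?endo_mx1 ?det1 ?normr1.
by exists rho; split; exact: subset_closure.
Qed.

(** By reflexivity [sigma] belongs to its own class, which is that of [rho]. *)
Lemma char_class_equivalent rho sigma :
  char_class H rho = char_class H sigma -> h_equivalent H rho sigma.
Proof.
rewrite /char_class !unlock => e.
have {}e : h_class H rho = h_class H sigma.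
  exact: (congr1 (fun c : h_classes V Gamma G H => sval c) e).
have : h_class H sigma sigma := h_equivalent_refl sigma.
by rewrite -e.
Qed.

Lemma continuous_char_class : continuous (@char_class K V Gamma G H).
Proof. exact: pi_continuous. Qed.

Lemma connected_component_path (R : realType) (f : R -> hom_space V Gamma G)
  (x : character_variety V Gamma G H) (s t : R) : continuous f ->
  connected_component setT x (char_class H (f s)) -> connected_component setT x (char_class H (f t)).
Proof.
move=> fc xs; apply: (connected_component_trans xs).
pose c u := char_class H (f u).
have cc : continuous c.
  by move=> u; apply: (continuous_comp (fc u)); exact: continuous_char_class.
have conn : connected (c @` [set: R]).
  apply: connected_continuous_connected; last by apply: continuous_subspaceT.
  by apply/connected_intervalP => u v _ _ w _.
by apply: (connected_component_max _ _ conn).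
Qed.

End CharacterVariety.

Section Scalars.
Variables (R : realType) (F : field_kind).

Definition real_scalar : {rmorphism R -> scalars R F} :=
  match F return {rmorphism R -> scalars R F} with
  | RealNumbers => idfun
  | ComplexNumbers => real_complex R
  end.

Definition complex_scalar : {rmorphism scalars R F -> R[i]} :=
  match F return {rmorphism scalars R F -> R[i]} with
  | RealNumbers => real_complex R
  | ComplexNumbers => idfun
  end.

Lemma complex_scalarE : complex_scalar =1 @to_complex R F.
Proof. by rewrite /complex_scalar /to_complex; case: F. Qed.

Lemma complex_real_scalar x : complex_scalar (real_scalar x) = x%:C.
Proof. by rewrite /complex_scalar /real_scalar; case: F. Qed.

Lemma continuous_real_scalar : continuous real_scalar.
Proof.
rewrite /real_scalar; case: F => /= x; first exact: cvg_id.
apply/cvgrPdist_lt => e e0.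
(* A positive element for the order of [R[i]] is real, so distances can be compared in [R]. *)
have [Ie e0'] : complex.Im e = 0 /\ 0 < complex.Re e.
  by move: e0; rewrite ltcE => /andP[/eqP h1 h2]; exact (conj h1 h2).
have eE : e = (complex.Re e)%:C by move: Ie; case: e {e0 e0'} => a b /= ->.
have := @cvg_id _ (nbhs x); move=> /cvgrPdist_lt/(_ _ e0'); apply: filterS => y /= yx.
by rewrite eE -rmorphB normc_def /= expr0n /= addr0 sqrtr_sqr ltcR.
Qed.

End Scalars.

(** * Deformations of a block triangular representation *)

Section Deformation.
Variables (K : fieldType) (Gamma : groupType) (n r s : nat) (M : Gamma -> 'M[K]_n).
Variables (Q : 'M[K]_(n, r.+1 + s.+1)) (Q' : 'M[K]_(r.+1 + s.+1, n)).
Hypotheses (QQ' : Q *m Q' = 1%:M) (Q'Q : Q' *m Q = 1%:M).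
Hypothesis M1 : M 1%g = 1%:M.
Hypothesis MM : forall g h : Gamma, M (g * h)%g = M h *m M g.
Hypothesis ur0 : forall g, ursubmx (Q' *m M g *m Q) = 0.

Definition sub_block g := ulsubmx (Q' *m M g *m Q).
Definition ext_block g := dlsubmx (Q' *m M g *m Q).
Definition quot_block g := drsubmx (Q' *m M g *m Q).

Lemma block_decomposition g :
  Q' *m M g *m Q = block_mx (sub_block g) 0 (ext_block g) (quot_block g).
Proof. by rewrite -[LHS]submxK ur0. Qed.

Lemma block_decompositionM g h :
  block_mx (sub_block (g * h)%g) 0 (ext_block (g * h)%g) (quot_block (g * h)%g) =
  block_mx (sub_block h *m sub_block g) 0
    (ext_block h *m sub_block g + quot_block h *m ext_block g) (quot_block h *m quot_block g).
Proof.
rewrite -block_decomposition MM.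
have -> : Q' *m (M h *m M g) *m Q = (Q' *m M h *m Q) *m (Q' *m M g *m Q).
  by rewrite !mulmxA -[Q' *m M h *m Q *m Q']mulmxA QQ' mulmx1.
by rewrite !block_decomposition mulmx_block !mulmx0 !mul0mx !addr0 !add0r.
Qed.

Lemma sub_blockM g h : sub_block (g * h)%g = sub_block h *m sub_block g.
Proof. by have /eq_block_mx[] := block_decompositionM g h. Qed.

Lemma quot_blockM g h : quot_block (g * h)%g = quot_block h *m quot_block g.
Proof. by have /eq_block_mx[] := block_decompositionM g h. Qed.

Lemma ext_blockM g h :
  ext_block (g * h)%g = ext_block h *m sub_block g + quot_block h *m ext_block g.
Proof. by have /eq_block_mx[] := block_decompositionM g h. Qed.

Lemma blocks1 : [/\ sub_block 1%g = 1%:M, ext_block 1%g = 0 & quot_block 1%g = 1%:M].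
Proof.
have := block_decomposition 1%g; rewrite M1 mulmx1 Q'Q scalar_mx_block.
by move=> /eq_block_mx[].
Qed.

(** One formula for both paths: with [u = v = 1] the parameter [e] scales the off-diagonal block,
    and with [e = 0] the characters [u] and [v] twist the diagonal blocks. In these two cases it is
    multiplicative, see [deformM]. *)
Definition deform (u v : Gamma -> K) (e : K) g : 'M[K]_n :=
  Q *m block_mx (u g *: sub_block g) 0 (e *: ext_block g) (v g *: quot_block g) *m Q'.

Lemma deform_id g : deform (fun=> 1) (fun=> 1) 1 g = M g.
Proof.
rewrite /deform !scale1r -block_decomposition !mulmxA QQ' mul1mx.
by rewrite -mulmxA QQ' mulmx1.
Qed.

Lemma deform1 u v e : u 1%g = 1 -> v 1%g = 1 -> deform u v e 1%g = 1%:M.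
Proof.
move=> u1 v1; rewrite /deform u1 v1; have [-> -> ->] := blocks1.
by rewrite !scale1r scaler0 -scalar_mx_block mulmx1 QQ'.
Qed.

Lemma deformM u v e g h : (forall g h : Gamma, u (g * h)%g = u g * u h) ->
  (forall g h : Gamma, v (g * h)%g = v g * v h) ->
  e = 0 \/ (u =1 (fun=> 1) /\ v =1 (fun=> 1)) ->
  deform u v e (g * h)%g = deform u v e h *m deform u v e g.
Proof.
move=> uM vM euv; rewrite /deform.
have gen (X Y : 'M[K]_(r.+1 + s.+1)) : Q *m X *m Q' *m (Q *m Y *m Q') = Q *m (X *m Y) *m Q'.
  by rewrite !mulmxA -[Q *m X *m Q' *m Q]mulmxA Q'Q mulmx1.
rewrite gen; congr (Q *m _ *m Q').
rewrite mulmx_block !mulmx0 !mul0mx !addr0 !add0r sub_blockM quot_blockM ext_blockM uM vM.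
rewrite -!scalemxAl -!scalemxAr !scalerA ![u h * _]mulrC ![v h * _]mulrC; congr block_mx.
case: euv => [->|[u1 v1]]; first by rewrite ?mul0r ?mulr0 !scale0r addr0.
by rewrite u1 v1 ?mulr1 ?mul1r scalerDr.
Qed.

Lemma det_deform u v e g : u g ^+ r.+1 * v g ^+ s.+1 = 1 ->
  \det (deform u v e g) = \det (M g).
Proof.
move=> uv; rewrite /deform rect_det // det_lblock !detZ mulrACA uv mul1r.
by rewrite -(rect_det (M g) Q'Q QQ') block_decomposition det_lblock.
Qed.

Lemma char_poly_deform u v e g :
  char_poly (deform u v e g) = char_poly (u g *: sub_block g) * char_poly (v g *: quot_block g).
Proof. by rewrite /deform rect_char_poly // char_poly_lblock. Qed.

End Deformation.

(** * Anosov representations with invariant subspaces *)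

Section Main.
Variables (Gamma : groupType) (Sigma : seq Gamma) (R : realType) (F : field_kind).
Variables (V : vectType (scalars R F)) (G H : linear_group).
Local Notation K := (scalars R F).
Local Notation n := (\dim {:V}).
Implicit Types rho sigma : hom_space V Gamma G.

Lemma anosov_char_poly (rho sigma : Gamma -> 'End(V)) :
  (forall g, char_poly (endo_mx (rho g)) = char_poly (endo_mx (sigma g))) ->
  anosov Sigma rho -> anosov Sigma sigma.
Proof.
move=> e [theta [th ne P]]; exists theta; split; [exact: th|exact: ne|move=> k kth].
have [a [b [a0 b0 gap]]] := P k kth; exists a, b; split; [exact: a0|exact: b0|move=> g].
have e' : complex_eigenvalues (rho g) = complex_eigenvalues (sigma g).
  by rewrite /complex_eigenvalues /complex_char_poly e.
by have := gap g; rewrite /eigen_modulus e'.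
Qed.

Lemma reducible_stable_mx (rho : Gamma -> 'End(V)) : reducible rho ->
  exists w : 'M[K]_n, [/\ w != 0, (\rank w < n)%N & forall g, (w *m endo_mx (rho g) <= w)%MS].
Proof.
move=> [W [W0 Wf Wst]]; have bV := vbasisP {:V}.
exists (passmx.msof (vbasis {:V}) W); split.
- by rewrite passmx.msof_eq0.
- rewrite ltn_neqAle rank_leq_row andbT; apply: contra Wf => full.
  rewrite eqEsubv subvf /= -(passmx.sub_msof bV); apply: submx_full.
  by rewrite /row_full.
move=> g; apply/row_subP => i; rewrite row_mul.
have : (row i (passmx.msof (vbasis {:V}) W) <= passmx.msof (vbasis {:V}) W)%MS by exact: row_sub.
rewrite -!(passmx.mem_vecof bV) => iW.
rewrite /endo_mx -(passmx.hom_vecof _ bV).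
by apply: (subvP (Wst g)); apply: memv_img.
Qed.

Lemma deformed_rep r s (M : Gamma -> 'M[K]_n) (Q : 'M[K]_(n, r.+1 + s.+1)) (Q' : 'M[K]_(r.+1 + s.+1, n))
    (rho : hom_space V Gamma G) u v e :
  (forall g, M g = endo_mx (rep rho g)) ->
  Q *m Q' = 1%:M -> Q' *m Q = 1%:M -> (forall g, ursubmx (Q' *m M g *m Q) = 0) ->
  (forall g h : Gamma, u (g * h)%g = u g * u h) -> (forall g h : Gamma, v (g * h)%g = v g * v h) ->
  (forall g, u g ^+ r.+1 * v g ^+ s.+1 = 1) -> u 1%g = 1 -> v 1%g = 1 ->
  e = 0 \/ (u =1 (fun=> 1) /\ v =1 (fun=> 1)) ->
  exists sigma : hom_space V Gamma G, forall g, endo_mx (rep sigma g) = deform M Q Q' u v e g.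
Proof.
move=> ME QQ' Q'Q ur0 uM vM uv u1 v1 euv; have [rhoG rho1 rhoM] := repP rho.
have M1 : M 1%g = 1%:M by rewrite ME rho1 endo_mx1.
have MM g h : M (g * h)%g = M h *m M g by rewrite !ME rhoM endo_mx_comp.
apply: exists_rep => [|g h|g]; first exact: deform1.
  exact: deformM.
apply: in_group_det (rhoG g); rewrite endo_of_mxK det_deform //.
by rewrite ME.
Qed.

End Main.

Section Main.
Variables (Gamma : groupType) (Sigma : seq Gamma) (R : realType) (F : field_kind).
Variables (V : vectType (scalars R F)) (G H : linear_group).
Local Notation K := (scalars R F).
Local Notation n := (\dim {:V}).

(** The eigenvalues of [rho g] and the joint spectrum of the blocks are root lists of one monic
    polynomial, hence permutations of each other; sorting the moduli removes the dependence on the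
    listing. *)
Lemma anosov_log_gap a b (X : Gamma -> 'M[R[i]]_a.+1) (Y : Gamma -> 'M[R[i]]_b.+1)
    (rho : Gamma -> 'End(V)) : n = (a.+1 + b.+1)%N ->
  (forall g, map_poly (complex_scalar R F) (char_poly (endo_mx (rho g))) = char_poly (X g) * char_poly (Y g)) ->
  anosov Sigma rho ->
  exists k a0 b0, [/\ (0 < k < a.+1 + b.+1)%N, 0 < a0 &
    forall g, a0 * (conj_length Sigma g)%:R - b0 <= log_gap X Y k g].
Proof.
move=> nE charE [theta [th [k kth] P]].
have [a0 [b0 [a00 _ gap]]] := P k kth.
exists k, a0, b0; split; [by have := th k kth; rewrite /simple_roots /= nE|exact: a00|move=> g].
have perm : perm_eq (complex_eigenvalues (rho g)) (joint_spectrum X Y g).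
  apply: prod_XsubC_eq; rewrite big_cat /= -!mx_rootsP -charE.
  rewrite /complex_eigenvalues; case: closed_field_poly_normal => l /= lE.
  have -> : map_poly (complex_scalar R F) (char_poly (endo_mx (rho g))) = complex_char_poly (rho g).
    by apply: eq_map_poly; exact: complex_scalarE.
  rewrite [RHS]lE; have -> : lead_coef (complex_char_poly (rho g)) = 1; last by rewrite scale1r.
  have -> : complex_char_poly (rho g) = map_poly (complex_scalar R F) (char_poly (endo_mx (rho g))).
    by apply: eq_map_poly => x; rewrite complex_scalarE.
  by rewrite lead_coef_map (monicP (char_poly_monic _)) rmorph1.
have sortE : sort >=%O [seq Normc.normc z | z <- complex_eigenvalues (rho g)] =
    sort >=%O [seq Normc.normc z | z <- joint_spectrum X Y g].
  apply/perm_sortP; last exact: perm_map.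
  - by move=> x y; exact: le_total.
  - by move=> y x z /= h1 h2; exact: le_trans h2 h1.
  - by move=> x y /andP[h1 h2]; apply: le_anti; apply/andP; split; [exact: h2|exact: h1].
by have := gap g; rewrite /eigen_modulus sortE.
Qed.

End Main.

Theorem corollary4 (Gamma : groupType) (Sigma : seq Gamma)
    (R : realType) (F : field_kind) (V : vectType (scalars R F))
    (G H : linear_group) :
  word_hyperbolic Gamma ->
  ~ virtually_cyclic Gamma ->
  finite_generating_set Sigma ->
  ~ finite_index (commutator_subgroup Gamma) ->
  forall x : character_variety V Gamma G H,
    let C := connected_component [set: character_variety V Gamma G H] x in
    (forall c : character_variety V Gamma G H, C c ->
       exists rho : hom_space V Gamma G,
         c = char_class H rho /\ anosov Sigma (rep rho)) ->
    ~ exists c : character_variety V Gamma G H, C c /\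
       exists rho : hom_space V Gamma G,
         c = char_class H rho /\ reducible (rep rho).
Proof.
move=> hypG nvc genS infN x C allA [c [Cc [rho [cE redrho]]]].
have [phi phiM [g0 phig0]] := exists_hom_int genS infN.
have [alpha [beta [phia growth]]] := exists_growing_conj_length hypG nvc genS phiM phig0.
have [w [w0 wn wst]] := reducible_stable_mx redrho.
pose M g := endo_mx (rep rho g).
have [r [s [Q [Q' [QQ' Q'Q ur0]]]]] := block_reduction w0 wn wst.
have [rhoG rho1 rhoM] := repP rho.
have M1 : M 1%g = 1%:M by rewrite /M rho1 endo_mx1.
have MM g h : M (g * h)%g = M h *m M g by rewrite /M rhoM endo_mx_comp.
have nE : \dim {:V} = (r.+1 + s.+1)%N.
  by apply/eqP; rewrite eqn_leq (mulmx1_min QQ') (mulmx1_min Q'Q).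
have rep_inj (tau sigma : hom_space V Gamma G) :
    (forall g, endo_mx (rep tau g) = endo_mx (rep sigma g)) -> tau = sigma.
  by move=> e; apply: val_inj; apply/funext => g; apply: endo_mx_inj; exact: e.
pose D := deform M Q Q'.
(* For fixed [g] the deformed matrix is a combination of three constant matrices with the
   coefficients [u], [e] and [v]. *)
have entry_cont (X : topologicalType) (u v e : X -> scalars R F) g i j :
    continuous u -> continuous v -> continuous e ->
    continuous (fun y => D (fun=> u y) (fun=> v y) (e y) g i j).
  move=> uc vc ec; pose N1 := Q *m block_mx (sub_block M Q Q' g) 0 0 0 *m Q'.
  pose N2 := Q *m block_mx 0 0 (ext_block M Q Q' g) 0 *m Q'.
  pose N3 := Q *m block_mx 0 0 0 (quot_block M Q Q' g) *m Q'.
  rewrite (_ : (fun _ => _) = fun y => u y * N1 i j + e y * N2 i j + v y * N3 i j).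
    by move=> y; apply: cvgD; first apply: cvgD; apply: cvgM; try exact: cvg_cst; [exact: uc|exact: ec|exact: vc].
  apply/funext => y; have -> : D (fun=> u y) (fun=> v y) (e y) g = u y *: N1 + e y *: N2 + v y *: N3.
    have gen c0 (X0 : 'M[scalars R F]_(r.+1 + s.+1)) : c0 *: (Q *m X0 *m Q') = Q *m (c0 *: X0) *m Q'.
      by rewrite -scalemxAr -scalemxAl.
    rewrite /N1 /N2 /N3 !gen -!mulmxDl -!mulmxDr.
    by rewrite !scale_block_mx !add_block_mx !scaler0 !addr0 !add0r.
  by rewrite !mxE.
have path1 (y : R) : exists sigma : hom_space V Gamma G,
    forall g, endo_mx (rep sigma g) = D (fun=> 1) (fun=> 1) (real_scalar R F y) g.
  apply: (deformed_rep (rho := rho)) => //; rewrite ?expr1n ?mulr1 //.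
  by right.
have [f1 f1E] := choice path1.
have f1_cont : continuous f1.
  apply: continuous_to_hom_space => g i j.
  rewrite (_ : (fun _ => _) = fun y => D (fun=> 1) (fun=> 1) (real_scalar R F y) g i j); last first.
    by apply/funext => y; rewrite f1E.
  apply: entry_cont; [by move=> z; exact: cvg_cst|by move=> z; exact: cvg_cst|exact: continuous_real_scalar].
have Cf10 : C (char_class H (f1 0)).
  apply: (@connected_component_path _ V Gamma G H R f1 x 1 0 f1_cont).
  have -> : f1 1 = rho; last by rewrite -cE.
  by apply: rep_inj => g; rewrite f1E rmorph1 /D deform_id.
pose cu (t : R) g := real_scalar R F (expR (t * s.+1%:R * (phi g)%:~R)).
pose cv (t : R) g := real_scalar R F (expR (- (t * r.+1%:R) * (phi g)%:~R)).
have path2 (t : R) : exists sigma : hom_space V Gamma G,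
    forall g, endo_mx (rep sigma g) = D (cu t) (cv t) 0 g.
  apply: (deformed_rep (rho := rho)) => //.
  - by move=> g h; rewrite /cu phiM rmorphD mulrDr expRD rmorphM.
  - by move=> g h; rewrite /cv phiM rmorphD mulrDr expRD rmorphM.
  - move=> g; rewrite /cu /cv -!rmorphXn -rmorphM -!expRM_natr -expRD.
    rewrite (_ : _ + _ = 0) ?expR0 ?rmorph1 //; ring.
  - by rewrite /cu (phi1 phiM) mulr0 expR0 rmorph1.
  - by rewrite /cv (phi1 phiM) mulr0 expR0 rmorph1.
  - by left.
have [f2 f2E] := choice path2.
have f2_cont : continuous f2.
  apply: continuous_to_hom_space => g i j.
  rewrite (_ : (fun _ => _) = fun t => D (fun=> cu t g) (fun=> cv t g) 0 g i j); last first.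
    by apply/funext => t; rewrite f2E.
  have ec (q : R) : continuous (fun t : R => real_scalar R F (expR (t * q))).
    move=> t; apply: (@continuous_comp _ _ _ (fun t : R => expR (t * q)) (real_scalar R F)); last exact: continuous_real_scalar.
    apply: (@continuous_comp _ _ _ (fun t : R => t * q) expR); last exact: continuous_expR.
    by apply: cvgM; [exact: cvg_id|exact: cvg_cst].
  apply: entry_cont; last by move=> z; exact: cvg_cst.
    rewrite (_ : (fun _ => _) = fun t => real_scalar R F (expR (t * (s.+1%:R * (phi g)%:~R)))); first exact: ec.
    by apply/funext => t; rewrite /cu mulrA.
  rewrite (_ : (fun _ => _) = fun t => real_scalar R F (expR (t * (- (r.+1%:R * (phi g)%:~R))))); first exact: ec.
  by apply/funext => t; rewrite /cv; congr (real_scalar R F (expR _)); ring.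
have Cf2 t : C (char_class H (f2 t)).
  apply: (@connected_component_path _ V Gamma G H R f2 x 0 t f2_cont).
  have -> : f2 0 = f1 0; last exact: Cf10.
  apply: rep_inj => g; rewrite f1E f2E rmorph0 /D /deform /cu /cv.
  by rewrite !mul0r oppr0 mul0r expR0 rmorph1.
(* The matrices of endomorphisms multiply in reverse order; transposition turns the blocks into
   homomorphisms and keeps their characteristic polynomials. *)
pose A g : 'M[R[i]]_r.+1 := (map_mx (complex_scalar R F) (sub_block M Q Q' g))^T.
pose B g : 'M[R[i]]_s.+1 := (map_mx (complex_scalar R F) (quot_block M Q Q' g))^T.
have [b1 _ b3] := blocks1 Q'Q M1 ur0.
have homA : matrix_hom A.
  split; first by rewrite /A b1 map_mx1 trmx1.
  by move=> g h; rewrite /A (sub_blockM QQ' MM ur0) map_mxM trmx_mul.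
have homB : matrix_hom B.
  split; first by rewrite /B b3 map_mx1 trmx1.
  by move=> g h; rewrite /B (quot_blockM QQ' MM ur0) map_mxM trmx_mul.
have [t tP] := twisted_no_gap phiM homA homB phia growth.
have [sigma [sE sA]] := allA _ (Cf2 t).
have anos : anosov Sigma (rep (f2 t)).
  apply: anosov_char_poly sA => g; apply/esym.
  exact: (h_equivalent_char_poly g (char_class_equivalent sE)).
have [|k [a0 [b0 [kn a00 gap]]]] := anosov_log_gap nE (X := twist_sub phi s A t) (Y := twist_quot phi r B t) _ anos.
  move=> g; rewrite f2E /D (char_poly_deform M QQ' Q'Q) rmorphM /= !map_char_poly !map_mxZ /=.
  rewrite /twist_sub /twist_quot /twist /A /B !char_poly_scale_tr.
  by rewrite /cu /cv !complex_real_scalar.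
exact: (tP k kn a0 b0 a00 gap).
Qed.
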